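(* Let $(D,X)$ be a Dyer system and let $Y,Y'\subseteq X$. The following conditions are equivalent: 1. there exists $\alpha\in D$ such that $\alpha D_Y\alpha^{-1}=D_{Y'}$; 2. there exists $\beta\in D$ such that $\beta Y\beta^{-1}=Y'$. Moreover, there exists an algorithm that, given a Dyer graph defining $(D,X)$ and the subsets $Y,Y'$, checks whether either of these two equivalent conditions is satisfied.
   Context: A Dyer graph is a finite simplicial graph $\Gamma$ with vertex set $V(\Gamma)$ and edge set $E(\Gamma)$, together with a vertex labelling $f\colon V(\Gamma)\to\mathbb{N}_{\geq 2}\cup\{\infty\}$ and an edge labelling $m\colon E(\Gamma)\to\mathbb{N}_{>2}\cup\{\infty\}$ such that for every edge $\{u,v\}\in E(\Gamma)$, if $f(v)\geq 3$ (including $f(v)=\infty$), then $m(u,v)=\infty$. The labelling $m$ is extended to all pairs of distinct vertices by $m(u,v)=2$ if $\{u,v\}\notin E(\Gamma)$. The associated Dyer group is $$D(\Gamma)=\langle V(\Gamma)\mid v^{f(v)}=1 \text{ for all } v \text{ with } f(v)<\infty,\ \underbrace{uvu\cdots}_{m(u,v)\text{ terms}}=\underbrace{vuv\cdots}_{m(u,v)\text{ terms}}\text{ for all } \{u,v\}\text{ with } m(u,v)\neq\infty\rangle.$$ A Dyer system is a pair $(D,X)$ where $D$ is a group and $X\subseteq D$ is a generating set such that there exist a Dyer graph $\Gamma$ and a group isomorphism $D(\Gamma)\to D$ mapping $V(\Gamma)$ bijectively onto $X$. For $Y\subseteq X$, $D_Y$ denotes the subgroup of $D$ generated by $Y$ (the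 standard parabolic subgroup associated with $Y$). *)

(* Defs.v *)
From HB Require Import structures.
From mathcomp Require Import all_boot.
From mathcomp Require Import boolp classical_sets functions.

Set Implicit Arguments.
Unset Strict Implicit.
Unset Printing Implicit Defensive.

Local Open Scope classical_set_scope.
Local Open Scope quotient_scope.

(* The letter [(v, false)] stands for the generator [v] and [(v, true)] for its
   formal inverse. A presentation is a relation [R] on words; [R u w] stands
   for the defining relation [u = w]. *)
Definition letter (V : Type) : Type := (V * bool)%type.
Definition word (V : Type) : Type := seq (letter V).

Definition inv_letter (V : Type) (a : letter V) : letter V := (a.1, ~~ a.2).
Definition inv_word (V : Type) (w : word V) : word V :=
  rev (map (@inv_letter V) w).

(* The least congruence on words containing [R] and the free cancellations. *)
Inductive pres_eq (V : Type) (R : word V -> word V -> Prop) :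
    word V -> word V -> Prop :=
| pres_rel u w : R u w -> pres_eq R u w
| pres_cancel a : pres_eq R [:: a; inv_letter a] [::]
| pres_refl w : pres_eq R w w
| pres_sym u w : pres_eq R u w -> pres_eq R w u
| pres_trans u w x : pres_eq R u w -> pres_eq R w x -> pres_eq R u x
| pres_cat u u' w w' :
    pres_eq R u u' -> pres_eq R w w' -> pres_eq R (u ++ w) (u' ++ w').

Section PresentedGroup.
Variables (V : choiceType) (R : word V -> word V -> Prop).

Definition pres_eqb : rel (word V) := fun u w => `[< pres_eq R u w >].

Lemma pres_eqb_equiv : equiv_class_of pres_eqb.
Proof.
split.
- by move=> w; apply/asboolP; apply: pres_refl.
- by move=> u w; apply/asboolP/asboolP; apply: pres_sym.
- move=> w u x /asboolP uw /asboolP wx; apply/asboolP.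
  exact: pres_trans uw wx.
Qed.

Canonical pres_equiv := EquivRelPack pres_eqb_equiv.

Definition pres_group : Type := {eq_quot pres_equiv}.

HB.instance Definition _ := Choice.on pres_group.
HB.instance Definition _ := Quotient.on pres_group.

Definition pres_class (w : word V) : pres_group := \pi_pres_group w.

Definition pres_mul (x y : pres_group) : pres_group :=
  pres_class (repr x ++ repr y).
Definition pres_one : pres_group := pres_class [::].
Definition pres_inv (x : pres_group) : pres_group :=
  pres_class (inv_word (repr x)).

Lemma pres_classP u w : pres_class u = pres_class w <-> pres_eq R u w.
Proof.
split=> [/eqP|uw]; first by rewrite eqquotE => /asboolP.
by apply/eqP; rewrite eqquotE; apply/asboolP.
Qed.

Lemma repr_pres_class w : pres_eq R (repr (pres_class w)) w.
Proof. by apply/pres_classP; rewrite /pres_class reprK. Qed.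

Lemma pres_class_repr x : pres_class (repr x) = x.
Proof. by rewrite /pres_class reprK. Qed.

Lemma inv_wordr (w : word V) : pres_eq R (w ++ inv_word w) [::].
Proof.
elim: w => [|a w IH]; first exact: pres_refl.
have -> : (a :: w) ++ inv_word (a :: w)
    = [:: a] ++ ((w ++ inv_word w) ++ [:: inv_letter a]).
  by rewrite /inv_word map_cons rev_cons -cats1 -catA.
apply: pres_trans (pres_cancel R a).
apply: (@pres_cat _ _ [:: a] [:: a]); first exact: pres_refl.
by apply: (@pres_cat _ _ _ [::]) => //; exact: pres_refl.
Qed.

Lemma inv_wordK : involutive (@inv_word V).
Proof.
move=> w; rewrite /inv_word map_rev revK -map_comp -[RHS]map_id.
by apply: eq_map => -[v b]; rewrite /= /inv_letter /= negbK.
Qed.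

Lemma inv_wordl (w : word V) : pres_eq R (inv_word w ++ w) [::].
Proof. by rewrite -{2}[w]inv_wordK; apply: inv_wordr. Qed.

Lemma pres_mulA : associative pres_mul.
Proof.
move=> x y z; apply/pres_classP.
apply: (@pres_trans _ _ _ (repr x ++ (repr y ++ repr z))).
  by apply: pres_cat; [exact: pres_refl | exact: repr_pres_class].
rewrite catA; apply: pres_cat; last exact: pres_refl.
by apply: pres_sym; exact: repr_pres_class.
Qed.

Lemma pres_mul1g : left_id pres_one pres_mul.
Proof.
move=> x; rewrite -[RHS]pres_class_repr; apply/pres_classP.
by apply: (@pres_cat _ _ _ [::]); [exact: repr_pres_class|exact: pres_refl].
Qed.

Lemma pres_mulg1 : right_id pres_one pres_mul.
Proof.
move=> x; rewrite -[RHS]pres_class_repr; apply/pres_classP.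
rewrite -[X in pres_eq _ _ X]cats0.
by apply: pres_cat; [exact: pres_refl|exact: repr_pres_class].
Qed.

Lemma pres_mulVg : left_inverse pres_one pres_inv pres_mul.
Proof.
move=> x; apply/pres_classP; apply: pres_trans (inv_wordl (repr x)).
by apply: pres_cat; [exact: repr_pres_class|exact: pres_refl].
Qed.

Lemma pres_mulgV : right_inverse pres_one pres_inv pres_mul.
Proof.
move=> x; apply/pres_classP; apply: pres_trans (inv_wordr (repr x)).
by apply: pres_cat; [exact: pres_refl|exact: repr_pres_class].
Qed.

HB.instance Definition _ := isGroup.Build pres_group
  pres_mulA pres_mul1g pres_mulg1 pres_mulVg pres_mulgV.

Definition pres_gen (v : V) : pres_group := pres_class [:: (v, false)].

End PresentedGroup.

(* [None] is the label infinity. *)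
Definition label : Type := option nat.

Definition label_geq (l : label) (k : nat) : bool :=
  if l is Some n then k <= n else true.

(* The edge labelling is a function of two vertices whose values are only
   meaningful on adjacent pairs. *)
Record dyerGraph (V : finType) := DyerGraph {
  adj : rel V;
  vlabel : V -> label;
  elabel : V -> V -> label;
  adj_sym : symmetric adj;
  adj_irr : irreflexive adj;
  vlabel_geq2 : forall v, label_geq (vlabel v) 2;
  elabel_sym : forall u v, adj u v -> elabel u v = elabel v u;
  elabel_gt2 : forall u v, adj u v -> label_geq (elabel u v) 3;
  dyer_cond : forall u v,
    adj u v -> label_geq (vlabel v) 3 -> elabel u v = None
}.

Definition mlabel (V : finType) (G : dyerGraph V) (u v : V) : label :=
  if adj G u v then elabel G u v else Some 2.

(* The positive word [u v u ...] with [k] letters. *)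
Definition alt_word (V : Type) (k : nat) (u v : V) : word V :=
  mkseq (fun i => (if odd i then v else u, false)) k.

Inductive dyer_rel (V : finType) (G : dyerGraph V) :
    word V -> word V -> Prop :=
| dyer_power v k :
    vlabel G v = Some k -> dyer_rel G (nseq k (v, false)) [::]
| dyer_braid u v k : u != v -> mlabel G u v = Some k ->
    dyer_rel G (alt_word k u v) (alt_word k v u).

Definition dyer_group (V : finType) (G : dyerGraph V) : groupType :=
  pres_group (dyer_rel G).

Definition dyer_gen (V : finType) (G : dyerGraph V) (v : V) : dyer_group G :=
  pres_gen (dyer_rel G) v.

Definition is_subgroup (D : groupType) (H : set D) : Prop :=
  H 1%g /\ forall x y, H x -> H y -> H (x * y^-1)%g.

Definition generated (D : groupType) (Y : set D) : set D :=
  smallest (@is_subgroup D) Y.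

Definition conj_set (D : groupType) (a : D) (Y : set D) : set D :=
  [set (a * y * a^-1)%g | y in Y].

(* [phi] exhibits [G] as a Dyer graph defining [(D, X)]. *)
Definition dyer_defines (V : finType) (G : dyerGraph V) (D : groupType)
    (X : set D) (phi : dyer_group G -> D) : Prop :=
  [/\ {morph phi : x y / (x * y)%g}, bijective phi
    & set_bij [set: V] X (phi \o @dyer_gen V G)].

Definition dyer_system (D : groupType) (X : set D) : Prop :=
  generated X = [set: D] /\
  exists (V : finType) (G : dyerGraph V) (phi : dyer_group G -> D),
    dyer_defines X phi.

Definition conj_parabolic (D : groupType) (Y Y' : set D) : Prop :=
  exists a : D, conj_set a (generated Y) = generated Y'.

Definition conj_subset (D : groupType) (Y Y' : set D) : Prop :=
  exists b : D, conj_set b Y = Y'.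

(* Partial recursive functions in the sense of Kleene: the model of computation
   in which algorithms are expressed. *)
Inductive recfun : nat -> Type :=
| rf_zero n : recfun n
| rf_succ : recfun 1
| rf_proj n : 'I_n -> recfun n
| rf_comp k n : recfun k -> ('I_k -> recfun n) -> recfun n
| rf_prim n : recfun n -> recfun n.+2 -> recfun n.+1
| rf_min n : recfun n.+1 -> recfun n.

(* [rf_eval p a y]: on the arguments [a], the computation of [p] halts with
   result [y].  In the primitive recursion case, [w i] is the value of the
   function at [i]; in the minimisation case, all the values before the first
   zero have to be defined. *)
Fixpoint rf_eval (n : nat) (p : recfun n) : n.-tuple nat -> nat -> Prop :=
  match p in recfun n return n.-tuple nat -> nat -> Prop with
  | rf_zero n => fun _ y => y = 0
  | rf_succ => fun a y => y = (thead a).+1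
  | rf_proj n i => fun a y => y = tnth a i
  | rf_comp k n g h => fun a y =>
      exists2 b : k.-tuple nat,
        forall i, rf_eval (h i) a (tnth b i) & rf_eval g b y
  | rf_prim n g h => fun a y =>
      let x := thead a in
      let a' : n.-tuple nat := [tuple of behead a] in
      exists w : nat -> nat,
        [/\ rf_eval g a' (w 0),
            forall i, i < x -> rf_eval h [tuple of i :: w i :: a'] (w i.+1)
          & y = w x]
  | rf_min n g => fun a y =>
      rf_eval g [tuple of y :: a] 0 /\
      forall x, x < y -> exists z, rf_eval g [tuple of x :: a] z.+1
  end.

Definition label_code (l : label) : nat := if l is Some n then n else 0.

(* The input of the algorithm: for a listing [vs] of the vertices, the number
   of vertices, the vertex labels, the matrix of extended edge labels row by
   row, and the indicator functions of the two vertex subsets; infinity is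
   coded by 0 (which is not the value of a label), non-adjacency by 2. *)
Definition dyer_input (V : finType) (G : dyerGraph V) (vs : seq V)
    (A A' : {set V}) : seq nat :=
  size vs :: [seq label_code (vlabel G v) | v <- vs]
    ++ [seq label_code (mlabel G u v) | u <- vs, v <- vs]
    ++ [seq nat_of_bool (v \in A) | v <- vs]
    ++ [seq nat_of_bool (v \in A') | v <- vs].

Definition dyer_code (V : finType) (G : dyerGraph V) (vs : seq V)
    (A A' : {set V}) : nat :=
  CodeSeq.code (dyer_input G vs A A').

(* Main.v *)
Require Import Defs.
From HB Require Import structures.
From mathcomp Require Import all_boot all_order all_algebra.
From mathcomp Require Import ring lra zify.
From mathcomp Require Import Rstruct.
From mathcomp Require Import boolp classical_sets functions reals trigo.

(** Sending each generator [v] to the product of two reflections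
[(v, false)] and [(v, true)] maps the Dyer group to a Coxeter group, where an
element conjugating one standard parabolic subgroup to another must carry the
span of the corresponding simple roots to the other span.  An element of
minimal length in the double coset then permutes simple roots, and its letters
commute with every generator of order at least 3 in [Y]; forgetting the other
reflections gives an element of the Dyer group conjugating [Y] to [Y'].

For the algorithm, such an element is a product of elementary conjugations,
each inside a parabolic subgroup with one more generator [s].  The inversions of
an elementary conjugation are exactly the positive roots involving [s], so
there are finitely many of them.  Two of them congruent modulo 3 in a lattice
over a ring of cyclotomic integers are equal, because the principal congruence
subgroup of level 3 has no torsion; this bounds the length explicitly.  With a
bounded length, and Tits' length-nonincreasing solution of the word problem,
conjugacy becomes a formula with bounded quantifiers. *)
Set Implicit Arguments.
Unset Strict Implicit.
Unset Printing Implicit Defensive.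
Import Order.TTheory GRing.Theory Num.Theory.

Local Open Scope ring_scope.

(** * Chebyshev recurrence and cosines *)

(** The homomorphism to the doubled Coxeter group is never shown to be injective. What returns to
    the Dyer group is a chain of Tits moves over generators of order 2, where every such move is a
    Dyer relation.

    The obstacle on the way there is that the Dyer group only sees the rotation attached to a
    vertex, not its two reflections. The rotation displaces vectors within the plane of the two
    simple roots. As the Gram determinant of that plane is nonzero, the displacements recover both
    roots.

    Torsion appears in the length bound as follows. For two inversions [b], [c] of an elementary
    conjugation, let [T] be the product of their reflections. Iterates of [b] under [T] with nonzero
    [s]-coordinate are inversions up to sign. Those with zero [s]-coordinate lie on one line of the
    plane of [b] and [c], so the orbit is finite. Level 3 suffices because [T - 1] gains a factor 3
    on the lattice: if [1 + T + T^2] kills [v], then [-3 T v = (T - 1)^2 v] gains two factors and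
    loses one. Level 2 would admit [T = -1]. *)

Fixpoint chb (R : pzRingType) (x : R) (k : nat) : R :=
  if k is k'.+1 then
    if k' is j.+1 then x * chb x k' - chb x j else 1
  else 0.

Lemma chbSS (R : pzRingType) (x : R) k :
  chb x k.+2 = x * chb x k.+1 - chb x k.
Proof. by []. Qed.

(* The value at infinity may be any real number [> 2]; at [2] the form would
   degenerate on the plane spanned by two simple roots. *)
Definition cval (R : realType) (l : option nat) : R :=
  if l is Some k then 2 * cos (pi / k%:R) else 3.

Section Cval.
Variable R : realType.

Lemma chb3_ge (k : nat) : 0 <= chb (3 : R) k /\ chb (3 : R) k + 1 <= chb 3 k.+1.
Proof.
elim: k => [|k [h0 h1]]; first by split; rewrite ?add0r.
split; first by lra.
by rewrite chbSS; move: (chb _ k.+1) (chb _ k) h0 h1 => a b; lra.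
Qed.

Lemma chb_inf_gt0 k : 0 < chb (cval R None) k.+1.
Proof. by have [h0 h1] := chb3_ge k; apply: lt_le_trans h1; rewrite ltr_wpDl. Qed.

(** These are rescaled Chebyshev polynomials of the second kind. The signs and zeros of the
    coefficients in a dihedral root system are read off from the sine. *)
Lemma sin_chb (t : R) k : sin t * chb (2 * cos t) k = sin (t *+ k).
Proof.
suff: sin t * chb (2 * cos t) k = sin (t *+ k) /\
      sin t * chb (2 * cos t) k.+1 = sin (t *+ k.+1) by case.
elim: k => [|k [h0 h1]]; first by rewrite mulr0n sin0 mulr0 mulr1n mulr1.
split=> //; rewrite chbSS mulrBr h0 mulrCA h1.
have -> : t *+ k = t *+ k.+1 - t by rewrite mulrSr addrK.
by rewrite [t *+ k.+2]mulrSr !sinD sinN cosN; ring.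
Qed.

Lemma sin_pi_div_gt0 k : (1 < k)%N -> 0 < sin (pi / k%:R : R).
Proof.
move=> k1; have k0 : 0 < k%:R :> R by rewrite ltr0n; exact: ltnW.
apply: sin_gt0_pi; rewrite divr_gt0 ?pi_gt0 //=.
by rewrite ltr_pdivrMr // ltr_pMr ?pi_gt0 // ltr1n.
Qed.

Lemma chb_cval0 k : (1 < k)%N -> chb (cval R (Some k)) k = 0.
Proof.
move=> k1; have s0 := sin_pi_div_gt0 k1.
apply: (mulfI (lt0r_neq0 s0)); rewrite sin_chb mulr0.
have -> : pi / k%:R *+ k = pi :> R; last exact: sinpi.
by rewrite -[LHS]mulr_natr divfK // pnatr_eq0 -lt0n ltnW.
Qed.

Lemma chb_cval_ge0 k j : (1 < k)%N -> (j <= k)%N -> 0 <= chb (cval R (Some k)) j.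
Proof.
move=> k1 jk; have s0 := sin_pi_div_gt0 k1.
have k0 : 0 < k%:R :> R by rewrite ltr0n ltnW.
rewrite -(pmulr_rge0 _ s0) sin_chb; apply: sin_ge0_pi.
rewrite mulrn_wge0 ?divr_ge0 ?pi_ge0 ?ler0n //=.
by rewrite -[_ *+ j]mulr_natr mulrAC ler_pdivrMr // ler_wpM2l ?pi_ge0 // ler_nat.
Qed.

Lemma cval2 : cval R (Some 2) = 0.
Proof. by rewrite /cval cos_pihalf mulr0. Qed.

(** The Gram determinant of two simple roots is [4 - c ^+ 2], with [c] the value of their label;
    [conj_span] divides by it. *)
Lemma cval_sqr_neq4 l : (if l is Some k then 1 < k else true)%N ->
  cval R l ^+ 2 != 4.
Proof.
case: l => [k|_]; last by apply/eqP => /= ?; lra.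
move=> k1; have s0 := sin_pi_div_gt0 k1; apply/eqP => /= h.
have := cos2Dsin2 (pi / k%:R : R); move: h s0; rewrite exprMn.
by move=> h s0 e; have := exprn_gt0 2 s0; lra.
Qed.

End Cval.

(** * The geometric representation of a Coxeter group *)

Record coxeterMatrix (S : Type) := CoxeterMatrix {
  cm :> S -> S -> option nat;
  cm_sym : forall s t, cm s t = cm t s;
  cm_gt1 : forall s t, s <> t -> if cm s t is Some k then (1 < k)%N else true
}.

Fixpoint ralt (S : Type) (k : nat) (t s : S) : seq S :=
  if k is k'.+1 then rcons (ralt k' s t) t else [::].

Lemma size_ralt (S : Type) k (t s : S) : size (ralt k t s) = k.
Proof. by elim: k t s => //= k IH t s; rewrite size_rcons IH. Qed.

Section GeometricRepresentation.
Variables (R : realType) (S : finType) (m : coxeterMatrix S).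

Notation V := {ffun S -> R^o}.
Implicit Types (s t : S) (u v : V) (w : seq S) (K I J Q : pred S).

Definition cc s t : R := cval R (m s t).
(** Twice the usual Gram matrix: with simple roots of square 2 the reflections involve no division,
    so coordinates of roots stay in the ring generated by the numbers [cc]. *)
Definition kf s t : R := if s == t then 2 else - cc s t.
Definition bf u v : R := \sum_s \sum_t (u s : R) * (v t : R) * kf s t.
Definition sroot s : V := [ffun t => (t == s)%:R].
Definition prj s v : R := bf v (sroot s).
Definition refl s v : V := v - prj s v *: sroot s.
(** The rightmost letter acts first. No Coxeter group is formed: two words stand for the same
    element when their actions agree as functions. *)
Definition act w v : V := foldr refl v w.

Lemma vZE a v t : (a *: v) t = a * v t.
Proof. by rewrite ffunE. Qed.

Lemma ccC s t : cc s t = cc t s. Proof. by rewrite /cc cm_sym. Qed.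

Lemma bfC u v : bf u v = bf v u.
Proof.
rewrite /bf exchange_big; apply: eq_bigr => s _; apply: eq_bigr => t _.
by rewrite /kf eq_sym ccC [u _ * _]mulrC.
Qed.

Lemma bfDl u u' v : bf (u + u') v = bf u v + bf u' v.
Proof.
rewrite /bf -big_split; apply: eq_bigr => s _; rewrite -big_split.
by apply: eq_bigr => t _; rewrite ffunE !mulrDl.
Qed.

Lemma bfZl a u v : bf (a *: u) v = a * bf u v.
Proof.
rewrite /bf mulr_sumr; apply: eq_bigr => s _; rewrite mulr_sumr.
by apply: eq_bigr => t _; rewrite vZE -!mulrA.
Qed.

Lemma bfDr u v v' : bf u (v + v') = bf u v + bf u v'.
Proof. by rewrite bfC bfDl ![bf _ u]bfC. Qed.

Lemma bfZr a u v : bf u (a *: v) = a * bf u v.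
Proof. by rewrite bfC bfZl bfC. Qed.

Lemma bfNl u v : bf (- u) v = - bf u v.
Proof. by rewrite -scaleN1r bfZl mulN1r. Qed.

Lemma bfNr u v : bf u (- v) = - bf u v.
Proof. by rewrite bfC bfNl bfC. Qed.

Lemma prjE s v : prj s v = \sum_t v t * kf t s.
Proof.
rewrite /prj /bf; apply: eq_bigr => t _; rewrite (bigD1 s) //= ffunE eqxx mulr1.
by rewrite big1 ?addr0 // => i /negPf is_; rewrite ffunE is_ mulr0 mul0r.
Qed.

Lemma prjD s u v : prj s (u + v) = prj s u + prj s v.
Proof. exact: bfDl. Qed.
Lemma prjZ s a v : prj s (a *: v) = a * prj s v.
Proof. exact: bfZl. Qed.
Lemma prjN s v : prj s (- v) = - prj s v.
Proof. exact: bfNl. Qed.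

Lemma prj_sroot s t : prj s (sroot t) = kf t s.
Proof.
rewrite prjE (bigD1 t) //= ffunE eqxx mul1r.
by rewrite big1 ?addr0 // => i /negPf it; rewrite ffunE it mul0r.
Qed.

Lemma sroot_diag s : bf (sroot s) (sroot s) = 2.
Proof. by rewrite -/(prj s _) prj_sroot /kf eqxx. Qed.

Lemma refl_sroot s : refl s (sroot s) = - sroot s.
Proof.
by rewrite /refl prj_sroot /kf eqxx scaler_nat mulr2n opprD addNKr.
Qed.

Lemma reflD s u v : refl s (u + v) = refl s u + refl s v.
Proof. by rewrite /refl prjD scalerDl opprD addrACA. Qed.

Lemma reflZ s a v : refl s (a *: v) = a *: refl s v.
Proof. by rewrite /refl prjZ -scalerA -scalerBr. Qed.

Lemma reflK s : involutive (refl s).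
Proof.
move=> v; rewrite {1}/refl /refl prjD prjN prjZ prj_sroot /kf eqxx.
rewrite -[X in _ - X - _]/(_ *: _) -addrA -opprD -scalerDl.
have -> : prj s v + (prj s v - prj s v * 2) = 0 by ring.
by rewrite scale0r subr0.
Qed.

Lemma bf_refl s u v : bf (refl s u) (refl s v) = bf u v.
Proof.
rewrite /refl !(bfDl, bfDr, bfNl, bfNr, bfZl, bfZr) sroot_diag.
by rewrite [bf (sroot s) v]bfC -/(prj s u) -/(prj s v); ring.
Qed.

Lemma reflE s v t : t != s -> refl s v t = v t.
Proof. by move=> /negPf ts; rewrite !ffunE ts scaler0 subr0. Qed.

Lemma act_cat w1 w2 v : act (w1 ++ w2) v = act w1 (act w2 v).
Proof. exact: foldr_cat. Qed.

Lemma act_rcons w s v : act (rcons w s) v = act w (refl s v).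
Proof. by rewrite -cats1 act_cat. Qed.

Lemma act_cons s w v : act (s :: w) v = refl s (act w v).
Proof. by []. Qed.

Lemma actD w u v : act w (u + v) = act w u + act w v.
Proof. by elim: w => //= s w ->; rewrite reflD. Qed.

Lemma actZ w a v : act w (a *: v) = a *: act w v.
Proof. by elim: w => //= s w ->; rewrite reflZ. Qed.

Lemma actN w v : act w (- v) = - act w v.
Proof. by rewrite -scaleN1r actZ scaleN1r. Qed.

Lemma act0 w : act w 0 = 0.
Proof. by have := actZ w 0 0; rewrite !scale0r. Qed.

Lemma act_sum w (T : Type) (r : seq T) (P : pred T) (F : T -> V) :
  act w (\sum_(i <- r | P i) F i) = \sum_(i <- r | P i) act w (F i).
Proof. exact: (big_morph _ (actD w) (act0 w)). Qed.

Lemma act_revK w v : act (rev w) (act w v) = v.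
Proof.
elim: w v => //= s w IH v.
by rewrite rev_cons act_rcons reflK IH.
Qed.

Lemma act_Krev w v : act w (act (rev w) v) = v.
Proof. by rewrite -{1}[w]revK act_revK. Qed.

Lemma act_inj w : injective (act w).
Proof. exact: can_inj (act_revK w). Qed.

Lemma bf_act w u v : bf (act w u) (act w v) = bf u v.
Proof. by elim: w => //= s w <-; rewrite bf_refl. Qed.

Lemma root_diag w s : bf (act w (sroot s)) (act w (sroot s)) = 2.
Proof. by rewrite bf_act sroot_diag. Qed.

Lemma act_refl w s v :
  act w (refl s v) = act w v - bf (act w v) (act w (sroot s)) *: act w (sroot s).
Proof. by rewrite actD actN actZ bf_act. Qed.

(** Conjugating the reflection in [sroot s] by [w] gives the reflection in its image. *)
Lemma act_sroot w s t : act w (sroot s) = sroot t ->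
  act (rcons w s) =1 act (t :: w).
Proof. by move=> h v; rewrite act_rcons act_refl h. Qed.

Lemma eq_act_rev w w' : act w =1 act w' -> act (rev w) =1 act (rev w').
Proof.
by move=> h v; apply: (@act_inj w); rewrite act_Krev h act_Krev.
Qed.

(** * Alternating words and the braid relations *)

Fixpoint chb_sum (b : bool) (x : R) k : R :=
  if k is k'.+1 then (if odd k == b then chb x k else 0) + chb_sum b x k'
  else 0.

Lemma chb_sumE b (x : R) k :
  chb_sum b x k.+1 = (if odd k.+1 == b then chb x k.+1 else 0) + chb_sum b x k.
Proof. by []. Qed.

Lemma chb_sumS (x : R) k :
  chb_sum true x k.+2 + chb_sum true x k = x * chb_sum false x k.+1 + 1 /\
  chb_sum false x k.+2 + chb_sum false x k = x * chb_sum true x k.+1.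
Proof.
elim: k => [|k [h1 h2]]; first by split=> /=; ring.
move: h1 h2; rewrite !chb_sumE (chbSS x k.+1) !oddS.
move: (chb x k.+2) (chb x k.+1) (chb_sum true x k) (chb_sum false x k).
by move=> a b c d; case: (odd k) => /= h1 h2; split; lra.
Qed.

(** A closed form on all vectors, not only on the plane of the two roots, so that the braid
    relations need no orthogonal decomposition. The two letters contribute alternately, hence the
    sums of [chb] over indices of one parity. *)
Lemma act_ralt k s t (v : V) : s != t ->
  let c := cc s t in let x := prj t v in let y := prj s v in
  act (ralt k t s) v = v
    - (chb_sum true c k * x + chb_sum false c k.-1 * y) *: sroot t
    - (chb_sum false c k * x + chb_sum true c k.-1 * y) *: sroot s.
Proof.
elim: k s t v => [|k IH] s t v st c x y.
  rewrite /=; by rewrite !mul0r !addr0 !scale0r !subr0.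
rewrite [ralt _ _ _]/= act_rcons IH 1?eq_sym // ccC -/c [k.+1.-1]/=.
have px : prj t (refl t v) = - x.
  by rewrite /refl prjD prjN prjZ prj_sroot /kf eqxx -/x; ring.
have py : prj s (refl t v) = y + c * x.
  rewrite /refl prjD prjN prjZ prj_sroot /kf eq_sym (negPf st) -/x -/y ccC -/c.
  by ring.
rewrite px py {px py}.
have [e1 e2] : chb_sum true c k.+1 = c * chb_sum false c k + 1 - chb_sum true c k.-1
    /\ chb_sum false c k.+1 = c * chb_sum true c k - chb_sum false c k.-1.
  case: k {IH} => [|k]; first by split=> /=; ring.
  by have [<- <-] := chb_sumS c k; rewrite !addrK.
rewrite e1 e2.
apply/ffunP => r; rewrite /refl -/x !ffunE.
rewrite -![_ *: (_ : R^o)]/(_ * _ : R).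
move: (_%:R : R) (_%:R : R) => a b; move: (v r : R) => z.
by rewrite -![@GRing.add _ _ _]/(_ + _ : R); ring.
Qed.

(** Since [chb] vanishes at [k], the parity sums up to [k] and up to [k.-1] coincide, and the closed
    form of [act_ralt] becomes symmetric in [s] and [t]. *)
Lemma act_braid k s t : s != t -> m s t = Some k ->
  act (ralt k t s) =1 act (ralt k s t).
Proof.
move=> st mst v; rewrite !act_ralt 1?[t == s]eq_sym // (ccC t s).
have k1 : (1 < k)%N by have := cm_gt1 m (elimN eqP st); rewrite mst.
have c0 : chb (cc s t) k = 0 by rewrite /cc mst chb_cval0.
have e b : chb_sum b (cc s t) k = chb_sum b (cc s t) k.-1.
  by case: (k) c0 k1 => // j c0 _; rewrite chb_sumE c0 if_same add0r.
rewrite !e -!addrA; congr (_ + _); rewrite addrC.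
by congr (- (_ *: _) + - (_ *: _)); ring.
Qed.

(** The index [j] makes the induction on [k] run: each letter advances the pair of coefficients by
    one step of the recurrence. *)
Lemma act_ralt_chb k j s t : s != t ->
  let c := cc s t in
  act (ralt k t s) (chb c j.+1 *: sroot s + chb c j *: sroot t) =
    chb c (j + k).+1 *: sroot (if odd k then t else s) +
    chb c (j + k) *: sroot (if odd k then s else t).
Proof.
elim: k j s t => [|k IH] j s t st c; first by rewrite addn0.
rewrite [ralt _ _ _]/= act_rcons reflD !reflZ refl_sroot /refl prj_sroot.
rewrite /kf (negPf st) -/c.
have -> : chb c j.+1 *: (sroot s - - c *: sroot t) + chb c j *: - sroot t =
    chb c j.+2 *: sroot t + chb c j.+1 *: sroot s.
  rewrite chbSS scaleNr opprK scalerDr scalerA scalerN scalerBl [c * _]mulrC.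
  by rewrite -addrA addrC.
by rewrite /c ccC IH 1?eq_sym // addSnnS /=; case: (odd k).
Qed.

Lemma act_ralt_sroot k s t : s != t ->
  act (ralt k t s) (sroot s) =
    chb (cc s t) k.+1 *: sroot (if odd k then t else s) +
    chb (cc s t) k *: sroot (if odd k then s else t).
Proof. by move=> st; rewrite -(act_ralt_chb k 0 st) scale1r scale0r addr0. Qed.

Lemma chb_ge0_lt s t k : s != t ->
  (if m s t is Some j then k < j else true)%N ->
  0 <= chb (cc s t) k /\ 0 <= chb (cc s t) k.+1.
Proof.
move=> st; case mst: (m s t) => [j|] kj; rewrite /cc mst; last first.
  split; last exact/ltW/chb_inf_gt0.
  by case: (k) => // k'; exact/ltW/chb_inf_gt0.
have j1 : (1 < j)%N by have := cm_gt1 m (elimN eqP st); rewrite mst.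
by rewrite !chb_cval_ge0 // ltnW.
Qed.

Lemma all_ralt Q k s t : Q s -> Q t -> all Q (ralt k t s).
Proof. by elim: k s t => //= k IH s t Qs Qt; rewrite all_rcons Qt IH. Qed.

Definition pos v := forall t, 0 <= v t :> R.

Lemma posD u v : pos u -> pos v -> pos (u + v).
Proof. by move=> hu hv t; rewrite ffunE addr_ge0 ?hu ?hv. Qed.

Lemma posZ a v : 0 <= a -> pos v -> pos (a *: v).
Proof. by move=> ha hv t; rewrite vZE mulr_ge0 ?hv. Qed.

Lemma pos_sroot s : pos (sroot s).
Proof. by move=> t; rewrite ffunE ler0n. Qed.

Lemma pos_anti v : pos v -> pos (- v) -> v = 0.
Proof.
move=> h1 h2; apply/ffunP => t; rewrite ffunE; apply/le_anti/andP; split.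
  by have := h2 t; rewrite ffunE oppr_ge0.
exact: h1.
Qed.

Lemma bf0l u : bf 0 u = 0.
Proof. by rewrite -(scale0r u) bfZl mul0r. Qed.

Lemma root_neq0 w s : act w (sroot s) <> 0.
Proof.
by move=> h; have := root_diag w s; rewrite h bf0l => /eqP; rewrite eq_sym pnatr_eq0.
Qed.

Lemma sroot_inj : injective sroot.
Proof.
move=> s t /ffunP /(_ s); rewrite !ffunE eqxx.
by case: eqP => // _ /eqP; rewrite oner_eq0.
Qed.

(** * Reduced words and signs of roots *)

Definition reduced w := forall w', act w' =1 act w -> (size w <= size w')%N.

Lemma exists_reduced w : exists2 w', act w' =1 act w & reduced w'.
Proof.
have ex : exists n, `[< exists2 w', act w' =1 act w & size w' = n >].
  by exists (size w); apply/asboolP; exists w.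
have [n /asboolP[w' ew' <-] hmin] := ex_minnP ex; exists w' => // w'' ew''.
by apply: hmin; apply/asboolP; exists w'' => // v; rewrite ew'' ew'.
Qed.

Lemma act_ss s w : act (s :: s :: w) =1 act w.
Proof. by move=> v; rewrite !act_cons reflK. Qed.

Lemma act_rcons2 w s : act (rcons (rcons w s) s) =1 act w.
Proof. by move=> v; rewrite !act_rcons reflK. Qed.

Lemma eq_act_rcons w w' s : act w =1 act w' -> act (rcons w s) =1 act (rcons w' s).
Proof. by move=> h v; rewrite !act_rcons h. Qed.

Lemma dihedral_word s t w : all (pred2 s t) w ->
  exists k a b, [/\ (a = s /\ b = t) \/ (a = t /\ b = s), (k <= size w)%N
    & act w =1 act (ralt k a b)].
Proof.
elim/last_ind: w => [_|w r IH]; first by exists 0, s, t; split=> //; left.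
rewrite all_rcons => /andP[hr /IH[k [a [b [hab kw e]]]]]; rewrite size_rcons.
have {hr} [ra|rb] : r = a \/ r = b.
- by case/orP: hr hab => /eqP-> [] [-> ->]; tauto.
- case: k kw e => [|k] kw e.
    by exists 1, a, b; split=> //; rewrite ra; apply: (eq_act_rcons (w' := [::])).
  exists k, b, a; split; first by tauto.
    by rewrite (leq_trans _ (leqnSn _)) // ltnW.
  by move=> v; rewrite ra (eq_act_rcons _ e) act_rcons2.
- by exists k.+1, b, a; split=> //; [tauto|rewrite rb; apply: eq_act_rcons].
Qed.

Lemma ralt_split i j (t s : S) : exists2 p, size p = i & ralt (i + j) t s = p ++ ralt j t s.
Proof.
elim: j t s => [|j IH] t s.
  by rewrite addn0; exists (ralt i t s); rewrite ?size_ralt ?cats0.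
have [p hp e] := IH s t; exists p => //.
by rewrite addnS /= e rcons_cat.
Qed.

(** With [t] the last letter of [w], a maximal factor in the letters [s], [t] is split off at the
    right. By induction the remaining factor sends both simple roots to positive ones, and the
    dihedral factor sends [sroot s] to a nonnegative combination of them. *)
Lemma root_pos_of_length n w s : (size w < n)%N -> reduced w ->
  (forall u : seq S, act u =1 act (rcons w s) -> (size w <= size u)%N) ->
  pos (act w (sroot s)).
Proof.
elim: n w s => // n IH w s; rewrite ltnS => wn red hs.
case: (lastP w) wn red hs => [|w0 t] wn red hs; first exact: pos_sroot.
have st : s != t.
  apply: contraT => /negPn/eqP ts; have := hs w0; rewrite size_rcons ltnn.
  by apply=> v; rewrite ts act_rcons2.
move ew0: (rcons w0 t) wn red hs => w' wn red hs.
have sw : size w' = (size w0).+1 by rewrite -ew0 size_rcons.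
(* Length-additive factorisations with a dihedral right factor; the left factor [v] is then taken as
   short as possible. *)
pose fac (v : seq S) := exists x, [/\ all (pred2 s t) x, (size v + size x = size w')%N
                         & act (v ++ x) =1 act w'].
have ex : exists i, `[< exists2 v : seq S, fac v & size v = i >].
  exists (size w0); apply/asboolP; exists w0 => //; exists [:: t].
  by rewrite /= eqxx orbT addn1 sw cats1 ew0.
have [i /asboolP[v [x [xst svx evx]] vi] hmin] := ex_minnP ex.
have vw : (size v < size w')%N.
  rewrite vi sw ltnS; apply: hmin; apply/asboolP; exists w0 => //.
  by exists [:: t]; rewrite /= eqxx orbT addn1 sw cats1 ew0.
have redv : reduced v.
  move=> u eu; rewrite -(leq_add2r (size x)) svx -size_cat; apply: red => z.
  by rewrite act_cat eu -act_cat evx.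
(* If [r] shortened [v], moving it into the dihedral factor would contradict the choice of [v]. *)
have posv r : pred2 s t r -> pos (act v (sroot r)).
  move=> hr; apply: IH => //; first exact: leq_trans vw wn.
  move=> u eu; rewrite leqNgt; apply/negP => uv.
  have eux : act (u ++ r :: x) =1 act w'.
    by move=> z; rewrite act_cat eu act_rcons -act_cons act_ss -act_cat evx.
  have := red _ eux; rewrite size_cat /= -svx addnS -addSn leq_add2r => vu.
  suff : (i <= size u)%N by rewrite -vi leqNgt uv.
  apply: hmin; apply/asboolP; exists u => //; exists (r :: x); split=> //.
    exact/andP.
  by rewrite /= addnS -addSn -svx; congr (_ + _)%N; apply/eqP; rewrite eqn_leq uv vu.
have [k [a [b [hab kx ex']]]] := dihedral_word xst.
have ew : act (v ++ ralt k a b) =1 act w'.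
  by move=> z; rewrite act_cat -ex' -act_cat evx.
(* A dihedral factor ending in [s] would make the product with [s] shorter than [w'], against
   [hs]. *)
have nos y : act (v ++ rcons y s) =1 act w' -> (size y < k)%N -> False.
  move=> ey yk; have : (size w' <= size (v ++ y))%N.
    by apply: hs => z; rewrite act_rcons -ey !act_cat act_rcons reflK.
  by rewrite size_cat -svx leq_add2l leqNgt (leq_trans yk kx).
have hk : k = 0 \/ a = t /\ b = s.
  case: hab => [[as_ bt]|]; last by right.
  by left; case: k kx ex' ew nos => // k kx ex' ew /(_ (ralt k b a)); rewrite -as_ size_ralt; case.
have {hab hk ew} ew : act (v ++ ralt k t s) =1 act w'.
  by case: hk ew => [->|[-> ->]].
(* The dihedral factor is shorter than the label of the pair: otherwise a braid relation would make
   it end in [s], which [nos] excludes. *)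
have [p0 p1] : 0 <= chb (cc s t) k /\ 0 <= chb (cc s t) k.+1.
  apply: chb_ge0_lt => //; case mst: (m s t) => [j|] //.
  have j1 : (1 < j)%N by have := cm_gt1 m (elimN eqP st); rewrite mst.
  rewrite ltnNge; apply/negP => jk.
  have [p sp e] := ralt_split (k - j) j t s.
  rewrite subnK // in e; case: j jk j1 mst sp e => // j jk j1 mst sp e.
  apply: (nos (p ++ ralt j t s)).
    move=> z; rewrite -ew e -cats1 -catA cats1 -[rcons _ s]/(ralt j.+1 s t).
    by rewrite !act_cat (act_braid st mst).
  by rewrite size_cat sp size_ralt; lia.
rewrite -ew act_cat act_ralt_sroot // actD !actZ.
by apply: posD; apply: posZ => //; apply: posv; rewrite /=; case: odd; rewrite eqxx ?orbT.
Qed.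

(** Either appending [s] does not shorten [w], or [root_pos_of_length] applies to a reduced form of
    the product, which sends [sroot s] to the opposite root. *)
Lemma root_sign w s : pos (act w (sroot s)) \/ pos (- act w (sroot s)).
Proof.
have [w' ew redw] := exists_reduced w; rewrite -ew.
have [h|h] :=
    pselect (forall u : seq S, act u =1 act (rcons w' s) -> (size w' <= size u)%N).
  by left; apply: (@root_pos_of_length (size w').+1).
have [u [eu uw]] : exists u : seq S, act u =1 act (rcons w' s) /\ (size u < size w')%N.
  apply: contrapT => hn; apply: h => u eu; rewrite leqNgt; apply/negP => uw.
  by apply: hn; exists u.
right; have [u' eu' redu] := exists_reduced u.
have eu2 : act (rcons u' s) =1 act w'.
  by move=> v; rewrite act_rcons eu' eu act_rcons reflK.
rewrite -eu2 act_rcons refl_sroot actN opprK.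
apply: (@root_pos_of_length (size u').+1) => // z ez.
have : (size w' <= size z)%N by apply: redw => v; rewrite ez eu2.
by have := redu _ (fun v => esym (eu' v)); lia.
Qed.

(** The reflection [r] changes only the coordinate at [r], so a positive root that it makes negative
    is a multiple of [sroot r]; the norm makes the factor 1. *)
Lemma neg_cons r w s : pos (act w (sroot s)) -> pos (- act (r :: w) (sroot s)) ->
  act w (sroot s) = sroot r.
Proof.
move=> p n; set b := act w (sroot s) in p *.
have bE : b = (b r : R) *: sroot r.
  apply/ffunP => t; rewrite vZE ffunE; have [->|tr] := eqVneq t r.
    by rewrite mulr1.
  rewrite mulr0; apply/le_anti; rewrite p andbT.
  by have := n t; rewrite ffunE act_cons reflE // oppr_ge0.
have := root_diag w s; rewrite -/b bE bfZl bfZr sroot_diag => h.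
have : (b r : R) ^+ 2 = 1 ^+ 2 by rewrite expr2 expr1n; lra.
move=> /eqP; rewrite eqrXn2 // ?p // => /eqP br1.
by rewrite br1 scale1r.
Qed.

(** Along the suffixes of [w] the image of [sroot s] is positive at the start and negative at the
    end. At a change of sign it is the simple root of the letter just read, and that letter cancels
    against [s]. *)
Lemma exchange w s : pos (- act w (sroot s)) -> exists w1 r w2,
  [/\ w = w1 ++ r :: w2, act w2 (sroot s) = sroot r
    & act (rcons w s) =1 act (w1 ++ w2)].
Proof.
elim: w => [|r w IH] h.
  by have /(@root_neq0 [::]) := pos_anti (@pos_sroot s) h.
have [p|n] := root_sign w s; last first.
  have [w1 [r' [w2 [-> e1 e2]]]] := IH n.
  by exists (r :: w1), r', w2; split=> // v; rewrite !act_cons -e2.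
have e := neg_cons p h; exists [::], r, w; split=> // v.
by rewrite act_cons (act_sroot e) act_cons reflK.
Qed.

End GeometricRepresentation.

(** * Cosets, conjugation of simple roots, and Tits' solution of the word problem *)

Section Roots.
Variables (R : realType) (S : finType) (m : coxeterMatrix S).
Notation V := {ffun S -> R^o}.
Notation act := (@act R S m).
Notation sroot := (@sroot R S).
Notation bf := (@bf R S m).
Notation reduced := (@reduced R S m).
Implicit Types (s t : S) (v : V) (w : seq S) (K I J Q : pred S).

Lemma pos_neg_root w s : pos (act w (sroot s)) -> pos (- act w (sroot s)) -> False.
Proof. by move=> p n; apply: (@root_neq0 _ _ m w s); exact: pos_anti. Qed.

Lemma reduced_prefix u w : reduced (u ++ w) -> reduced u.
Proof.
move=> h z ez; rewrite -(leq_add2r (size w)) -!size_cat.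
by apply: h => v; rewrite !act_cat ez.
Qed.

Lemma reduced_pos u s w : reduced (u ++ s :: w) -> pos (act u (sroot s)).
Proof.
rewrite -cat_rcons => /reduced_prefix h.
have [//|/exchange[u1 [r [u2 [e _ e2]]]]] := root_sign R m u s.
by have := h _ (fun v => esym (e2 v)); rewrite e size_rcons !size_cat /=; lia.
Qed.

Lemma reduced_rcons u s : reduced u -> pos (act u (sroot s)) -> reduced (rcons u s).
Proof.
move=> h p z ez; rewrite size_rcons ltnNge; apply/negP => zu.
have [z' ez' redz] := exists_reduced R m z.
have zz : (size z' <= size z)%N by apply: redz => v; rewrite ez'.
have := @exchange R S m z' s; case.
  by rewrite ez' ez act_rcons refl_sroot actN opprK.
move=> z1 [r [z2 [e _ e2]]].
have : (size u <= size (z1 ++ z2))%N.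
  by apply: h => v; rewrite -e2 act_rcons ez' ez act_rcons reflK.
by move: zz zu; rewrite e !size_cat /=; lia.
Qed.

(** Exchange only deletes letters, so reducing a word never leaves [Q]. *)
Lemma exists_reduced_over Q w : all Q w ->
  exists w', [/\ act w' =1 act w, reduced w' & all Q w'].
Proof.
elim/last_ind: w => [_|w s IH]; first by exists [::].
rewrite all_rcons => /andP[Qs /IH[w' [e red Qw]]].
have [p|/exchange[u1 [r [u2 [e1 e2 e3]]]]] := root_sign R m w' s.
  exists (rcons w' s); split; first exact: eq_act_rcons.
    exact: reduced_rcons.
  by rewrite all_rcons Qs.
have e4 : act (rcons (u1 ++ u2) s) =1 act w'.
  by move=> v; rewrite act_rcons -e3 act_rcons reflK.
exists (u1 ++ u2); split; first by move=> v; rewrite -e3 !act_rcons e.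
  apply: (@reduced_prefix _ [:: s]); rewrite cats1 => z ez.
  have := red z; rewrite e1 size_rcons !size_cat /= addnS; apply=> v.
  by rewrite ez e4 e1.
by move: Qw; rewrite e1 !all_cat /= => /and3P[-> _ ->].
Qed.

(** * Supports, positivity and minimal coset representatives *)

Definition span K v := forall t, ~~ K t -> v t = 0.

Lemma act_over Q w v t : all Q w -> ~~ Q t -> act w v t = v t.
Proof.
move=> + nQ; elim: w => //= s w IH /andP[Qs Qw].
by rewrite reflE ?IH //; apply: contraNneq nQ => ->.
Qed.

Lemma vec_sum v : v = \sum_s v s *: sroot s.
Proof.
apply/ffunP => t; rewrite sum_ffunE (bigD1 t) //= vZE ffunE eqxx mulr1.
rewrite big1 ?addr0 // => s st; rewrite vZE ffunE eq_sym (negPf st).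
exact: mulr0.
Qed.

Lemma span_act_over Q K w v : all Q w -> {subset Q <= K} ->
  span K v -> span K (act w v).
Proof.
move=> Qw QK h t nK; rewrite (act_over _ Qw) ?h //.
by apply: contra nK; exact: QK.
Qed.

Lemma span_sroot K s : K s -> span K (sroot s).
Proof. by move=> Ks t; rewrite ffunE; case: eqP => // ->; rewrite Ks. Qed.

Lemma span_linear K J w : (forall k, K k -> span J (act w (sroot k))) ->
  forall v, span K v -> span J (act w v).
Proof.
move=> h v hv t nJ; rewrite {1}[v]vec_sum act_sum sum_ffunE big1 // => s _.
rewrite actZ vZE; have [Ks|nK] := boolP (K s); first by rewrite h // mulr0.
by rewrite hv // mul0r.
Qed.

Lemma pos_linear K w v : (forall k, K k -> pos (act w (sroot k))) ->
  pos v -> span K v -> pos (act w v).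
Proof.
move=> h p hv t; rewrite {1}[v]vec_sum act_sum sum_ffunE sumr_ge0 // => s _.
rewrite actZ vZE; have [Ks|nK] := boolP (K s); first by rewrite mulr_ge0 ?h ?p.
by rewrite hv // mul0r.
Qed.

(** Letters of [Q] leave the coordinate at [s] equal to 1, and one positive coordinate decides the
    sign of a root. *)
Lemma pos_outside Q w s : all Q w -> ~~ Q s -> pos (act w (sroot s)).
Proof.
move=> Qw nQ; have [//|n] := root_sign R m w s.
by have := n s; rewrite ffunE (act_over _ Qw nQ) ffunE eqxx oppr_ge0 ler10.
Qed.

(** The factor [b] is of least length in its coset. If it made [sroot k] negative, exchange would
    drop a letter of [b] while [k] is moved into [x]. *)
Lemma coset_decomp Q K d : all Q d -> exists b x,
  [/\ all Q b, all (predI Q K) x, reduced (b ++ x), act (b ++ x) =1 act d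
    & forall k, K k -> pos (act b (sroot k))].
Proof.
move=> Qd.
have ex : exists n, `[< exists b x, [/\ all Q b, all (predI Q K) x,
   act (b ++ x) =1 act d & size b = n] >].
  by exists (size d); apply/asboolP; exists d, [::]; rewrite cats0.
have [n /asboolP[b [x [Qb Kx e bn]]] hmin] := ex_minnP ex.
have hpos k : K k -> pos (act b (sroot k)).
  move=> Kk; have [Qk|nQ] := boolP (Q k); last exact: pos_outside nQ.
  have [//|/exchange[u1 [r [u2 [e1 e2 e3]]]]] := root_sign R m b k.
  suff : (n <= size (u1 ++ u2))%N by rewrite -bn e1 !size_cat /=; lia.
  apply: hmin; apply/asboolP; exists (u1 ++ u2), (k :: x); split => //.
  - by move: Qb; rewrite e1 !all_cat /= => /and3P[-> _ ->].
  - by rewrite /= Qk Kk Kx.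
  - by move=> v; rewrite act_cat -e3 act_rcons -act_cons act_ss -act_cat e.
have redb : reduced b.
  have [b' [eb' redb' Qb']] := exists_reduced_over Qb.
  move=> z ez; have h1 : (size b' <= size z)%N by apply: redb' => v; rewrite ez eb'.
  apply: leq_trans h1; rewrite bn; apply: hmin; apply/asboolP.
  by exists b', x; split=> // v; rewrite act_cat eb' -act_cat e.
have [x' [ex' redx Kx']] := exists_reduced_over Kx.
exists b, x'; split=> //; last by move=> v; rewrite act_cat ex' -act_cat e.
elim/last_ind: x' redx Kx' {ex'} => [_ _|x' s IH redx]; first by rewrite cats0.
rewrite all_rcons => /andP[/andP[_ Ks] Kx']; rewrite -rcons_cat.
move: redx; rewrite -cats1 => redx; apply: reduced_rcons.
  exact: IH (reduced_prefix redx) Kx'.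
rewrite act_cat; apply: (pos_linear hpos); first exact: reduced_pos redx.
by apply: span_act_over Kx' _ (span_sroot Ks) => t /andP[].
Qed.

Lemma root_multiple w s t a : act w (sroot s) = a *: sroot t -> 0 <= a -> a = 1.
Proof.
move=> e a0; have := root_diag R m w s; rewrite e bfZl bfZr sroot_diag => h.
have : a ^+ 2 = 1 ^+ 2 by rewrite expr2 expr1n; lra.
by move=> /eqP; rewrite eqrXn2 // => /eqP.
Qed.

(** A simple root spans an extreme ray of the positive cone, so every term of the sum is
    proportional to it. As [act w] is injective on simple roots, a single term remains. *)
Lemma simple_of_pos_sum K w v t : pos v -> span K v ->
  (forall k, K k -> pos (act w (sroot k))) -> act w v = sroot t ->
  exists k, [/\ K k, act w (sroot k) = sroot t & v = v k *: sroot k].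
Proof.
move=> p hv h e.
have key k : v k != 0 -> K k /\ act w (sroot k) = sroot t.
  move=> vk; have Kk : K k by apply: contraNT vk => /hv->.
  split=> //; set b := act w (sroot k).
  have bE : b = (b t : R) *: sroot t.
    apply/ffunP => r; rewrite vZE ffunE; have [->|rt] := eqVneq r t.
      by rewrite mulr1.
    rewrite mulr0; have : act w v r = 0 by rewrite e ffunE (negPf rt).
    rewrite {1}[v]vec_sum act_sum sum_ffunE => /eqP; rewrite psumr_eq0; last first.
      move=> s _; rewrite actZ vZE; have [Ks|nK] := boolP (K s).
        by rewrite mulr_ge0 ?h ?p.
      by rewrite hv // mul0r.
    move=> /allP /(_ k (mem_index_enum _)) /=; rewrite actZ vZE mulf_eq0.
    by rewrite (negPf vk) => /eqP.
  by rewrite bE (root_multiple bE) ?scale1r // h.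
have [k vk] : exists k, v k != 0.
  apply/existsP; apply: contraT; rewrite negb_exists => /forallP h0.
  have v0 : v = 0 by apply/ffunP => k; rewrite ffunE; apply/eqP/negPn.
  by have := @root_neq0 R S m [::] t; rewrite -e v0 act0.
have [Kk ek] := key k vk; exists k; split=> //.
apply/ffunP => r; rewrite vZE ffunE; have [->|rk] := eqVneq r k.
  by rewrite mulr1.
rewrite mulr0; apply/eqP; apply: contraTT rk => /key[_].
by rewrite -ek => /act_inj/sroot_inj->; rewrite eqxx.
Qed.

(** The simple root at [i] is the image under [rev d] of a nonnegative combination of roots from
    [J], each of which [rev d] keeps positive; [simple_of_pos_sum] leaves one of them. *)
Lemma simple_to_simple I J d : (forall i, I i -> pos (act d (sroot i))) ->
  (forall j, J j -> pos (act (rev d) (sroot j))) ->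
  (forall i, I i -> span J (act d (sroot i))) ->
  forall i, I i -> exists2 j, J j & act d (sroot i) = sroot j.
Proof.
move=> pI pJ sIJ i Ii.
have [//|j [Jj ej evi]] := @simple_of_pos_sum J (rev d) _ i (pI _ Ii) (sIJ _ Ii) pJ.
  exact: act_revK.
exists j => //; rewrite evi (root_multiple evi) ?scale1r //.
exact: pI.
Qed.

(* An element of minimal length in the double coset of [a] works. *)
Lemma conj_span_conj_simple Q I J a : all Q a ->
  (forall i, I i -> span J (act a (sroot i))) ->
  (forall j, J j -> span I (act (rev a) (sroot j))) ->
  exists d, [/\ all Q d,
    forall i, I i -> exists2 j, J j & act d (sroot i) = sroot j &
    forall j, J j -> exists2 i, I i & act d (sroot i) = sroot j].
Proof.
move=> Qa hI hJ.
pose dc n := exists y x d, [/\ all Q d, all (predI Q J) y, all (predI Q I) x,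
  act d =1 act (y ++ a ++ x) & size d = n].
have ex : exists n, `[< dc n >].
  by exists (size a); apply/asboolP; exists [::], [::], a; rewrite cats0.
have [n /asboolP[y [x [d [Qd Jy Ix e dn]]]] hmin] := ex_minnP ex.
have er : act (rev d) =1 act (rev x ++ rev a ++ rev y).
  by move=> v; rewrite (eq_act_rev e) !rev_cat -catA.
(* A negative image would let exchange drop a letter of [d] and absorb [i] into the right factor of
   the double coset. *)
have pI i : I i -> pos (act d (sroot i)).
  move=> Ii; have [Qi|nQ] := boolP (Q i); last exact: pos_outside nQ.
  have [//|/exchange[u1 [r [u2 [e1 e2 e3]]]]] := root_sign R m d i.
  suff : (n <= size (u1 ++ u2))%N by rewrite -dn e1 !size_cat /=; lia.
  apply: hmin; apply/asboolP; exists y, (rcons x i), (u1 ++ u2); split => //.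
  - by move: Qd; rewrite e1 !all_cat /= => /and3P[-> _ ->].
  - by rewrite all_rcons /= Qi Ii Ix.
  - by move=> v; rewrite -e3 act_rcons e -!rcons_cat act_rcons.
have Qrd : all Q (rev d) by rewrite all_rev.
have pJ j : J j -> pos (act (rev d) (sroot j)).
  move=> Jj; have [Qj|nQ] := boolP (Q j); last exact: pos_outside nQ.
  have [//|/exchange[u1 [r [u2 [e1 e2 e3]]]]] := root_sign R m (rev d) j.
  suff : (n <= size (rev (u1 ++ u2)))%N.
    by rewrite -dn -[size d]size_rev e1 size_rev !size_cat /=; lia.
  apply: hmin; apply/asboolP; exists (j :: y), x, (rev (u1 ++ u2)); split => //.
  - by move: Qrd; rewrite e1 all_rev !all_cat /= => /and3P[-> _ ->].
  - by rewrite /= Qj Jj Jy.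
  - move=> v; rewrite -(eq_act_rev e3) rev_rcons revK.
    by rewrite !act_cons e.
have sI i : I i -> span J (act d (sroot i)).
  move=> Ii; rewrite e !act_cat; apply: span_act_over Jy _ _ => [t /andP[]//|].
  apply: span_linear hI _ _; apply: span_act_over Ix _ (span_sroot Ii).
  by move=> t /andP[].
have sJ j : J j -> span I (act (rev d) (sroot j)).
  move=> Jj; rewrite er !act_cat; apply: (@span_act_over (predI Q I)).
  - by rewrite all_rev.
  - by move=> t /andP[].
  apply: span_linear hJ _ _; apply: (@span_act_over (predI Q J)) (span_sroot Jj).
    by rewrite all_rev.
  by move=> t /andP[].
exists d; split=> //; first exact: simple_to_simple.
move=> j Jj; have [|i Ii ei] := @simple_to_simple J I (rev d) pJ _ sJ j Jj.
  by rewrite revK.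
by exists i => //; rewrite -ei act_Krev.
Qed.

(** * Tits' moves on words *)

Inductive tstep : seq S -> seq S -> Prop :=
| tstep_del u s w : tstep (u ++ [:: s, s & w]) (u ++ w)
| tstep_braid u s t k w : s != t -> m s t = Some k ->
    tstep (u ++ ralt k s t ++ w) (u ++ ralt k t s ++ w).

Definition trel : rel (seq S) := fun u w => `[< tstep u w \/ tstep w u >].

Definition tchain L Q u w := exists p, [/\ path trel u p, last u p = w
  & all (fun x => (size x <= L)%N && all Q x) (u :: p)].

Lemma tstep_act u w : tstep u w -> act u =1 act w.
Proof.
case=> [a s z|a s t k z st mst] v; first by rewrite !act_cat !act_cons reflK.
by rewrite !act_cat (act_braid st mst).
Qed.

Lemma trel_act u w : trel u w -> act u =1 act w.
Proof. by case/asboolP => /tstep_act h v; rewrite h. Qed.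

Lemma tchain_act L Q u w : tchain L Q u w -> act u =1 act w.
Proof.
case=> p [hp <- _]; elim: p u hp => [//|x p IH] u /= /andP[/trel_act ux /IH h] v.
by rewrite ux h.
Qed.

Lemma tchain_refl L Q u : (size u <= L)%N -> all Q u -> tchain L Q u u.
Proof. by move=> uL uQ; exists [::]; rewrite /= uL uQ. Qed.

Lemma tchain_trans L Q w u z : tchain L Q u w -> tchain L Q w z -> tchain L Q u z.
Proof.
case=> p [hp lp ap] [q [hq lq /= /andP[_ aq]]]; exists (p ++ q).
by rewrite cat_path last_cat lp hp hq lq -cat_cons all_cat ap aq.
Qed.

Lemma tchain_sym L Q u w : tchain L Q u w -> tchain L Q w u.
Proof.
case=> p [hp lp ap]; exists (rev (belast u p)); split.
- rewrite -lp rev_path; apply: sub_path hp => x y /asboolP h.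
  by apply/asboolP; tauto.
- by case: (p) lp => [<-|x q _] //=; rewrite rev_cons last_rcons.
- rewrite -lp -rev_rcons -lastI; by rewrite all_rev.
Qed.

Lemma tchain_step L Q u w : trel u w -> (size u <= L)%N -> all Q u ->
  (size w <= L)%N -> all Q w -> tchain L Q u w.
Proof. by move=> h uL uQ wL wQ; exists [:: w]; rewrite /= h uL uQ wL wQ. Qed.

Lemma tchain_leq L L' Q u w : (L <= L')%N -> tchain L Q u w -> tchain L' Q u w.
Proof.
move=> LL [p [hp lp ap]]; exists p; split=> //; apply: sub_all ap => x.
by move=> /andP[/leq_trans -> // ->].
Qed.

Lemma tchain_rcons L Q u w s : Q s -> tchain L Q u w ->
  tchain L.+1 Q (rcons u s) (rcons w s).
Proof.
move=> Qs [p [hp lp ap]]; exists (map (rcons^~ s) p); split.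
- apply: homo_path hp => x y /asboolP h; apply/asboolP.
  have r a b : tstep a b -> tstep (rcons a s) (rcons b s).
    case=> [c d z|c d e k z cd mcd]; rewrite !rcons_cat.
      exact: (tstep_del c d (rcons z s)).
    exact: tstep_braid.
  by case: h => /r; tauto.
- by rewrite (last_map (rcons^~ s)) lp.
- rewrite -(map_cons (rcons^~ s)) all_map; apply: sub_all ap => x /andP[h1 h2] /=.
  by rewrite size_rcons ltnS h1 all_rcons Qs.
Qed.

Lemma reduced_size u w : reduced u -> reduced w -> act u =1 act w -> size u = size w.
Proof. by move=> hu hw e; apply/eqP; rewrite eqn_leq hu ?hw // => v; rewrite e. Qed.

(** When the last letters [s], [t] differ, both are right descents of the element. It then has
    reduced words ending in either alternating word of length [m s t]; induction links [u] to one of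
    them and [w] to the other, and one braid move joins the two. *)
Lemma tits_reduced Q n u w : size u = n -> all Q u -> all Q w ->
  reduced u -> reduced w -> act u =1 act w -> tchain n Q u w.
Proof.
elim: n u w => [|n IH] u w un Qu Qw redu redw e.
  have := reduced_size redu redw e; rewrite un => /esym/size0nil ->.
  by rewrite (size0nil un); exact: tchain_refl.
have wn : size w = n.+1 by rewrite -(reduced_size redu redw e).
case: (lastP u) un Qu redu e => // {}u s; rewrite size_rcons => -[un] Qu redu e.
case: (lastP w) wn Qw redw e => // {}w t; rewrite size_rcons => -[wn] Qw redw e.
move: (Qu) (Qw); rewrite !all_rcons => /andP[Qs Qu'] /andP[Qt Qw'].
have redp x r : reduced (rcons x r) -> reduced x.
  by rewrite -cats1; exact: reduced_prefix.
have cancel x y r : act (rcons x r) =1 act (rcons y r) -> act x =1 act y.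
  by move=> h v; have := h (@refl R S m r v); rewrite !act_rcons !reflK.
have [st|st] := eqVneq s t.
  move: e; rewrite -st => /cancel e; apply: tchain_rcons => //.
  by apply: IH => //; [exact: redp redu|exact: redp redw].
have [b [x [Qb Qx redbx ebx hpos]]] := coset_decomp (pred2 s t) Qu.
have xst : all (pred2 s t) x by apply: sub_all Qx => r /andP[].
have [k [a [c [hac kx ex]]]] := dihedral_word R m xst.
have ek : act (b ++ ralt k a c) =1 act (rcons u s).
  by move=> v; rewrite act_cat -ex -act_cat ebx.
have kxE : k = size x.
  apply/eqP; rewrite eqn_leq kx -(leq_add2l (size b)) -size_cat.
  rewrite -{1}(size_ralt k a c) -size_cat; apply: redbx => v.
  by rewrite ek ebx.
have bxn : (size b + k = n.+1)%N.
  by rewrite kxE -size_cat (reduced_size redbx redu ebx) size_rcons un.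
have neg r : pred2 s t r -> pos (- act (rcons u s) (sroot r)).
  case/orP => /eqP->; last rewrite e.
    rewrite act_rcons refl_sroot actN opprK; apply: (@reduced_pos u s [::]).
    by rewrite cats1.
  rewrite act_rcons refl_sroot actN opprK; apply: (@reduced_pos w t [::]).
  by rewrite cats1.
(* Were the dihedral factor shorter than the label, the root of the letter in which it does not end
   would stay positive, against [neg]. *)
have [j mst jk] : exists2 j, m s t = Some j & (j <= k)%N.
  apply: contrapT => hn.
  have [p0 p1] : 0 <= chb (cc R m s t) k /\ 0 <= chb (cc R m s t) k.+1.
    apply: chb_ge0_lt => //; case mst: (m s t) => [j|] //; rewrite ltnNge.
    by apply/negP => jk; apply: hn; exists j.
  have ca : c != a by case: hac => -[-> ->] //; rewrite eq_sym.
  have cca : cc R m c a = cc R m s t by case: hac => -[-> ->] //; rewrite ccC.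
  have kst : pred2 s t c /\ pred2 s t a.
    by case: hac => -[-> ->]; rewrite /= !eqxx ?orbT.
  apply: (@pos_neg_root (rcons u s) c); last by apply: neg; case: kst.
  rewrite -ek act_cat act_ralt_sroot // cca actD !actZ.
  by apply: posD; apply: posZ => //; apply: hpos; case: odd; case: kst.
have j1 : (1 < j)%N by have := cm_gt1 m (elimN eqP st); rewrite mst.
have [p sp ep] := ralt_split (k - j) j a c; rewrite subnK // in ep.
have Qp : all Q p.
  have : all Q (ralt k a c) by apply: all_ralt; case: hac => -[ea ec]; rewrite ?ea ?ec.
  by rewrite ep all_cat => /andP[].
case: j => // j in mst jk j1 sp ep *.
set y := b ++ p.
have Qy : all Q y by rewrite all_cat Qb.
have sy : (size y + j = n)%N.
  by rewrite size_cat sp; move: (size b) bxn jk => i; clear; lia.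
have [es et] : act (y ++ ralt j.+1 s t) =1 act (rcons u s) /\
               act (y ++ ralt j.+1 t s) =1 act (rcons u s).
  have e1 : act (y ++ ralt j.+1 a c) =1 act (rcons u s).
    by move=> v; rewrite -catA -ep ek.
  have br v : act (ralt j.+1 s t) v = act (ralt j.+1 t s) v.
    by rewrite (act_braid st mst).
  by split=> v; rewrite -e1 !act_cat; case: hac => -[ea ec]; rewrite ea ec // br.
rewrite /= -!rcons_cat in es et.
have eu : act (y ++ ralt j t s) =1 act u by apply: (cancel _ _ s).
have ew : act (y ++ ralt j s t) =1 act w.
  by apply: (cancel _ _ t) => v; rewrite et e.
have red x' z : reduced x' -> act z =1 act x' -> size z = size x' -> reduced z.
  by move=> h ez sz z' ez'; rewrite sz; apply: h => v; rewrite ez' ez.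
have Qys : all Q (y ++ ralt j t s) by rewrite all_cat Qy all_ralt.
have Qyt : all Q (y ++ ralt j s t) by rewrite all_cat Qy all_ralt.
have cu : tchain n Q u (y ++ ralt j t s).
  apply: IH => //; first exact: redp redu.
  apply: red (redp _ _ redu) eu _; by rewrite size_cat size_ralt sy.
have cw : tchain n Q (y ++ ralt j s t) w.
  apply: IH => //; first by rewrite size_cat size_ralt.
    by apply: red (redp _ _ redw) ew _; rewrite size_cat size_ralt sy.
  exact: redp redw.
apply: tchain_trans (tchain_rcons Qs cu) _.
apply: tchain_trans _ (tchain_rcons Qt cw).
apply: tchain_step; rewrite ?size_rcons ?all_rcons ?size_cat ?size_ralt ?sy ?Qs ?Qt //.
  apply/asboolP; left; have := tstep_braid y [::] st mst.
  by rewrite /= !cats0 !rcons_cat.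
all: by rewrite -size_cat -/y sy.
Qed.

(** Letters are appended one at a time. One that shortens the reduced word is first matched by
    rearranging that word, at constant length, so as to end in the same letter; then the two
    cancel. *)
Lemma tits_reduce Q u : all Q u -> exists u', [/\ reduced u', all Q u' & tchain (size u) Q u u'].
Proof.
elim/last_ind: u => [_|u s IH].
  by exists [::]; split=> //; exact: tchain_refl.
rewrite all_rcons => /andP[Qs /IH[u' [redu Qu c]]]; rewrite size_rcons.
have c' := tchain_rcons Qs c.
have [p|/exchange[u1 [r [u2 [e1 e2 e3]]]]] := root_sign R m u' s.
  exists (rcons u' s); split=> //; first exact: reduced_rcons.
  by rewrite all_rcons Qs.
have Q12 : all Q (u1 ++ u2).
  by move: Qu; rewrite e1 !all_cat /= => /and3P[-> _ ->].
have e4 : act (rcons (u1 ++ u2) s) =1 act u'.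
  by move=> v; rewrite act_rcons -e3 act_rcons reflK.
have s4 : size (rcons (u1 ++ u2) s) = size u'.
  by rewrite e1 size_rcons !size_cat addnS.
have red4 : reduced (rcons (u1 ++ u2) s).
  by move=> z ez; rewrite s4; apply: redu => v; rewrite ez e4.
have u'u : (size u' <= size u)%N.
  case: c => p [_ <- /allP /(_ (last u p) (mem_last _ _))].
  by case/andP.
have c4 : tchain (size u) Q u' (rcons (u1 ++ u2) s).
  apply: tchain_leq u'u _; apply: tits_reduced => //.
  by rewrite all_rcons Qs.
exists (u1 ++ u2); split=> //.
  by apply: (@reduced_prefix _ [:: s]); rewrite cats1.
apply: tchain_trans c' _; apply: tchain_trans (tchain_rcons Qs c4) _.
apply: tchain_step; rewrite ?all_rcons ?Qs //.
- apply/asboolP; left; have := tstep_del (u1 ++ u2) s [::].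
  by rewrite cats0 -!cats1 -!catA.
- by rewrite size_rcons s4.
- by move: s4; rewrite size_rcons; lia.
Qed.

Lemma tits Q u w : all Q u -> all Q w -> act u =1 act w ->
  tchain (maxn (size u) (size w)) Q u w.
Proof.
move=> Qu Qw e; have [u' [redu Qu' cu]] := tits_reduce Qu.
have [w' [redw Qw' cw]] := tits_reduce Qw.
have sub z z' : tchain (size z) Q z z' -> (size z' <= size z)%N.
  case=> p [_ <- /allP /(_ (last z p) (mem_last _ _))].
  by case/andP.
apply: tchain_trans (tchain_leq (leq_maxl _ _) cu) _.
apply: tchain_trans _ (tchain_leq (leq_maxr _ _) (tchain_sym cw)).
apply: (@tchain_leq (size u')); first exact: leq_trans (sub _ _ cu) (leq_maxl _ _).
apply: tits_reduced => // v.
by rewrite -(tchain_act cu) e (tchain_act cw).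
Qed.

End Roots.

(** * Congruences modulo 3 *)

Section IntegerSpan.
Variable R : numFieldType.
Implicit Types (l : seq R) (z : nat -> int) (x y : R).

Definition zcomb l z : R := \sum_(i < size l) (z i)%:~R * l`_i.
Definition zspan l x := exists z, x = zcomb l z.

Lemma zcomb_cons a l z : zcomb (a :: l) z = (z 0)%:~R * a + zcomb l (z \o succn).
Proof. by rewrite /zcomb /= big_ord_recl. Qed.

Lemma zcombD l z z' : zcomb l (fun i => z i + z' i) = zcomb l z + zcomb l z'.
Proof.
by rewrite /zcomb -big_split; apply: eq_bigr => i _; rewrite rmorphD mulrDl.
Qed.

Lemma zcombZ l k z : zcomb l (fun i => k * z i) = k%:~R * zcomb l z.
Proof.
by rewrite /zcomb mulr_sumr; apply: eq_bigr => i _; rewrite rmorphM mulrA.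
Qed.

Lemma zspanD l x y : zspan l x -> zspan l y -> zspan l (x + y).
Proof. by move=> [z ->] [z' ->]; exists (fun i => z i + z' i); rewrite zcombD. Qed.

Lemma zspanZ l k x : zspan l x -> zspan l (k%:~R * x).
Proof. by move=> [z ->]; exists (fun i => k * z i); rewrite zcombZ. Qed.

Lemma zspan0 l : zspan l 0.
Proof. by exists (fun=> 0); rewrite /zcomb big1 // => i _; rewrite mul0r. Qed.

Lemma zspanN l x : zspan l x -> zspan l (- x).
Proof. by move=> /(zspanZ (-1)); rewrite mulN1r. Qed.

Lemma zspan_sum l (T : Type) (r : seq T) (P : pred T) (F : T -> R) :
  (forall i, P i -> zspan l (F i)) -> zspan l (\sum_(i <- r | P i) F i).
Proof.
by move=> h; apply: big_ind => //; [exact: zspan0|exact: zspanD].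
Qed.

Lemma zspan_mem l x : x \in l -> zspan l x.
Proof.
move=> /(nthP 0)[i il <-]; exists (fun j => (j == i)%:Z).
rewrite /zcomb (bigD1 (Ordinal il)) //= eqxx mul1r big1 ?addr0 // => j.
by rewrite -val_eqE /= => /negPf->; rewrite mul0r.
Qed.

Definition zfree l := forall z, zcomb l z = 0 -> forall i, (i < size l)%N -> z i = 0.

(** A generator with a nonzero multiple in the span of the others is absorbed into the denominator
    [D]; the others are kept. Independence up to a denominator is enough to test divisibility. *)
Lemma zspan_free l : exists D l', [/\ D != 0 :> int, zfree l'
  & forall x, zspan l x -> zspan l' (D%:~R * x)].
Proof.
elim: l => [|a l [D [l' [D0 free sub]]]].
  exists 1, [::]; split=> // x [z ->]; rewrite /zcomb big_ord0 mulr0.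
  exact: zspan0.
have [[E [z [E0 Ea]]]|hn] := pselect (exists E z, E != 0 :> int /\ E%:~R * a = zcomb l' z).
  exists (D * E), l'; split=> //; first exact: mulf_neq0.
  move=> x [y ->]; rewrite zcomb_cons mulrDr; apply: zspanD.
    rewrite rmorphM mulrCA -mulrA Ea; do 2!apply: zspanZ; by exists z.
  by rewrite rmorphM mulrAC mulrC; apply: zspanZ; apply: sub; exists (y \o succn).
exists D, (a :: l'); split=> //.
  move=> z; rewrite zcomb_cons => h.
  have z0 : z 0%N = 0.
    apply/eqP; apply: contrapT => /negP z0; apply: hn; exists (z 0%N).
    exists (fun i => -1 * z i.+1); split=> //; rewrite zcombZ mulN1r.
    by apply/eqP; rewrite -addr_eq0 h.
  move: h; rewrite z0 mul0r add0r => /free h [|i] // il.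
  exact: (h i).
move=> x [y ->]; rewrite zcomb_cons mulrDr.
have [u ->] := sub _ (ex_intro _ (y \o succn) erefl).
exists (fun i => if i is j.+1 then u j else D * y 0%N).
by rewrite zcomb_cons rmorphM mulrA.
Qed.

Lemma zspan_divisible l x : (forall j, exists2 y, zspan l y & x = 3 ^+ j * y) -> x = 0.
Proof.
move=> h; have [D [l' [D0 free sub]]] := zspan_free l.
have [y /sub[u eu] xy] := h 0%N; rewrite expr0 mul1r in xy; rewrite -xy in eu.
have u0 i : (i < size l')%N -> u i = 0.
  move=> il; have [y' /sub[z ez] ex] := h `|u i|%N.
  have e0 : zcomb l' (fun i' => u i' + -1 * (3 ^+ `|u i|%N * z i')) = 0.
    by rewrite zcombD -eu !zcombZ -ez {1}ex rmorphXn; ring.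
  have := free _ e0 i il; rewrite mulN1r => /subr0_eq ui; have := congr1 absz ui.
  rewrite {1}abszM abszX; case: (eqVneq (z i) 0) => [z0|z0].
    by rewrite ui z0 mulr0.
  have : (`|u i| < 3 ^ `|u i|)%N by exact: ltn_expl.
  rewrite -absz_gt0 in z0; move: (`|u i|)%N (3 ^ _)%N (`|z i|)%N z0 => a b c.
  by nia.
have : D%:~R * x = 0.
  by rewrite eu /zcomb big1 // => i _; rewrite u0 // mul0r.
by move/eqP; rewrite mulf_eq0 intr_eq0 (negPf D0) => /eqP.
Qed.

End IntegerSpan.

(** * Additive maps congruent to the identity modulo 3 *)

Section Congruence.
Variables (R : realType) (S : finType) (l : seq R).
Notation V := {ffun S -> R^o}.
Implicit Types (v u : V) (T : V -> V).

Definition lat j v := forall s, exists2 y, zspan l y & v s = 3 ^+ j * y.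

Lemma latD j u v : lat j u -> lat j v -> lat j (u + v).
Proof.
move=> hu hv s; have [y hy e] := hu s; have [y' hy' e'] := hv s.
by exists (y + y'); [exact: zspanD|rewrite ffunE e e' mulrDr].
Qed.

Lemma latN j v : lat j v -> lat j (- v).
Proof.
move=> hv s; have [y hy e] := hv s.
by exists (- y); [exact: zspanN|rewrite ffunE e mulrN].
Qed.

Lemma lat3 j v : lat j.+1 (3 *: v) <-> lat j v.
Proof.
split=> hv s; have [y hy e] := hv s; exists y => //.
  move: e; rewrite ffunE exprS -mulrA => /mulfI; apply.
  by rewrite pnatr_eq0.
by rewrite ffunE e exprS -mulrA.
Qed.

Lemma lat_divisible v : (forall j, lat j v) -> v = 0.
Proof.
move=> h; apply/ffunP => s; rewrite ffunE.
by apply: (@zspan_divisible _ l) => j; exact: h.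
Qed.

Definition cong3 T := [/\ forall u v, T (u + v) = T u + T v,
  forall v, lat 0 v -> lat 0 (T v) & forall v, lat 0 v -> lat 1 (T v - v)].

Lemma cong3_0 T : cong3 T -> T 0 = 0.
Proof. by case=> h _ _; apply: (addrI (T 0)); rewrite -h !addr0. Qed.

Lemma cong3_MulrN T v k : cong3 T -> T (v *+ k) = T v *+ k.
Proof.
move=> hT; elim: k => [|k IH]; first by rewrite !mulr0n cong3_0.
by case: hT => h _ _; rewrite !mulrS h IH.
Qed.

(** Divisibility as an integer multiple is respected by every additive map that preserves the
    lattice. *)
Lemma lat_exp j v : lat j v <-> exists2 u, lat 0 u & v = u *+ (3 ^ j).
Proof.
split=> [hv|[u hu ->] s].
  pose y s := projT1 (cid2 (hv s)).
  have yP s : zspan l (y s) /\ v s = 3 ^+ j * y s.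
    by rewrite /y; case: cid2.
  exists [ffun s => y s : R^o].
    by move=> s; exists (y s); [case: (yP s)|rewrite ffunE mul1r].
  apply/ffunP => s; rewrite -scaler_nat !ffunE (yP s).2 natrX.
  by [].
have [y hy e] := hu s; exists y => //.
by rewrite -scaler_nat ffunE e mul1r natrX.
Qed.

Lemma cong3_lat T j v : cong3 T -> lat j v -> lat j (T v).
Proof.
move=> hT /lat_exp[u hu ->]; apply/lat_exp; exists (T u).
  by case: hT => _ h _; exact: h.
by rewrite cong3_MulrN.
Qed.

Lemma cong3_latB T j v : cong3 T -> lat j v -> lat j.+1 (T v - v).
Proof.
move=> hT /lat_exp[u hu ->]; have [_ _ h] := hT.
have /lat_exp[z hz e] := h _ hu; apply/lat_exp; exists z => //.
by rewrite cong3_MulrN // -mulrnBl e -mulrnA expn1 expnSr mulnC.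
Qed.

Lemma cong3_comp T T' : cong3 T -> cong3 T' -> cong3 (T \o T').
Proof.
move=> [h1 h2 h3] [h1' h2' h3']; split=> [u v|v hv|v hv] /=.
- by rewrite h1' h1.
- by apply/h2/h2'.
- by rewrite -(subrK (T' v) (T _)) -addrA; apply: latD; [apply/h3/h2'|apply: h3'].
Qed.

Lemma cong3_iter T k : cong3 T -> cong3 (iter k T).
Proof.
move=> hT; elim: k => [|k IH]; last exact: (cong3_comp hT IH).
split=> // v hv /=; rewrite subrr => s; exists 0; first exact: zspan0.
by rewrite ffunE mulr0.
Qed.

(* To be applied to [v = T b - b] when [iter e T b = b]. *)
Lemma cong3_sum_eq0 T e v : cong3 T -> (0 < e)%N -> lat 0 v ->
  \sum_(i < e) iter i T v = 0 -> v = 0.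
Proof.
move=> + e0; have [n en] := ubnP e; elim: n => // n IH in e e0 en T v *.
move=> hT hv h.
(* Only 0 is divisible by all powers of 3, so it is enough to gain one factor at a time. *)
suff step j : lat j v -> lat j.+1 v by apply: lat_divisible; elim=> // j /step.
move=> hj.
have [/dvdnP[e' ee]|n3] := boolP (3 %| e)%N.
  (* Grouping the orbit sum in threes gives a shorter orbit sum, for [iter 3 T] and this vector. *)
  have w0 : v + T v + T (T v) = 0.
    apply: (IH e' _ _ (iter 3 T)); first by lia.
    - by lia.
    - exact: cong3_iter.
    - have hl u : lat 0 u -> lat 0 (T u) by exact: cong3_lat.
      apply: latD; last exact/hl/hl.
      by apply: latD; [|exact: hl].
    - have tD u w : T (u + w) = T u + T w by case: hT.
      have itD u w i : iter i T (u + w) = iter i T u + iter i T w.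
        by elim: i => //= i ->; rewrite tD.
      rewrite -[RHS]h ee; elim: (e') => [|k IHk]; first by rewrite !big_ord0.
      rewrite mulSnr addn3 !big_ord_recr /= IHk -iterM !itD !addrA.
      by rewrite -!iterSr !iterS.
  have hB u k : lat k u -> lat k.+1 (T u - u) by exact: cong3_latB.
  (* By [w0], [-3 T v = (T - 1)^2 v]: the right side gains two factors 3, of which the left side
     costs one. *)
  have hTv : lat j.+1 (T v).
    apply/lat3; have -> : 3 *: T v = - (T (T v - v) - (T v - v)).
      have tD u w : T (u + w) = T u + T w by case: hT.
      have tN u : T (- u) = - T u.
        by apply: (addrI (T u)); rewrite -tD !subrr cong3_0.
      rewrite tD tN -[LHS]addr0 -[X in _ + X]oppr0 -w0.
      by apply/ffunP => s; rewrite !ffunE -![_ *: (_ : R^o)]/(_ * _ : R); move: (T _ _ : R) (T _ _ : R) (v s : R) => a b c; ring.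
    by apply/latN/hB/hB.
  rewrite -[v](subKr (T v)); apply: latD => //; apply/latN.
  exact: hB.
(* For [e] prime to 3, both [v *+ e] and [v *+ 3] gain a factor, hence so does [v]. *)
have hs : lat j.+1 (v *+ e).
  have -> : v *+ e = \sum_(i < e) (v - iter i T v).
    by rewrite sumrB h subr0 sumr_const card_ord.
  apply: big_ind => [|u w|i _]; last first.
  - by rewrite -opprB; apply/latN/cong3_latB => //; exact: cong3_iter.
  - exact: latD.
  - by move=> s; exists 0; [exact: zspan0|rewrite ffunE mulr0].
have h3 : lat j.+1 (v *+ 3) by rewrite -scaler_nat; apply/lat3.
have hk u k : lat j.+1 u -> lat j.+1 (u *+ k).
  move=> hu; elim: k => [|k IHk]; last by rewrite mulrS; apply: latD.
  by move=> s; exists 0; [exact: zspan0|rewrite mulr0n ffunE mulr0].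
have [e1|e2] : (e = 3 * (e %/ 3) + 1)%N \/ (e = 3 * (e %/ 3) + 2)%N.
  by move: n3; rewrite /dvdn; lia.
- have -> : v = v *+ e - v *+ 3 *+ (e %/ 3).
    by rewrite -mulrnA {1}e1 mulrnDr [_ + v *+ 1]addrC addrK.
  by apply: latD => //; apply/latN/hk.
- have -> : v = v *+ 3 - (v *+ e - v *+ 3 *+ (e %/ 3)).
    by rewrite -mulrnA {1}e2 mulrnDr [_ + v *+ 2]addrC addrK -mulrnBr.
  by apply: latD => //; apply/latN/latD => //; apply/latN/hk.
Qed.

(** The displacement [T v - v] has a telescoping orbit sum, which vanishes. *)
Lemma cong3_torsion_free T e v : cong3 T -> (0 < e)%N -> lat 0 v ->
  iter e T v = v -> T v = v.
Proof.
move=> hT e0 hv h; apply/subr0_eq; apply: (cong3_sum_eq0 hT e0).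
  by apply: latD; [exact: cong3_lat|exact: latN].
have tD u w : T (u + w) = T u + T w by case: hT.
have tN u : T (- u) = - T u.
  by apply: (addrI (T u)); rewrite -tD !subrr cong3_0.
have -> : \sum_(i < e) iter i T (T v - v) = iter e T v - v.
  elim: (e) => [|k IH]; first by rewrite big_ord0 subrr.
  rewrite big_ord_recr /= IH.
  have -> : iter k T (T v - v) = iter k.+1 T v - iter k T v.
    by rewrite iterSr; elim: k {IH} => //= k ->; rewrite tD tN.
  by rewrite [LHS]addrC addrA subrK.
by rewrite h subrr.
Qed.

End Congruence.

(** * The ring of the numbers [2 cos (k pi / N)] *)

Section CosRing.
Variables (R : realType) (N : nat).
Hypothesis N0 : (0 < N)%N.

Definition cosN (k : nat) : R := 2 * cos (pi / N%:R *+ k).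
(** The entry at index 0 is 1 and not [cosN 0 = 2], so that the span contains the unit. *)
Definition cosgen : seq R := [seq if k == 0%N then 1 else cosN k | k <- iota 0 N].

Lemma cosgen1 : zspan cosgen 1.
Proof.
by apply: zspan_mem; apply/mapP; exists 0%N; rewrite ?mem_iota.
Qed.

Lemma cosN0 : cosN 0 = 2.
Proof. by rewrite /cosN mulr0n cos0 mulr1. Qed.

Lemma cosND k : cosN (k + N) = - cosN k.
Proof.
rewrite /cosN mulrnDr.
have -> : pi / N%:R *+ N = pi :> R.
  by rewrite -[LHS]mulr_natr divfK // pnatr_eq0 -lt0n.
by rewrite cosDpi mulrN.
Qed.

Lemma zspan_cosN k : zspan cosgen (cosN k).
Proof.
have [n kn] := ubnP k; elim: n => // n IH in k kn *.
have [kN|Nk] := ltnP k N; last first.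
  by rewrite -(subnK Nk) cosND; apply/zspanN/IH; lia.
have [->|k0] := eqVneq k 0%N.
  by rewrite cosN0 -[2]mulr1; apply: (zspanZ 2); exact: cosgen1.
apply: zspan_mem; apply/mapP; exists k; first by rewrite mem_iota.
by rewrite (negPf k0).
Qed.

Lemma cosNM j k : (k <= j)%N -> cosN j * cosN k = cosN (j + k) + cosN (j - k).
Proof.
move=> kj; rewrite /cosN -{1}(subnK kj) -(subnK kj) addnK !mulrnDr.
set x := _ *+ (j - k); set y := _ *+ k.
rewrite !cosD !sinD; move: (cos2Dsin2 y); rewrite !expr2.
move: (cos x) (cos y) (sin x) (sin y) => a b c d h.
transitivity (4 * a * b * b - 4 * c * d * b); first by ring.
transitivity (2 * (a * b - c * d) * b - 2 * (a * d + c * b) * d + 2 * a * (b * b + d * d)).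
  by ring.
by rewrite h; ring.
Qed.

(** The product of two cosines is a sum of cosines by [cosNM], and antiperiodicity in [N] brings the
    indices back into range. *)
Lemma zspan_mul x y : zspan cosgen x -> zspan cosgen y -> zspan cosgen (x * y).
Proof.
move=> [z ->] [z' ->]; rewrite /zcomb mulr_suml; apply: zspan_sum => i _.
rewrite mulr_sumr; apply: zspan_sum => j _.
rewrite mulrACA -rmorphM; apply: zspanZ.
have sz : size cosgen = N by rewrite size_map size_iota.
have gE (k : 'I_(size cosgen)) : cosgen`_k = 1 \/ exists k', cosgen`_k = cosN k'.
  rewrite (nth_map 0%N) ?size_iota -?sz // nth_iota -?sz // add0n.
  by case: ifP => _; [left|right; exists k].
have [->|[k ->]] := gE i; first by rewrite mul1r; apply/zspan_mem/mem_nth.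
have [->|[k' ->]] := gE j; first by rewrite mulr1; exact: zspan_cosN.
have [kk|/ltnW kk] := leqP k' k; last rewrite mulrC.
  by rewrite cosNM //; apply: zspanD; exact: zspan_cosN.
by rewrite cosNM //; apply: zspanD; exact: zspan_cosN.
Qed.

Lemma zspan_nat k : zspan cosgen k%:R.
Proof. by rewrite -[k%:R]mulr1; apply: (zspanZ k); exact: cosgen1. Qed.

Lemma zspan_cval L : (if L is Some k then k %| N else true)%N ->
  zspan cosgen (cval R L).
Proof.
case: L => [k|_]; last exact: zspan_nat.
case/dvdnP => q Nq; have -> : cval R (Some k) = cosN q; last exact: zspan_cosN.
rewrite /cosN Nq /=; congr (2 * cos _).
have : (0 < q * k)%N by rewrite -Nq.
rewrite muln_gt0 => /andP[q0 k0].
rewrite -mulr_natr natrM; field.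
by rewrite !pnatr_eq0 -!lt0n q0 k0.
Qed.

End CosRing.

(** * Length of an elementary conjugation *)

Section Bound.
Variables (R : realType) (S : finType) (m : coxeterMatrix S) (N : nat).
Hypothesis N0 : (0 < N)%N.
Hypothesis mN : forall s t, s != t -> (if m s t is Some k then k %| N else true)%N.
Notation V := {ffun S -> R^o}.
Notation act := (@act R S m).
Notation sroot := (@sroot R S).
Notation bf := (@bf R S m).
Notation reduced := (@reduced R S m).
Notation l := (cosgen R N).
Notation lat := (@lat R S l).
Implicit Types (s t : S) (w x : seq S) (K I J Q : pred S).

Lemma lat0P (v : V) : lat 0 v <-> forall s, zspan l (v s).
Proof.
split=> h s; first by have [y hy ->] := h s; rewrite mul1r.
by exists (v s : R); [exact: h|rewrite mul1r].
Qed.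

Lemma zspan_kf s t : zspan l (kf R m s t).
Proof.
rewrite /kf; case: eqVneq => [_|st]; first exact: zspan_nat.
by apply: zspanN; apply: zspan_cval => //; exact: mN.
Qed.

Lemma zspan_bf (u v : V) : lat 0 u -> lat 0 v -> zspan l (bf u v).
Proof.
move=> /lat0P hu /lat0P hv; apply: zspan_sum => s _; apply: zspan_sum => t _.
by apply: zspan_mul (zspan_kf s t) => //; exact: zspan_mul.
Qed.

Lemma latZ j (a : R) (v : V) : zspan l a -> lat j v -> lat j (a *: v).
Proof.
move=> ha hv s; have [y hy e] := hv s; exists (a * y); first exact: zspan_mul.
by rewrite vZE e mulrCA.
Qed.

Lemma latZ1 (a : R) (v : V) : zspan l a -> lat 0 v -> lat 1 (3 * a *: v).
Proof.
move=> ha /lat0P hv s; exists (a * (v s : R)); first exact: zspan_mul.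
by rewrite vZE expr1 mulrA.
Qed.

Lemma lat_sroot s : lat 0 (sroot s).
Proof. by apply/lat0P => t; rewrite ffunE; exact: zspan_nat. Qed.

Lemma lat_act w (v : V) : lat 0 v -> lat 0 (act w v).
Proof.
move=> hv; elim: w => //= s w IH; apply: latD => //; apply/latN/latZ.
  by apply: zspan_bf => //; exact: lat_sroot.
exact: lat_sroot.
Qed.

Definition rfl (b v : V) : V := v - bf v b *: b.

Lemma rflD b (u v : V) : rfl b (u + v) = rfl b u + rfl b v.
Proof. by rewrite /rfl bfDl scalerDl opprD addrACA. Qed.

Lemma rflK b : bf b b = 2 -> involutive (rfl b).
Proof.
move=> b2 v; rewrite {1}/rfl /rfl bfDl bfNl bfZl b2 -addrA -opprD -scalerDl.
have -> : bf v b + (bf v b - bf v b * 2) = 0 by ring.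
by rewrite scale0r subr0.
Qed.

Lemma lat_rfl b (v : V) : lat 0 b -> lat 0 v -> lat 0 (rfl b v).
Proof. by move=> hb hv; apply: latD => //; apply/latN/latZ => //; exact: zspan_bf. Qed.

Lemma rfl_act w s : act (w ++ s :: rev w) =1 rfl (act w (sroot s)).
Proof.
by move=> v; rewrite act_cat act_cons act_refl act_Krev.
Qed.

Lemma cong3_rfl b c : lat 0 b -> lat 0 c -> bf c c = 2 -> lat 1 (b - c) ->
  cong3 l (rfl b \o rfl c).
Proof.
move=> hb hc c2 hbc; split=> [u v|v hv|v hv] /=.
- by rewrite !rflD.
- by do 2!apply: lat_rfl => //.
(* With [u = rfl c v] the difference is [rfl b u - rfl c u], controlled by [b - c] alone. *)
rewrite -[X in _ - X](rflK c2); move: (rfl c v) (lat_rfl hc hv) => u hu.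
have /lat_exp[e he ebc] := hbc; rewrite expn1 in ebc.
have -> : rfl b u - rfl c u = 3 * - bf u e *: c - 3 * (bf u b) *: e.
  have bE : b = c + 3 *: e by rewrite scaler_nat -ebc addrC subrK.
  rewrite /rfl [in bf u b *: _]bE bE bfDr bfZr.
  apply/ffunP => s; rewrite !ffunE -![_ *: (_ : R^o)]/(_ * _ : R).
  move: (u s : R) (c s : R) (e s : R) (bf u c) (bf u e) => x y z p q.
  by rewrite -![@GRing.add _ _ _]/(_ + _ : R); ring.
apply: latD; first by apply: latZ1 => //; apply/zspanN/zspan_bf.
by apply/latN/latZ1 => //; exact: zspan_bf.
Qed.

(** Absence of torsion forces [rfl b (rfl c b) = b], that is [rfl c b = - b]. So [b] is a multiple
    of [c]; the norms leave a sign, and positivity fixes it. *)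
Lemma cong_roots_eq b c e : lat 0 b -> lat 0 c -> bf b b = 2 -> bf c c = 2 ->
  lat 1 (b - c) -> (0 < e)%N -> iter e (rfl b \o rfl c) b = b ->
  pos b -> pos c -> b = c.
Proof.
move=> hb hc b2 c2 hbc e0 he pb pc.
have /= h := cong3_torsion_free (cong3_rfl hb hc c2 hbc) e0 hb he.
have rbb : rfl b b = - b.
  by rewrite /rfl b2 scaler_nat mulr2n opprD addNKr.
have := congr1 (rfl b) h; rewrite rflK // rbb /rfl.
move=> /(congr1 (fun v => b - v)); rewrite opprB addrCA subrr addr0 opprK => ebc.
have bE : b = (bf b c / 2) *: c.
  rewrite mulrC -scalerA ebc -mulr2n -scaler_nat scalerA mulVf ?scale1r //.
  by rewrite pnatr_eq0.
set a := _ / 2 in bE.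
have h2 : a ^+ 2 = 1.
  by move: b2; rewrite bE bfZl bfZr c2 expr2 => ?; lra.
have [s bs] : exists s, b s != 0.
  apply/existsP; apply: contraT; rewrite negb_exists => /forallP h0.
  have v0 : b = 0 by apply/ffunP => k; rewrite ffunE; apply/eqP/negPn.
  by move: b2; rewrite v0 bf0l => /eqP; rewrite eq_sym pnatr_eq0.
have a0 : 0 < a.
  have : 0 < (b s : R) by rewrite lt_neqAle eq_sym bs pb.
  rewrite {1}bE vZE => h'; rewrite ltNge; apply/negP => an.
  by have := mulr_le0_ge0 an (pc s); rewrite leNgt h'.
have /eqP : a ^+ 2 = 1 ^+ 2 by rewrite h2 expr1n.
by rewrite eqrXn2 // ?ltW // => /eqP a1; rewrite bE a1 scale1r.
Qed.

(** For reduced [x] these are the positive roots that [x] makes negative, read off from the suffixes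
    of [x]; their number is the length. *)
Definition inversion x (v : V) := exists x1 r x2,
  x = x1 ++ r :: x2 /\ v = act (rev x2) (sroot r).

Fixpoint inversions x : seq V :=
  if x is r :: x' then act (rev x') (sroot r) :: inversions x' else [::].

Lemma size_inversions x : size (inversions x) = size x.
Proof. by elim: x => //= r x ->. Qed.

Lemma inversionsP x v : reflect (inversion x v) (v \in inversions x).
Proof.
apply: (iffP idP).
- elim: x => //= r x IH; rewrite inE => /orP[/eqP->|/IH[x1 [q [x2 [-> ->]]]]].
    by exists [::], r, x.
  by exists (r :: x1), q, x2.
- case=> x1 [r [x2 [-> ->]]]; elim: x1 => [|q x1 IH] /=; first exact: mem_head.
  by rewrite inE IH orbT.
Qed.

Lemma inversion_of_neg x w s : pos (act w (sroot s)) ->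
  pos (- act x (act w (sroot s))) -> inversion x (act w (sroot s)).
Proof.
elim: x => [|r x IH] p n.
  by case: (@pos_neg_root R S m w s).
have [px|nx] := root_sign R m (x ++ w) s; last first.
  rewrite act_cat in nx; have [x1 [q [x2 [-> ->]]]] := IH p nx.
  by exists (r :: x1), q, x2.
have := @neg_cons R S m r (x ++ w) s px; rewrite act_cons act_cat.
by move=> /(_ n) e; exists [::], r, x; rewrite -e act_revK.
Qed.

Lemma reduced_rev x : reduced x -> reduced (rev x).
Proof.
move=> h z ez; rewrite size_rev -(size_rev z); apply: h => v.
by rewrite (eq_act_rev ez) revK.
Qed.

Lemma reduced_suffix x1 x2 : reduced (x1 ++ x2) -> reduced x2.
Proof.
move=> /reduced_rev; rewrite rev_cat => /reduced_prefix /reduced_rev.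
by rewrite revK.
Qed.

Lemma inversion_pos x v : reduced x -> inversion x v -> pos v.
Proof.
move=> red [x1 [r [x2 [e ->]]]]; move: red; rewrite e => /reduced_suffix.
move=> /reduced_rev; rewrite rev_cons => h; apply: (@reduced_pos R S m _ r [::]).
by rewrite cats1.
Qed.

Lemma inversions_uniq x : reduced x -> uniq (inversions x).
Proof.
elim: x => //= r x IH red; rewrite IH ?andbT; last first.
  exact: (@reduced_suffix [:: r]).
apply/inversionsP => -[x1 [q [x2 [ex e]]]].
have : act x (act (rev x) (sroot r)) = sroot r by rewrite act_Krev.
rewrite e {1}ex act_cat act_cons act_Krev refl_sroot actN => ea.
have p : pos (act x1 (sroot q)).
  by apply: (@reduced_pos R S m x1 q x2); rewrite -ex; exact: (@reduced_suffix [:: r]).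
by apply: (@pos_neg_root R S m x1 q p); rewrite ea; exact: pos_sroot.
Qed.

(** * The inversions of an elementary conjugation *)

Section SizeBound.
Variables (J : pred S) (s : S) (x : seq S).
Let K : pred S := [pred k | (k == s) || J k].
Hypotheses (Js : ~~ J s) (Kx : all K x) (redx : reduced x).
Hypothesis xJ : forall j, J j -> exists2 k, K k & act x (sroot j) = sroot k.
Hypothesis xs : pos (- act x (sroot s)).

Let span_K w v : all K w -> span K v -> span K (act w v).
Proof. by move=> Kw; apply: span_act_over Kw _. Qed.

(** Some coordinate [t] of the image of [sroot s] is nonzero, hence negative, while no root from [J]
    is sent to [sroot t]. The [t]-coordinate of the image of the root is then governed by its
    [s]-coordinate alone. *)
Lemma neg_of_coef w r : all K w -> K r -> 0 < (act w (sroot r) s : R) ->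
  pos (- act x (act w (sroot r))).
Proof.
move=> Kw Kr b0; set b := act w (sroot r) in b0 *.
(* Otherwise the image of [sroot s] would lie in the span of the images of [J], and pulling back
   would put [sroot s] in the span of [J]. *)
have [t nt xt] : exists2 t, ~ (exists2 j, J j & act x (sroot j) = sroot t)
    & act x (sroot s) t != 0.
  apply: contrapT => hn.
  pose K' : pred S := [pred t | `[< exists2 j, J j & act x (sroot j) = sroot t >]].
  have h1 : span K' (act x (sroot s)).
    move=> t /asboolPn nt; apply/eqP; apply: contrapT => /negP xt.
    by apply: hn; exists t.
  have : span J (act (rev x) (act x (sroot s))).
    apply: span_linear h1 => k /asboolP[j Jj e]; rewrite -e act_revK.
    exact: span_sroot.
  rewrite act_revK => /(_ s Js); rewrite ffunE eqxx => /eqP.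
  by rewrite oner_eq0.
have xt0 : (act x (sroot s) t : R) < 0.
  by rewrite lt_neqAle xt; have := xs t; rewrite ffunE oppr_ge0.
have bt : act x b t = b s * (act x (sroot s) t : R) :> R.
  rewrite {1}[b]vec_sum act_sum sum_ffunE (bigD1 s) //= actZ vZE.
  rewrite big1 ?addr0 // => k ks; rewrite actZ vZE.
  have [Kk|nK] := boolP (K k); last first.
    by rewrite (span_K Kw (span_sroot R Kr)) // mul0r.
  move: Kk; rewrite /K /= (negPf ks) => /= Jk.
  have [k' _ e] := xJ Jk; rewrite e ffunE.
  case: eqP => [tk|_]; last by rewrite mulr0.
  by case: nt; exists k => //; rewrite e tk.
have := root_sign R m (x ++ w) r; rewrite act_cat -/b => -[p|//].
by have := p t; rewrite bt pmulr_rge0 // leNgt xt0.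
Qed.

(** With [s]-coordinate 0 the root would be a nonnegative combination over [J], which [x] keeps
    positive. *)
Lemma inversion_coef v : inversion x v -> 0 < (v s : R).
Proof.
move=> inv; have p := inversion_pos redx inv.
have [x1 [r [x2 [ex ev]]]] := inv.
have Kv : span K v.
  move: Kx; rewrite ex all_cat /= => /and3P[_ Kr Kx2].
  by rewrite ev; apply: span_K; [rewrite all_rev|exact: span_sroot].
rewrite lt_neqAle eq_sym p andbT; apply/negP => /eqP vs.
have px : pos (act x v).
  apply: (@pos_linear R S m J) p _ => [j /xJ[k _ ->]|t nt]; first exact: pos_sroot.
  by have [->//|ts] := eqVneq t s; apply: Kv; rewrite /K /= negb_or ts.
have : pos (- act x v).
  rewrite ev ex act_cat act_cons act_Krev refl_sroot actN opprK.
  by apply: (@reduced_pos R S m x1 r x2); rewrite -ex.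
by move: px; rewrite ev -act_cat; exact: pos_neg_root.
Qed.

Lemma inversion_lat v : inversion x v -> lat 0 v.
Proof. by case=> x1 [r [x2 [_ ->]]]; apply/lat_act/lat_sroot. Qed.

Lemma inversion_diag v : inversion x v -> bf v v = 2.
Proof. by case=> x1 [r [x2 [_ ->]]]; exact: root_diag. Qed.

(** The iterates stay in a finite list: inversions, their opposites, and at most two roots with zero
    [s]-coordinate. As [T] is injective, a repetition gives a period. *)
Lemma inversion_iter_torsion b c : inversion x b -> inversion x c ->
  exists2 e, (0 < e)%N & iter e (rfl b \o rfl c) b = b.
Proof.
move=> hb hc; set T := rfl b \o rfl c.
have b2 := inversion_diag hb; have c2 := inversion_diag hc.
have word v : inversion x v -> exists w, [/\ all K w & act w =1 rfl v].
  case=> x1 [r [x2 [ex ->]]]; exists (rev x2 ++ r :: x2); split.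
    by move: Kx; rewrite ex !all_cat all_rev /= => /and3P[_ -> ->].
  by move=> v'; rewrite -rfl_act revK.
have [wb [Kwb ewb]] := word b hb; have [wc [Kwc ewc]] := word c hc.
have root i : exists w r, [/\ all K w, K r & iter i T b = act w (sroot r)].
  elim: i => [|i [w [r [Kw Kr e]]]].
    case: hb => x1 [r [x2 [ex ->]]]; exists (rev x2), r.
    by move: Kx; rewrite ex !all_cat all_rev /= => /and3P[_ -> ->].
  exists (wb ++ wc ++ w), r; rewrite !all_cat Kwb Kwc; split=> //.
  by rewrite iterS e /T /= !act_cat ewb ewc.
have comb i : exists a d : R, iter i T b = a *: b + d *: c.
  elim: i => [|i [a [d e]]]; first by exists 1, 0; rewrite scale1r scale0r addr0.
  rewrite iterS e /T /= {1}/rfl; set p := bf _ b.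
  rewrite /rfl; set q := bf _ c; exists (a - p), (d - q).
  rewrite !scalerBl -!addrA; congr (_ + _).
  by rewrite [LHS]addrA [LHS]addrC.
have Tinj : injective T by apply: inj_comp; apply: can_inj; exact: rflK.
(* Iterates lie in the plane of [b] and [c], and [c] has nonzero [s]-coordinate. Zero [s]-coordinate
   thus cuts out the line of [g], on which norm 2 leaves two opposite vectors. *)
have key : exists d : V, forall i, (iter i T b s : R) = 0 ->
    iter i T b = d \/ iter i T b = - d.
  have [[i0 z0]|hn] := pselect (exists i, (iter i T b s : R) = 0); last first.
    by exists 0 => i hi; case: hn; exists i.
  exists (iter i0 T b) => i zi.
  have c0 := inversion_coef hc.
  pose g : V := b - ((b s : R) / (c s : R)) *: c.
  have mult j : (iter j T b s : R) = 0 -> exists a, iter j T b = a *: g.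
    have [a [d ->]] := comb j; rewrite ffunE !vZE => h; exists a.
    have -> : d = - (a * ((b s : R) / (c s : R))).
      by apply: (mulIf (lt0r_neq0 c0)); rewrite mulNr -mulrA divfK ?lt0r_neq0 //; lra.
    by rewrite /g scalerBr scalerA scaleNr.
  have [a ea] := mult _ zi; have [a0 ea0] := mult _ z0.
  have norm j : bf (iter j T b) (iter j T b) = 2.
    by have [w [r [_ _ ->]]] := root j; exact: root_diag.
  have := norm i; have := norm i0; rewrite ea ea0 !(bfZl, bfZr).
  move=> h0 h1.
  have g0 : bf g g != 0.
    by apply: contraTneq isT => g0; move: h0; rewrite g0 !mulr0 => /eqP; rewrite eq_sym pnatr_eq0.
  have : a ^+ 2 = a0 ^+ 2 by apply: (mulIf g0); rewrite !expr2 -!mulrA h0 h1.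
  move=> /eqP; rewrite eqf_sqr => /orP[] /eqP->; [left|right] => //.
  by rewrite scaleNr.
have [d hd] := key.
pose L := inversions x ++ map -%R (inversions x) ++ [:: d; - d].
have inL i : iter i T b \in L.
  rewrite !mem_cat !inE.
  have [w [r [Kw Kr e]]] := root i.
  have [/hd[]->|nz] := eqVneq (iter i T b s : R) 0; rewrite ?eqxx ?orbT //.
  have sp : 0 < (iter i T b s : R) -> iter i T b \in inversions x.
    move=> p0; apply/inversionsP; rewrite e; apply: inversion_of_neg.
      have [//|n] := root_sign R m w r.
      by have := n s; rewrite ffunE -e oppr_ge0 leNgt p0.
    by apply: neg_of_coef => //; rewrite -e.
  have [/sp->//|neg] := ltP 0 (iter i T b s : R).
  suff /(map_f -%R) : - iter i T b \in inversions x.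
    by rewrite opprK => ->; rewrite orbT.
  (* The opposite root is again the image of a simple root under a word over [K]: an odd number of
     letters [r] is appended. *)
  have eN : - iter i T b = act (rcons (rcons w r) r ++ [:: r]) (sroot r).
    by rewrite act_cat act_rcons2 /= refl_sroot actN e.
  have Kw' : all K (rcons (rcons w r) r ++ [:: r]).
    by rewrite all_cat !all_rcons /= Kr Kw.
  have p0 : 0 < (- iter i T b : V) s :> R.
    by rewrite ffunE oppr_gt0 lt_neqAle nz.
  apply/inversionsP; rewrite eN; apply: inversion_of_neg.
    have [//|n] := root_sign R m (rcons (rcons w r) r ++ [:: r]) r.
    by have := n s; rewrite ffunE -eN oppr_ge0 leNgt p0.
  by apply: neg_of_coef => //; rewrite -eN.
have : ~~ uniq [seq iter i T b | i <- iota 0 (size L).+1].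
  apply/negP => u; suff : (size [seq iter i T b | i <- iota 0 (size L).+1] <= size L)%N.
    by rewrite size_map size_iota ltnn.
  by apply: uniq_leq_size => // v /mapP[i _ ->].
move=> /(uniqPn 0)[i [j [ij]]]; rewrite size_map size_iota => jL.
rewrite !(nth_map 0%N) ?size_iota ?(ltn_trans ij) // !nth_iota ?(ltn_trans ij) //.
rewrite !add0n => e; exists (j - i)%N; first by rewrite subn_gt0.
have iterinj : injective (iter i T) by elim: (i) => [|k IH] u v //; rewrite !iterS => /Tinj /IH.
by apply: iterinj; rewrite -iterD addnC subnK ?e // ltnW.
Qed.

(** Integer coordinates are chosen for each lattice vector and reduced modulo 3. They need not be
    unique: only the implication from equal residues to congruence matters, and it gives at most
    [3 ^ (#|S| * N)] classes. *)
Lemma lat_class : exists cls : V -> {ffun S * 'I_N -> 'I_3},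
  forall u v, lat 0 u -> lat 0 v -> cls u = cls v -> lat 1 (u - v).
Proof.
have sl : size l = N by rewrite size_map size_iota.
pose z (v : V) t : nat -> int :=
  if pselect (zspan l (v t)) is left h then projT1 (cid h) else fun=> 0.
have zP v : lat 0 v -> forall t, v t = zcomb l (z v t).
  by move=> /lat0P hv t; rewrite /z; case: pselect => // h; case: cid.
exists (fun v => [ffun p : S * 'I_N => inord `|(z v p.1 p.2 %% 3)%Z|%N]) => u v hu hv.
move=> /ffunP h t; rewrite ffunE ffunE (zP u) // (zP v) // /zcomb.
rewrite -sumrB.
exists (zcomb l (fun i => ((z u t i - z v t i) %/ 3)%Z)); first by eexists.
rewrite /zcomb mulr_sumr; apply: eq_bigr => i _.
rewrite -mulrBl mulrA -rmorphB; congr (_ * _).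
have iN : (i < N)%N by apply: leq_trans (ltn_ord i) _; rewrite sl.
have /(congr1 val) /= := h (t, Ordinal iN); rewrite !ffunE /=.
have small a : (`|(a %% 3)%Z| < 3)%N by lia.
rewrite !inordK // => e; have -> : 3 ^+ 1 = 3%:~R :> R by [].
by rewrite -rmorphM; congr (_%:~R); lia.
Qed.

(** Two inversions in the same class would be equal by [cong_roots_eq], so there are at most as many
    letters as classes. *)
Lemma size_bound : (size x <= 3 ^ (#|S| * N))%N.
Proof.
have [cls hcls] := lat_class.
rewrite leqNgt; apply/negP => big.
have nu : ~~ uniq (map cls (inversions x)).
  apply/negP => /card_uniqP; rewrite size_map size_inversions => e.
  have := max_card (mem (map cls (inversions x))).
  by rewrite e card_ffun card_prod !card_ord leqNgt big.
move: nu => /(uniqPn (cls 0))[i [j [ij]]]; rewrite size_map => jL.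
have iL := ltn_trans ij jL.
rewrite !(nth_map 0) //; set b := nth _ _ i; set c := nth _ _ j => e.
have hb : inversion x b by apply/inversionsP; exact: mem_nth.
have hc : inversion x c by apply/inversionsP; exact: mem_nth.
have [k k0 hk] := inversion_iter_torsion hb hc.
have bc : b = c.
  apply: cong_roots_eq k0 hk _ _; rewrite ?inversion_diag //.
  - exact: inversion_lat.
  - exact: inversion_lat.
  - by apply: hcls => //; exact: inversion_lat.
  - exact: inversion_pos hb.
  - exact: inversion_pos hc.
have /eqP := bc; rewrite nth_uniq ?inversions_uniq // => /eqP ijE.
by move: ij; rewrite ijE ltnn.
Qed.

End SizeBound.
End Bound.

(** * Conjugation by a word of bounded length *)

Section Moves.
Variables (R : realType) (S : finType) (m : coxeterMatrix S) (N : nat).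
Hypothesis N0 : (0 < N)%N.
Hypothesis mN : forall s t, s != t -> (if m s t is Some k then k %| N else true)%N.
Notation act := (@act R S m).
Notation sroot := (@sroot R S).
Notation reduced := (@reduced R S m).
Variables (Q I : pred S).

Definition move_bound : nat := (3 ^ (#|S| * N))%N.

(** A state records where the simple roots of [I] currently are. There are at most [#|S| ^ #|S|]
    states, which will bound the number of moves. *)
Definition conj_move (g h : {ffun S -> S}) := `[< exists x, [/\ all Q x,
  (size x <= move_bound)%N & forall i, I i -> act x (sroot (g i)) = sroot (h i)] >].

(** The last letter [s] of [d] is not in the current state [J], whose roots [d] keeps positive.
    Factoring [d] as [b ++ x], with [x] over [J] and [s], peels off the elementary conjugation [x];
    the shorter [b] still sends simple roots to simple roots. *)
Lemma conj_move_path n d (g : {ffun S -> S}) (f : S -> S) : (size d < n)%N ->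
  reduced d -> all Q d -> (forall i, I i -> act d (sroot (g i)) = sroot (f i)) ->
  exists2 p, path conj_move g p & forall i, I i -> last g p i = f i.
Proof.
elim: n d g => // n IH d g; rewrite ltnS; case: (lastP d) => [_ _ _ hd|{}d s dn red Qd hd].
  by exists [::] => // i Ii; apply: (@sroot_inj R); exact: hd.
have ns : pos (- act (rcons d s) (sroot s)).
  rewrite act_rcons refl_sroot actN opprK; apply: (@reduced_pos R S m d s [::]).
  by rewrite cats1.
move: (rcons d s) dn red Qd hd ns => {}d dn red Qd hd ns.
pose J : pred S := [pred k | [exists i, I i && (g i == k)]].
pose K : pred S := [pred k | (k == s) || J k].
have Js : ~~ J s.
  apply/existsP => -[i /andP[Ii /eqP gi]]; move: ns; rewrite -gi hd // => h.
  by apply: (@pos_neg_root R S m [::] (f i)) h; exact: pos_sroot.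
have [b [x [Qb Qx redbx ebx hpos]]] := coset_decomp R m K Qd.
have Kx : all K x by apply: sub_all Qx => k /andP[].
have Qx' : all Q x by apply: sub_all Qx => k /andP[].
have redx : reduced x by exact: reduced_suffix redbx.
have spanx k : K k -> span K (act x (sroot k)).
  by move=> Kk; apply: span_act_over Kx _ (span_sroot R Kk).
have negx v : span K v -> pos (- v) -> pos (- act b v).
  move=> sv pv; rewrite -actN; apply: (@pos_linear R S m K) => // t nt.
  by rewrite ffunE sv ?oppr0.
have xJ i : I i -> exists2 k, K k & act x (sroot (g i)) = sroot k /\ act b (sroot k) = sroot (f i).
  move=> Ii; have Kg : K (g i).
    by apply/orP; right; apply/existsP; exists i; rewrite Ii eqxx.
  have px : pos (act x (sroot (g i))).
    have [//|nx] := root_sign R m x (g i).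
    have := negx _ (spanx _ Kg) nx; rewrite -act_cat ebx hd // => h.
    by case: (@pos_neg_root R S m [::] (f i)) => //; exact: pos_sroot.
  have [|k [Kk ek exg]] := @simple_of_pos_sum R S m K b _ (f i) px (spanx _ Kg) hpos.
    by rewrite -act_cat ebx hd.
  exists k => //; split=> //; rewrite exg (root_multiple exg) ?scale1r //.
have nxs : pos (- act x (sroot s)).
  have [p|//] := root_sign R m x s; case: (@pos_neg_root R S m d s) => //.
  rewrite -ebx act_cat; apply: (pos_linear hpos p); apply: spanx.
  by rewrite /K /= eqxx.
have sx : (size x <= move_bound)%N.
  apply: (@size_bound R S m N N0 mN J s x Js Kx redx _ nxs) => j /existsP[i /andP[Ii /eqP <-]].
  by have [k Kk [e _]] := xJ i Ii; exists k.
(* As [x] makes [sroot s] negative it is not empty, so [b] is strictly shorter than [d]. *)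
have x0 : (0 < size x)%N.
  by case: (x) nxs => // h; case: (@pos_neg_root R S m [::] s); first exact: pos_sroot.
have bn : (size b < n)%N.
  apply: leq_trans dn; rewrite -(reduced_size redbx red ebx) size_cat.
  by rewrite -addn1 leq_add2l.
pose h : {ffun S -> S} := [ffun i => odflt (g i)
  [pick k | (act x (sroot (g i)) == sroot k) && (act b (sroot k) == sroot (f i))]].
have hP i : I i -> act x (sroot (g i)) = sroot (h i) /\ act b (sroot (h i)) = sroot (f i).
  move=> Ii; rewrite ffunE; case: pickP => [k /andP[/eqP-> /eqP->] //|].
  by have [k _ [e1 e2]] := xJ i Ii; move/(_ k); rewrite e1 e2 !eqxx.
have [|p hp lp] := IH b h bn (reduced_prefix redbx) Qb.
  by move=> i /hP[].
exists (h :: p) => //=; rewrite hp andbT; apply/asboolP; exists x; split=> //.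
by move=> i /hP[].
Qed.

Lemma move_path_word (g : {ffun S -> S}) p : path conj_move g p -> exists d,
  [/\ all Q d, (size d <= size p * move_bound)%N
    & forall i, I i -> act d (sroot (g i)) = sroot (last g p i)].
Proof.
elim: p g => [|h p IH] g /=; first by exists [::].
case/andP => /asboolP[x [Qx sx ex]] /IH[d [Qd sd ed]]; exists (d ++ x); split.
- by rewrite all_cat Qd.
- by rewrite size_cat mulSn addnC leq_add.
- by move=> i Ii; rewrite act_cat ex // ed.
Qed.

Lemma bounded_conj d (f : S -> S) : all Q d ->
  (forall i, I i -> act d (sroot i) = sroot (f i)) ->
  exists d', [/\ all Q d', (size d' <= #|S| ^ #|S| * move_bound)%N
    & forall i, I i -> act d' (sroot i) = sroot (f i)].
Proof.
move=> Qd hd; have [d1 [e1 red1 Qd1]] := exists_reduced_over R m Qd.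
pose g : {ffun S -> S} := [ffun i => i].
have [||p hp lp] := @conj_move_path (size d1).+1 d1 g f _ red1 Qd1 => //.
  by move=> i Ii; rewrite ffunE e1 hd.
(* Removing loops from the path leaves pairwise distinct states. *)
case/shortenP: hp lp => q hq uq _ lp.
have sq : (size q <= #|S| ^ #|S|)%N.
  have := max_card (mem (g :: q)); rewrite card_ffun (card_uniqP uq) /=.
  exact: ltnW.
have [d' [Qd' sd' ed']] := move_path_word hq; exists d'; split=> //.
  by apply: leq_trans sd' _; rewrite leq_mul2r sq orbT.
by move=> i Ii; have := ed' i Ii; rewrite ffunE lp.
Qed.

End Moves.

(** * From Dyer groups to Coxeter groups *)

(** Determined by its first letter, like the defining relators, whereas [ralt] is determined by its
    last letter, as suits arguments on descents. *)
Definition altw (T : Type) (k : nat) (u v : T) : seq T :=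
  mkseq (fun i => if odd i then v else u) k.

Lemma raltE (T : Type) k (t s : T) :
  ralt k t s = if odd k then altw k t s else altw k s t.
Proof.
elim: k t s => // k IH t s; rewrite /= IH /altw !mkseqS.
by case: (odd k).
Qed.

Section CoxeterExtra.
Variables (R : realType) (S : finType) (m : coxeterMatrix S).
Notation act := (@act R S m).
Notation sroot := (@sroot R S).
Implicit Types (s t : S) (w : seq S).

Lemma act_altw k s t : s != t -> m s t = Some k ->
  act (altw k s t) =1 act (altw k t s).
Proof.
move=> st mst v; have := @act_braid R S m k s t st mst v; rewrite !raltE.
by case: odd => [->|->].
Qed.

Lemma act_commute s t : s != t -> m s t = Some 2%N -> act [:: s; t] =1 act [:: t; s].
Proof. by move=> st /(act_altw st). Qed.

Lemma act_power k s t : s != t -> m s t = Some k ->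
  act (flatten (nseq k [:: s; t])) =1 id.
Proof.
move=> st mst; have -> : flatten (nseq k [:: s; t]) = rev (ralt k s t) ++ ralt k t s.
  elim: k s t {st mst} => // k IH s t.
  rewrite /= rev_rcons /= -rcons_cat -IH; congr (_ :: _).
  by elim: k {IH} => //= k ->.
by move=> v; rewrite act_cat (@act_braid R S m k s t st mst) act_revK.
Qed.

Lemma refl_commute s t : s != t -> m s t = Some 2%N -> refl m s (sroot t) = sroot t.
Proof.
move=> st mst; rewrite /refl prj_sroot /kf eq_sym (negPf st) ccC /cc mst cval2.
by rewrite oppr0 scale0r subr0.
Qed.

Lemma act_sub_span K w v : all K w -> span K (act w v - v).
Proof. by move=> Kw t nt; rewrite ffunE (@act_over R S m K w v t Kw nt) ffunE subrr. Qed.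

(** In [d = b ++ x], with [x] alternating in [s], [r], an empty [x] keeps [sroot s] positive. If [x]
    ends in [s], it sends [sroot r] to a combination with both coefficients positive, whose image is
    not simple; if [x] ends in [r], the image of [sroot r] is negative. *)
Lemma infinite_label_commute d s r t : s != r -> m s r = None ->
  act d (sroot r) = sroot t -> pos (- act d (sroot s)) -> False.
Proof.
move=> sr msr dr ds.
have [b [x [_ Kx _ ebx hpos]]] := @coset_decomp R S m predT (pred2 s r) d (all_predT d).
have [k [a [c [hac _ ex]]]] := dihedral_word R m Kx.
have {}ebx : act (b ++ ralt k a c) =1 act d.
  by move=> v; rewrite act_cat -ex -act_cat ebx.
have cpos j : 0 < chb (cc R m s r) j.+1 by rewrite /cc msr; exact: chb_inf_gt0.
have cpos0 j : 0 <= chb (cc R m s r) j.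
  by case: j => // j; exact: ltW.
have ps : pos (act b (sroot s)) by apply: hpos; rewrite /= eqxx.
have pr : pos (act b (sroot r)) by apply: hpos; rewrite /= eqxx orbT.
case: k {ex} ebx => [|k] ebx.
  by apply: (@pos_neg_root R S m d s) ds; rewrite -ebx cats0.
case: hac ebx => -[-> ->] ebx.
  have e := @act_ralt_sroot R S m k.+1 r s; rewrite eq_sym sr in e.
  move: (e isT); set v := act _ (sroot r) => ev.
  have bv : act b v = sroot t by rewrite -act_cat ebx.
  rewrite ccC in ev; clearbody v.
  have pv : pos v.
    by rewrite ev; apply: posD; apply: posZ => //; exact: pos_sroot.
  have sv : span (pred2 s r) v.
    move=> q; rewrite /= negb_or => /andP[qs qr].
    by rewrite ev ffunE !vZE !ffunE; case: odd; rewrite (negPf qs) (negPf qr) !mulr0 addr0.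
  have [q [_ _ vq]] := @simple_of_pos_sum R S m (pred2 s r) b v t pv sv hpos bv.
  have vs : v s != 0 /\ v r != 0.
    rewrite ev !ffunE -![_ *: (_ : R^o)]/(_ * _ : R).
    case: odd; rewrite !eqxx [r == s]eq_sym (negPf sr) !mulr0 !mulr1 ?addr0 ?add0r;
      by rewrite !gt_eqF.
  have vE p : v p = v q * (p == q)%:R :> R.
    by have /(congr1 (fun f : {ffun S -> R^o} => f p)) := vq; rewrite vZE ffunE.
  case: vs => vs vr; have [sq|sq] := eqVneq s q.
    by move: vr; rewrite vE -sq [r == s]eq_sym (negPf sr) mulr0 eqxx.
  by move: vs; rewrite vE (negPf sq) mulr0 eqxx.
apply: (@pos_neg_root R S m [::] t); first exact: pos_sroot.
rewrite -[act [::] _]dr -ebx act_cat /= act_rcons refl_sroot !actN opprK.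
have e := @act_ralt_sroot R S m k r s; rewrite eq_sym sr ccC in e.
rewrite (e isT) actD !actZ.
by apply: posD; apply: posZ => //; case: odd.
Qed.

End CoxeterExtra.

(** * The Coxeter matrices attached to a Dyer graph *)

Section DyerGraph.
Variables (R : realType) (V : finType) (G : dyerGraph V).
Implicit Types (u v p : V).

Lemma mlabelC u v : mlabel G u v = mlabel G v u.
Proof.
rewrite /mlabel adj_sym; case: ifP => // a.
by rewrite elabel_sym // adj_sym.
Qed.

Lemma mlabel_gt1 u v : if mlabel G u v is Some k then (1 < k)%N else true.
Proof.
rewrite /mlabel; case: ifP => // /elabel_gt2.
by case: elabel => //= k; exact: ltnW.
Qed.

(** The Dyer condition enters through this dichotomy. *)
Lemma mlabel_ge3 u v : vlabel G u != Some 2%N ->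
  mlabel G u v = None \/ mlabel G u v = Some 2%N.
Proof.
move=> u2; rewrite /mlabel; case: ifP; last by right.
move=> a; left; rewrite elabel_sym //; apply: dyer_cond; first by rewrite adj_sym.
have := vlabel_geq2 G u.
case: vlabel u2 => [k|//] /eqP k2; rewrite /label_geq => h.
have k3 : k <> 2%N by move=> e; apply: k2; rewrite e.
by lia.
Qed.

(** Every vertex is treated as a reflection here; only words over vertices of order 2 will be
    compared, for which the Coxeter relations are those of the Dyer group. *)
Definition cmV : coxeterMatrix V :=
  @CoxeterMatrix V (mlabel G) mlabelC (fun u v _ => mlabel_gt1 u v).

(** The graph is copied in two layers. Distinct vertices in different layers commute when their
    label is finite, so that a braid relation between generators of order 2 splits into one relation
    per layer. *)
Definition dlabel (s t : V * bool) : label :=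
  if s.1 == t.1 then vlabel G s.1
  else if s.2 == t.2 then mlabel G s.1 t.1
  else if mlabel G s.1 t.1 is Some _ then Some 2%N else None.

Lemma dlabelC s t : dlabel s t = dlabel t s.
Proof.
by rewrite /dlabel eq_sym mlabelC [s.2 == _]eq_sym; case: eqP => // ->.
Qed.

Lemma dlabel_gt1 s t : s <> t -> if dlabel s t is Some k then (1 < k)%N else true.
Proof.
move=> _; rewrite /dlabel; case: ifP => _.
  by have := vlabel_geq2 G s.1; case: vlabel.
by case: ifP => _; [exact: mlabel_gt1|case: mlabel].
Qed.

(* The generator [v] of the Dyer group is sent to the product of the
   reflections [(v, false)] and [(v, true)], which has order [vlabel v]. *)
Definition cmD : coxeterMatrix (V * bool)%type := CoxeterMatrix dlabelC dlabel_gt1.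

Definition dw (w : word V) : seq (V * bool) :=
  flatten [seq [:: (a.1, a.2); (a.1, ~~ a.2)] | a <- w].

Notation acD := (@act R _ cmD).
Notation acV := (@act R _ cmV).
Notation sroot := (@sroot R _).

Lemma dw_cat (u w : word V) : dw (u ++ w) = dw u ++ dw w.
Proof. by rewrite /dw map_cat flatten_cat. Qed.

Lemma dw_inv w : dw (inv_word w) = rev (dw w).
Proof.
elim: w => // -[v b] w IH; rewrite /inv_word map_cons rev_cons -cats1 dw_cat.
rewrite -/(inv_word w) IH /dw /= !rev_cons -!cats1 -catA.
by rewrite /= negbK.
Qed.

Lemma all_dw (A : pred V) w : all A [seq a.1 | a <- w] -> all [pred s | A s.1] (dw w).
Proof. by elim: w => //= a w IH /andP[Aa /IH]; rewrite /dw /= Aa => ->. Qed.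

Lemma dw_split u v (x : seq V) : (forall a b, a \in [:: u; v] -> b \in [:: u; v] ->
    cmD (a, false) (b, true) = Some 2%N) -> all (pred2 u v) x ->
  acD (dw [seq (a, false) | a <- x]) =1
    acD ([seq (a, false) | a <- x] ++ [seq (a, true) | a <- x]).
Proof.
move=> h; elim: x => //= a x IH /andP[ha hx] z.
have ha' : a \in [:: u; v] by rewrite !inE.
rewrite /dw /= -/(dw _) IH //; congr (refl _ _ _); rewrite !act_cat act_cons.
move: (act _ _ z) => {}z; elim: x hx {IH} => //= b x IH /andP[hb /IH<-].
have hb' : b \in [:: u; v] by rewrite !inE.
have ne : (b, false) != (a, true) by apply/eqP.
set y := act _ _ _.
by have /= -> := @act_commute R _ cmD _ _ ne (h _ _ hb' ha') y.
Qed.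

Lemma dlabel_same u v i : u != v -> cmD (u, i) (v, i) = mlabel G u v.
Proof. by move=> /negPf uv; rewrite /= /dlabel /= uv eqxx. Qed.

Lemma dlabel_diff u v k : u != v -> mlabel G u v = Some k ->
  cmD (u, false) (v, true) = Some 2%N.
Proof. by move=> /negPf uv e; rewrite /= /dlabel /= uv e. Qed.

(** For label 2, both reflections of [u] commute with both of [v]. For a larger finite label the
    Dyer condition makes both generators of order 2, so all cross-layer pairs commute and [dw_split]
    separates the layers. *)
Lemma act_dw_braid u v k : u != v -> mlabel G u v = Some k ->
  acD (dw (alt_word k u v)) =1 acD (dw (alt_word k v u)).
Proof.
move=> uv muv.
have altE a b : alt_word k a b = [seq (x, false) | x <- altw k a b].
  by rewrite /alt_word /altw /mkseq -map_comp.
have sym2 a b : a \in [:: u; v] -> b \in [:: u; v] -> a != b ->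
    cmD (a, false) (b, true) = Some 2%N.
  rewrite !inE => /orP[]/eqP-> /orP[]/eqP-> //; rewrite ?eqxx // => ab.
    exact: dlabel_diff muv.
  by apply: (@dlabel_diff _ _ k) => //; rewrite mlabelC.
have [k2|k2] := eqVneq k 2%N.
  subst k => z; rewrite /dw /=.
  have vu : v != u by rewrite eq_sym.
  have cc s t : s.1 \in [:: u; v] -> t.1 \in [:: u; v] -> s.1 != t.1 ->
      acD [:: s; t] =1 acD [:: t; s].
    case: s t => [a i] [b j] /= ha hb ab.
    have mab : mlabel G a b = Some 2%N.
      move: ha hb ab; rewrite !inE => /orP[]/eqP-> /orP[]/eqP->; rewrite ?eqxx //.
      by rewrite mlabelC.
    apply: act_commute; first by apply: contraNneq ab => -[->].
    by rewrite /= /dlabel /= (negPf ab) mab; case: ifP.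
  have e i j (y : {ffun V * bool -> R^o}) : refl cmD (u, i) (refl cmD (v, j) y) = refl cmD (v, j) (refl cmD (u, i) y).
    have := cc (u, i) (v, j); rewrite /= !inE !eqxx orbT => /(_ isT isT uv y).
    by [].
  by rewrite (e true false) (e true true) (e false false) (e false true).
have f2 a : a \in [:: u; v] -> vlabel G a = Some 2%N.
  have vu : mlabel G v u = Some k by rewrite mlabelC.
  rewrite !inE => /orP[]/eqP->; apply/eqP; apply: contraT => /mlabel_ge3.
    by move=> /(_ v); rewrite muv => -[] // [k2']; rewrite k2' eqxx in k2.
  by move=> /(_ u); rewrite vu => -[] // [k2']; rewrite k2' eqxx in k2.
have h a b : a \in [:: u; v] -> b \in [:: u; v] -> cmD (a, false) (b, true) = Some 2%N.
  move=> ha hb; have [<-|ab] := eqVneq a b; last exact: sym2.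
  by rewrite /= /dlabel /= eqxx f2.
have hall a b : all (pred2 u v) [:: a; b] -> all (pred2 u v) (altw k a b).
  move=> /and3P[ha hb _]; apply/allP => x /mapP[i _ ->]; by case: ifP.
have mapE i a b : [seq (x, i) | x <- altw k a b] = altw k (a, i) (b, i).
  by rewrite /altw /mkseq -map_comp; apply: eq_map => j /=; case: ifP.
have br i z : acD (altw k (u, i) (v, i)) z = acD (altw k (v, i) (u, i)) z.
  apply: act_altw; last by rewrite dlabel_same.
  by apply: contraNneq uv => -[->].
move=> z; rewrite !altE !(dw_split h) ?hall //= ?eqxx ?orbT // !act_cat !mapE.
by rewrite !br.
Qed.

Lemma dw_act (u w : word V) : pres_eq (dyer_rel G) u w -> acD (dw u) =1 acD (dw w).
Proof.
elim=> {u w}.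
- move=> u w [v k vk|a b k ab abk]; last exact: act_dw_braid.
  have -> : dw (nseq k (v, false)) = flatten (nseq k [:: (v, false); (v, true)]).
    by rewrite /dw map_nseq.
  by apply: act_power; [apply/eqP|rewrite /= /dlabel /= eqxx].
- by move=> [v b] z; rewrite /dw /= negbK !reflK.
- by [].
- by move=> u w _ h z; rewrite h.
- by move=> u w x _ h1 _ h2 z; rewrite h1.
- by move=> u u' w w' _ h1 _ h2 z; rewrite !dw_cat !act_cat h1 h2.
Qed.

(* On words over [order2] generators this inverts [dw]; it induces a map from
   the Coxeter group of [cmD] to that of [cmV]. *)
Definition kill (w : seq (V * bool)) : seq V :=
  [seq s.1 | s <- w & ~~ s.2 && (vlabel G s.1 == Some 2%N)].

Lemma kill_cat (u w : seq (V * bool)) : kill (u ++ w) = kill u ++ kill w.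
Proof. by rewrite /kill filter_cat map_cat. Qed.

Lemma kill_rcons (u : seq (V * bool)) s : kill (rcons u s) = kill u ++ kill [:: s].
Proof. by rewrite -cats1 kill_cat. Qed.

(** If both letters of a braid relation survive, it becomes a braid relation of [cmV]; if neither
    does, both sides vanish. If exactly one does, the label is 2 and both sides reduce to that
    letter. *)
Lemma kill_step (w w' : seq (V * bool)) : tstep cmD w w' -> acV (kill w) =1 acV (kill w').
Proof.
have ks s' : kill [:: s'] = if ~~ s'.2 && (vlabel G s'.1 == Some 2%N) then [:: s'.1] else [::].
  by rewrite /kill /=; case: ifP.
case=> [a s z|a s t k z st mst] y; rewrite !kill_cat !act_cat.
  rewrite -[[:: s, s & z]]/([:: s] ++ [:: s] ++ z) !kill_cat !act_cat.
  by rewrite ks; case: ifP => //= _; rewrite reflK.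
congr (act _ _ _); move: (act _ _ y) => {a z}y.
have kr j s' t' : kill (ralt j.+1 s' t') = kill (ralt j t' s') ++ kill [:: s'].
  by rewrite /= kill_rcons.
have one s' t' : cmD s' t' = Some k -> ~~ s'.2 && (vlabel G s'.1 == Some 2%N) ->
    ~~ (~~ t'.2 && (vlabel G t'.1 == Some 2%N)) -> k = 2%N.
  case: s' t' => [u i] [v j] /= e /andP[/negPf i0 /eqP fu].
  move: e; rewrite /dlabel /= i0; case: eqVneq => [<-|uv]; first by rewrite fu => -[].
  case: j => /=; first by case: mlabel => // j [].
  by move=> muv /(mlabel_ge3 u); rewrite mlabelC muv => -[] // [].
have [hs|hs] := boolP (~~ s.2 && (vlabel G s.1 == Some 2%N));
  have [ht|ht] := boolP (~~ t.2 && (vlabel G t.1 == Some 2%N)).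
- have kk j : kill (ralt j s t) = ralt j s.1 t.1 /\ kill (ralt j t s) = ralt j t.1 s.1.
    elim: j => // j [IH1 IH2]; rewrite !kr !ks hs ht IH1 IH2.
    by rewrite !cats1.
  rewrite !(proj1 (kk _)) !(proj2 (kk _)).
  case: s t st mst hs ht {one kk ks kr} => [u [//|]] [v [//|]] /= uv muv _ _.
  have uv' : u != v by apply: contraNneq uv => ->.
  rewrite (@act_braid R _ cmV k u v) //.
  by rewrite -muv /dlabel /= (negPf uv').
- by rewrite (one s t mst hs ht) !kr !ks hs (negPf ht).
- have mts : cmD t s = Some k by rewrite /= dlabelC.
  by rewrite (one t s mts ht hs) !kr !ks ht (negPf hs).
- have kk j : kill (ralt j s t) = [::] /\ kill (ralt j t s) = [::].
    by elim: j => // j [IH1 IH2]; rewrite !kr !ks (negPf hs) (negPf ht) IH1 IH2.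
  by rewrite (proj1 (kk _)) (proj2 (kk _)).
Qed.

(** Tits' theorem turns an equality of linear actions into a chain of moves, which is what [kill]
    respects. *)
Lemma kill_act (u w : seq (V * bool)) : acD u =1 acD w -> acV (kill u) =1 acV (kill w).
Proof.
move=> /(tits (all_predT u) (all_predT w))[p [hp <- _]].
elim: p u hp => [|x p IH] u //= /andP[/asboolP ux /IH h] z; rewrite -h.
by case: ux => /kill_step ->.
Qed.

End DyerGraph.

(** * A combinatorial criterion *)

Section ConjSets.
Local Open Scope classical_set_scope.
Variable D : groupType.
Implicit Types (Y : set D) (a : D).
Local Open Scope group_scope.

Lemma conj_setV a Y Y' : conj_set a Y = Y' -> conj_set a^-1 Y' = Y.
Proof.
move=> <-; rewrite eqEsubset; split=> x.
  by case=> _ [y Yy <-] <-; rewrite invgK !mulgA mulVg mul1g mulgVK.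
move=> Yx; exists (a * x * a^-1); first by exists x.
by rewrite invgK !mulgA mulVg mul1g mulgVK.
Qed.

Lemma generated_sub Y x : Y x -> generated Y x.
Proof. by move: x; exact: sub_smallest. Qed.

Lemma generated_conj a Y : conj_set a (generated Y) = generated (conj_set a Y).
Proof.
have sub (b : D) (Z : set D) : generated (conj_set b Z) `<=` conj_set b (generated Z).
  apply: smallest_sub.
    have [g1 gM] : is_subgroup (generated Z).
      split; first by move=> H [[]].
      by move=> x y hx hy H hH; case: (hH) => -[_ h] _; apply: h; [exact: hx|exact: hy].
    split; first by exists 1; rewrite // mulg1 mulgV.
    move=> _ _ [x hx <-] [y hy <-]; exists (x * y^-1); first exact: gM.
    by rewrite !invgM invgK !mulgA mulgVK.
  by move=> _ [x Zx <-]; exists x => //; exact: generated_sub.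
rewrite eqEsubset; split; last exact: sub.
have := sub a^-1 (conj_set a Y); rewrite (conj_setV (Y := Y)) // => h x [y hy <-].
have [z hz <-] := h _ hy; rewrite invgK !mulgA mulgV mul1g.
by rewrite mulgK.
Qed.

Lemma conj_subset_parabolic Y Y' : conj_subset Y Y' -> conj_parabolic Y Y'.
Proof. by case=> b <-; exists b; exact: generated_conj. Qed.

End ConjSets.

Section Criterion.
Local Open Scope classical_set_scope.
Variables (V : finType) (G : dyerGraph V).
Implicit Types (A : {set V}) (u v p y : V).

Definition order2 : pred V := [pred v | vlabel G v == Some 2%N].

Definition commuting A : pred V := [pred u | order2 u &&
  [forall p, (p \in A) && ~~ order2 p ==> (mlabel G u p == Some 2%N)]].

Definition conj_step A A' b := forall y, y \in A -> order2 y ->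
  exists y', [/\ y' \in A', order2 y'
    & tchain (cmV G) (size b).+1 order2 (rcons b y) (y' :: b)].

Definition conj_step' A A' b := forall y', y' \in A' -> order2 y' ->
  exists y, [/\ y \in A, order2 y
    & tchain (cmV G) (size b).+1 order2 (rcons b y) (y' :: b)].

(** A finitary certificate: generators of order at least 3 are left in place by [b], and those of
    order 2 are moved from [A] onto [A'], each move being witnessed by a chain of bounded words. *)
Definition crit A A' (b : seq V) := [/\
  forall p, ~~ order2 p -> (p \in A) = (p \in A'),
  all (commuting A) b, conj_step A A' b & conj_step' A A' b].

Definition vw (w : seq V) : word V := [seq (v, false) | v <- w].

Lemma vw_cat (u w : seq V) : vw (u ++ w) = vw u ++ vw w. Proof. exact: map_cat. Qed.

(** On letters of order 2, deleting a repeated letter is a power relation, and braid moves are braid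
    relations. *)
Lemma vw_step (u w : seq V) : all order2 u -> tstep (cmV G) u w ->
  pres_eq (dyer_rel G) (vw u) (vw w).
Proof.
have ctx (a b x z : word V) : pres_eq (dyer_rel G) x z ->
    pres_eq (dyer_rel G) (a ++ x ++ b) (a ++ z ++ b).
  by move=> h; apply: pres_cat (pres_refl _ _) (pres_cat h (pres_refl _ _)).
move=> + st; case: st => [a s z|a s t k z st mst].
  rewrite all_cat /= => /and3P[_ /eqP s2 _]; rewrite !vw_cat.
  apply: (ctx (vw a) (vw z) [:: (s, false); (s, false)] [::]).
  exact/pres_rel/(dyer_power s2).
move=> _; rewrite !vw_cat; apply: ctx; apply: pres_rel.
have alt x y j : vw (altw j x y) = alt_word j x y.
  by rewrite /vw /altw /alt_word /mkseq -map_comp.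
have mts : mlabel G t s = Some k by rewrite mlabelC.
have ts : t != s by rewrite eq_sym.
rewrite !raltE; case: odd; rewrite !alt; exact: dyer_braid.
Qed.

Lemma vw_chain L (u w : seq V) : tchain (cmV G) L order2 u w -> pres_eq (dyer_rel G) (vw u) (vw w).
Proof.
case=> p [hp <- ap]; elim: p u hp ap => [|x p IH] u /=; first by move=> *; exact: pres_refl.
case/andP => /asboolP ux hp /andP[/andP[_ u2] ap].
apply: pres_trans (IH _ hp ap); have /andP[/andP[_ x2] _] := ap.
by case: ux => h; [|apply: pres_sym]; exact: vw_step.
Qed.

Local Notation gen := (@dyer_gen V G).
Local Notation cls := (@pres_class V (dyer_rel G)).

Lemma cls_cat (u w : word V) : cls (u ++ w) = (cls u * cls w)%g.
Proof. by apply/pres_classP/pres_cat; apply: pres_sym; exact: repr_pres_class. Qed.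

Lemma cls_inv w : cls (inv_word w) = ((cls w)^-1)%g.
Proof.
apply: (mulgI (cls w)); rewrite -cls_cat mulgV.
by apply/pres_classP; exact: inv_wordr.
Qed.

Definition gens A : set (dyer_group G) := [set gen v | v in [set` A]].

Lemma crit_conj A A' b : crit A A' b -> conj_subset (gens A) (gens A').
Proof.
case=> hP Qb h1 h2; exists (cls (vw b)).
have comm p : p \in A -> ~~ order2 p -> (cls (vw b) * gen p = gen p * cls (vw b))%g.
  move=> pA p2; rewrite /dyer_gen /pres_gen -!cls_cat; apply/pres_classP.
  elim: b Qb {h1 h2} => [_|u b IH /= /andP[/andP[u2 /forallP /(_ p)]]].
    exact: pres_refl.
  rewrite pA p2 => /eqP mup /IH h.
  have up : u != p by apply: contraTneq u2 => ->.
  apply: pres_trans (pres_cat (pres_refl _ [:: (u, false)]) h) _.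
  exact: pres_cat (pres_rel (dyer_braid up mup)) (pres_refl _ _).
have chain L y y' : tchain (cmV G) L order2 (rcons b y) (y' :: b) ->
    (cls (vw b) * gen y * (cls (vw b))^-1 = gen y')%g.
  move=> /vw_chain /pres_classP; rewrite {1}/vw map_rcons -cats1 -/(vw b).
  rewrite -[vw (_ :: _)]/([:: (y', false)] ++ vw b) !cls_cat.
  by rewrite /dyer_gen /pres_gen => ->; rewrite mulgK.
rewrite eqEsubset; split=> x.
  case=> _ [y /= yA <-] <-; have [y2|y2] := boolP (order2 y).
    by have [y' [yA' _ /chain->]] := h1 y yA y2; exists y'.
  by exists y; rewrite /= -?hP // comm // mulgK.
case=> y' /= yA' <-; have [y2|y2] := boolP (order2 y').
  have [y [yA _ /chain e]] := h2 y' yA' y2.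
  by exists (gen y) => //; exists y.
have yA : y' \in A by rewrite hP.
by exists (gen y'); [exists y'|rewrite comm // mulgK].
Qed.

Lemma generated_word A x : generated (gens A) x ->
  exists2 w, all (mem A) [seq a.1 | a <- w] & x = cls w.
Proof.
move: x; rewrite -/(generated (gens A) `<=`
  [set x | exists2 w, all (mem A) [seq a.1 | a <- w] & x = cls w]).
apply: smallest_sub.
  split; first by exists [::].
  move=> _ _ [w hw ->] [w' hw' ->]; exists (w ++ inv_word w').
    by rewrite map_cat all_cat hw /inv_word map_rev all_rev -map_comp.
  by rewrite cls_cat cls_inv.
by move=> _ [v /= vA <-]; exists [:: (v, false)]; rewrite //= vA.
Qed.

(** * From conjugate parabolic subgroups to the criterion *)

Variable R : realType.
Notation acD := (@act R _ (cmD G)).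
Notation acV := (@act R _ (cmV G)).
Notation sroot := (@sroot R _).

Lemma conj_word A A' a : conj_set (cls a) (generated (gens A)) = generated (gens A') ->
  forall v, v \in A -> exists2 w, all [pred s | s.1 \in A'] w &
    acD (dw a ++ [:: (v, false); (v, true)] ++ rev (dw a)) =1 acD w.
Proof.
move=> h v vA.
have /generated_word[w hw e] : generated (gens A') (cls a * gen v * (cls a)^-1)%g.
  by rewrite -h; exists (gen v) => //; apply: generated_sub; exists v.
exists (dw w); first exact: all_dw.
move: e; rewrite -[gen v]/(cls [:: (v, false)]) -cls_inv -!cls_cat.
by move=> /pres_classP /dw_act e z; rewrite -e !dw_cat dw_inv catA.
Qed.

(** The conjugate of the rotation of [v] is a word over [A'], so it displaces every vector within
    the span for [A']. Suitable vectors in the plane of the two roots of [v] then exhibit each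
    root. *)
Lemma conj_span A A' a : conj_set (cls a) (generated (gens A)) = generated (gens A') ->
  forall s, s.1 \in A -> span [pred s | s.1 \in A'] (acD (dw a) (sroot s)).
Proof.
move=> /conj_word h [v i] /= vA; have [w hw e] := h v vA.
pose J : pred (V * bool) := [pred s | s.1 \in A'].
set s0 := (v, false); set s1 := (v, true).
have s01 : s0 != s1 by apply/eqP.
set c := cc R (cmD G) s0 s1.
have c4 : 4 - c ^+ 2 != 0.
  rewrite subr_eq0 eq_sym; apply: cval_sqr_neq4.
  exact: (cm_gt1 (cmD G) (elimN eqP s01)).
have spZ (x : R) z : x != 0 -> span J (x *: z) -> span J z.
  move=> x0 hz t nt; apply/eqP; have /eqP := hz t nt; rewrite vZE mulf_eq0.
  by rewrite (negPf x0).
have spB z z' : span J z -> span J z' -> span J (z - z').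
  by move=> h1 h2 t nt; rewrite !ffunE h1 // h2 // subr0.
have diff z : span J (acD (dw a) (refl (cmD G) s0 (refl (cmD G) s1 z) - z)).
  rewrite actD actN.
  have -> : acD (dw a) (refl (cmD G) s0 (refl (cmD G) s1 z)) = acD w (acD (dw a) z).
    by rewrite -e !act_cat act_revK.
  exact: act_sub_span.
have k00 s : prj (cmD G) s (sroot s) = 2 :> R by rewrite prj_sroot /kf eqxx.
have k01 : prj (cmD G) s0 (sroot s1) = - c.
  by rewrite prj_sroot /kf eq_sym (negPf s01) /cc cm_sym.
have k10 : prj (cmD G) s1 (sroot s0) = - c.
  by rewrite prj_sroot /kf (negPf s01).
have h0 : span J (acD (dw a) (sroot s0)).
  apply: (spZ (- (4 - c ^+ 2))); first by rewrite oppr_eq0.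
  (* This vector is orthogonal to [sroot s1], so the rotation moves it along [sroot s0] only. *)
  have := diff (2 *: sroot s0 + c *: sroot s1).
  set z := 2 *: _ + _.
  have z1 : prj (cmD G) s1 z = 0 by rewrite prjD !prjZ k10 k00; ring.
  have z0 : prj (cmD G) s0 z = 4 - c ^+ 2 by rewrite prjD !prjZ k01 k00; ring.
  by rewrite [refl _ s1 z]/refl z1 scale0r subr0 /refl z0 addrC addKr -scaleNr actZ.
case: i => //.
apply: (spZ (- (4 - c ^+ 2))); first by rewrite oppr_eq0.
(* This one is orthogonal to [sroot s0], but the reflection [s1] acts first, so a multiple of
   [sroot s0] appears too; [h0] disposes of it. *)
have := diff (2 *: sroot s1 + c *: sroot s0).
set z := 2 *: _ + _.
have z0 : prj (cmD G) s0 z = 0 by rewrite prjD !prjZ k01 k00; ring.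
have z1 : prj (cmD G) s1 z = 4 - c ^+ 2 by rewrite prjD !prjZ k10 k00; ring.
have -> : refl (cmD G) s0 (refl (cmD G) s1 z) - z =
    - (4 - c ^+ 2) *: sroot s1 - ((4 - c ^+ 2) * c) *: sroot s0.
  rewrite [refl _ s1 z]/refl z1 /refl prjD prjN prjZ z0 k01.
  rewrite sub0r mulrN opprK -[X in X - z]addrA [z + (_ + _)]addrC addrK.
  by rewrite scaleNr.
rewrite actD actN !actZ => h1.
have h2 : span J ((4 - c ^+ 2) * c *: acD (dw a) (sroot s0)).
  by move=> t nt; rewrite vZE h0 // mulr0.
move=> t nt; have := h1 t nt; rewrite ffunE [(- _ : {ffun _ -> _}) t]ffunE h2 // subr0.
by [].
Qed.

Definition commuting_letter A : pred (V * bool) := [pred s |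
  [forall p, (p \in A) && ~~ order2 p ==> (s.1 != p) && (mlabel G s.1 p == Some 2%N)]].

Lemma commuting_letter_refl A s p i : commuting_letter A s -> p \in A -> ~~ order2 p ->
  refl (cmD G) s (sroot (p, i)) = sroot (p, i).
Proof.
move=> /forallP /(_ p) + pA p2; rewrite pA p2 => /andP[sp /eqP m2].
apply: refl_commute; first by apply: contraNneq sp => ->.
by rewrite /= /dlabel /= (negPf sp) m2; case: ifP.
Qed.

(** The last letter [s] of [d] has its root made negative, so it is not a reflection of [p], and
    [infinite_label_commute] excludes an infinite label; label 2 remains. Such an [s] fixes the
    roots of [p], so the hypothesis passes to the rest of [d]. *)
Lemma commuting_letters A (d : seq (V * bool)) : reduced R (cmD G) d ->
  (forall p i, p \in A -> ~~ order2 p -> exists t, acD d (sroot (p, i)) = sroot t) ->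
  all (commuting_letter A) d.
Proof.
elim/last_ind: d => // d s IH red h; rewrite all_rcons.
have redd : reduced R (cmD G) d by move: red; rewrite -cats1; exact: reduced_prefix.
have ns : pos (- acD (rcons d s) (sroot s)).
  rewrite act_rcons refl_sroot actN opprK; apply: (@reduced_pos R _ (cmD G) d s [::]).
  by rewrite cats1.
have cs : commuting_letter A s.
  apply/forallP => p; apply/implyP => /andP[pA p2].
  have sp : s.1 != p.
    apply/eqP => sp; have [t e] := h p s.2 pA p2.
    apply: (@pos_neg_root R _ (cmD G) [::] t); first exact: pos_sroot.
    by rewrite [act _ [::] _]/= -e -sp -surjective_pairing.
  rewrite sp /=; have [mn|] := @mlabel_ge3 V G p s.1 p2; last by rewrite mlabelC => ->.
  have [t e] := h p s.2 pA p2.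
  case: (@infinite_label_commute R _ (cmD G) (rcons d s) s (p, s.2) t _ _ e ns).
    by apply: contraNneq sp => {1}->.
  by rewrite /= /dlabel /= (negPf sp) eqxx mlabelC.
rewrite cs; apply: IH redd _ => p i pA p2; have [t e] := h p i pA p2; exists t.
by rewrite -e act_rcons (commuting_letter_refl i cs).
Qed.

Lemma commuting_letters_fix A (d : seq (V * bool)) p i : all (commuting_letter A) d ->
  p \in A -> ~~ order2 p -> acD d (sroot (p, i)) = sroot (p, i).
Proof.
move=> + pA p2; elim: d => //= s d IH /andP[cs /IH->].
exact: commuting_letter_refl cs pA p2.
Qed.

(** The letters of a reduced form of [d] commute with [p], so its simple roots are fixed and [p]
    itself must lie in [A']. *)
Lemma conj_order3 A A' (d : seq (V * bool)) :
  (forall s, s.1 \in A -> exists2 t, t.1 \in A' & acD d (sroot s) = sroot t) ->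
  forall p, ~~ order2 p -> p \in A -> p \in A'.
Proof.
move=> h p p2 pA; have [d' e red] := exists_reduced R (cmD G) d.
have cd : all (commuting_letter A) d'.
  apply: commuting_letters red _ => q i qA q2; have [t _ et] := h (q, i) qA.
  by exists t; rewrite e.
have [t tA et] := h (p, false) pA.
move: tA; suff <- : (p, false) = t by [].
apply: (@sroot_inj R); rewrite -et -e.
by rewrite (commuting_letters_fix false cd).
Qed.

Lemma kill1 y : order2 y -> kill G [:: (y, false)] = [:: y].
Proof. by rewrite /kill /order2 /= => ->. Qed.

(** If [s] were forgotten, [y] would act trivially, although it negates its own root. *)
Lemma kill_not_nil b s y : acV (rcons b y) =1 acV (kill G [:: s] ++ b) ->
  kill G [:: s] = [:: s.1] /\ order2 s.1.
Proof.
rewrite /kill /=; case: ifP => [/andP[_ s2] _|_ e]; first by split.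
have := e (sroot y); rewrite act_rcons refl_sroot actN /= => /eqP.
rewrite eq_sym -addr_eq0 -mulr2n -scaler_nat scaler_eq0 pnatr_eq0 /=.
by move=> /eqP /root_neq0.
Qed.

Lemma kill_not_nil' b s y : acV (b ++ kill G [:: s]) =1 acV (y :: b) ->
  kill G [:: s] = [:: s.1] /\ order2 s.1.
Proof.
rewrite /kill /=; case: ifP => [/andP[_ s2] _|_ e]; first by split.
have := e (acV (rev b) (sroot y)); rewrite cats0 act_Krev act_cons act_Krev.
rewrite refl_sroot => /eqP; rewrite -addr_eq0 -mulr2n -scaler_nat scaler_eq0.
by rewrite pnatr_eq0 /= => /eqP /(@root_neq0 R _ (cmV G) [::]).
Qed.

(** The relation identifies the reflection in the image of [sroot y] with [y'], so the two roots are
    proportional, though possibly with opposite signs. *)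
Lemma conj_letter_span b y y' (J : pred V) : J y' -> acV (rcons b y) =1 acV (y' :: b) ->
  span J (acV b (sroot y)).
Proof.
move=> Jy' e; have := e (sroot y); rewrite act_rcons refl_sroot actN act_cons /refl.
set x := acV b _; move/eqP; rewrite eq_sym subr_eq addrC => /eqP ex t nt.
have : (x + x) t = 0.
  rewrite {1}ex subrK vZE ffunE; case: eqP => [tt|]; last by rewrite mulr0.
  by move: nt; rewrite tt Jy'.
by rewrite ffunE -mulr2n => /eqP; rewrite mulrn_eq0 => /eqP.
Qed.

(** The double coset argument is used twice: for the doubled group, to make the letters commute with
    the generators of order at least 3, and again after forgetting, with letters confined to
    [commuting A]. *)
Lemma conj_crit A A' N : (0 < N)%N ->
  (forall u v k, mlabel G u v = Some k -> (k %| N)%N) ->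
  conj_parabolic (gens A) (gens A') ->
  exists2 b, (size b <= #|V| ^ #|V| * move_bound V N)%N & crit A A' b.
Proof.
move=> N0 mN [x]; have -> : x = cls (repr x) by rewrite pres_class_repr.
move: (repr x) => {x} a hc.
have hcV : conj_set (cls (inv_word a)) (generated (gens A')) = generated (gens A).
  by rewrite cls_inv; apply: conj_setV.
pose I : pred (V * bool) := [pred s | s.1 \in A].
pose J : pred (V * bool) := [pred s | s.1 \in A'].
have hI s : I s -> span J (acD (dw a) (sroot s)) by exact: conj_span hc s.
have hJ s : J s -> span I (acD (rev (dw a)) (sroot s)).
  by rewrite -dw_inv; exact: conj_span hcV s.
have [d0 [_ d0I d0J]] := conj_span_conj_simple (all_predT (dw a)) hI hJ.
have [d ed red] := exists_reduced R (cmD G) d0.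
have dI s : s.1 \in A -> exists2 t, t.1 \in A' & acD d (sroot s) = sroot t.
  by move=> /d0I[t tJ e]; exists t; rewrite ?ed.
have dJ t : t.1 \in A' -> exists2 s, s.1 \in A & acD d (sroot s) = sroot t.
  by move=> /d0J[s sI e]; exists s; rewrite ?ed.
have hP p : ~~ order2 p -> (p \in A) = (p \in A').
  move=> p2; apply/idP/idP; first exact: conj_order3 dI p p2.
  apply: (@conj_order3 A' A (rev d)) p2 => t /dJ[s sA <-].
  by exists s => //; rewrite act_revK.
have cd : all (commuting_letter A) d.
  apply: commuting_letters red _ => q i qA _; have [t _ et] := dI (q, i) qA.
  by exists t.
pose b := kill G d.
have Qb : all (commuting A) b.
  rewrite all_map all_filter; apply: sub_all cd => s cs; apply/implyP => /andP[_ s2].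
  apply/andP; split=> //; apply/forallP => p; apply/implyP => hp.
  by have /forallP /(_ p) := cs; rewrite hp => /andP[].
have eI y : y \in A -> order2 y -> exists y', [/\ y' \in A', order2 y' & acV (rcons b y) =1 acV (y' :: b)].
  move=> yA y2; have [t tA et] := dI (y, false) yA.
  have /kill_act := act_sroot et; rewrite kill_rcons -[t :: d]/([:: t] ++ d) kill_cat.
  rewrite (kill1 y2) cats1 -/b => e.
  have [kt t2] := kill_not_nil e.
  by exists t.1; split=> //; rewrite kt in e.
have eJ y' : y' \in A' -> order2 y' -> exists y, [/\ y \in A, order2 y & acV (rcons b y) =1 acV (y' :: b)].
  move=> yA y2; have [s sA es] := dJ (y', false) yA.
  have /kill_act := act_sroot es.
  rewrite kill_rcons -[_ :: d]/([:: (y', false)] ++ d) kill_cat.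
  rewrite (kill1 y2) -/b => e.
  have [ks s2] := kill_not_nil' e.
  by exists s.1; split=> //; rewrite ks cats1 in e.
(* The relations kept by [kill] determine images of roots only up to sign. This suffices for
   inclusions of spans, from which simple roots are sent to simple roots anew. *)
pose I2 : pred V := [pred y | (y \in A) && order2 y].
pose J2 : pred V := [pred y | (y \in A') && order2 y].
have bI y : I2 y -> span J2 (acV b (sroot y)).
  move=> /andP[yA y2]; have [y' [yA' y2' e]] := eI y yA y2.
  by apply: conj_letter_span e; rewrite /J2 /= yA'.
have bJ y' : J2 y' -> span I2 (acV (rev b) (sroot y')).
  move=> /andP[yA' y2']; have [y [yA y2 e]] := eJ y' yA' y2'.
  apply: (@conj_letter_span (rev b) y' y); first by rewrite /I2 /= yA.
  by move=> v; have := eq_act_rev e v; rewrite rev_rcons rev_cons => ->.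
have [d2 [Qd2 d2I d2J]] := conj_span_conj_simple Qb bI bJ.
pose f y := odflt y [pick y' | J2 y' && (acV d2 (sroot y) == sroot y')].
have fP y : I2 y -> J2 (f y) /\ acV d2 (sroot y) = sroot (f y).
  move=> /d2I[y' Jy' e]; rewrite /f; case: pickP => [z /andP[Jz /eqP->] //|].
  by move=> /(_ y'); rewrite Jy' e eqxx.
have mN' s t : s != t -> (if cmV G s t is Some k then k %| N else true)%N.
  by move=> _; case e: (cmV G s t) => [k|] //; exact: mN e.
have [|d3 [Qd3 sd3 ed3]] := @bounded_conj R V (cmV G) N N0 mN' (commuting A) I2 d2 f Qd2.
  by move=> y /fP[].
exists d3 => //.
have o2 : all order2 d3 by apply: sub_all Qd3 => u /andP[].
have step y : I2 y -> order2 (f y) -> tchain (cmV G) (size d3).+1 order2 (rcons d3 y) (f y :: d3).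
  move=> Iy f2; have /andP[_ y2] := Iy.
  have := @tits R V (cmV G) order2 (rcons d3 y) (f y :: d3).
  rewrite size_rcons maxnn; apply; rewrite ?all_rcons /= ?o2 ?andbT //.
  exact/act_sroot/ed3.
split=> //.
  move=> y yA y2; have Iy : I2 y by rewrite /I2 /= yA.
  have [/andP[fA f2] _] := fP y Iy; exists (f y); split=> //; exact: step.
move=> y' yA y2'; have [|y Iy e] := d2J y'; first by rewrite /J2 /= yA.
have [/andP[fA f2] ef] := fP y Iy.
have fy : f y = y' by apply: (@sroot_inj R); rewrite -ef e.
have /andP[yA' y2] := Iy; exists y; split=> //.
by rewrite -fy; exact: step.
Qed.

End Criterion.

Local Close Scope ring_scope.

(** * Primitive recursive functions *)

(** Closure lemmas for the existence of a program replace explicit programs. Minimisation is avoided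
    throughout: every search has a computable bound, so evaluation always halts. *)
Definition pr (k : nat) (f : seq nat -> nat) : Prop :=
  exists p : recfun k, forall a : k.-tuple nat, rf_eval p a (f a).

Definition prb (k : nat) (f : seq nat -> bool) : Prop :=
  pr k (fun e => nat_of_bool (f e)).

Lemma pr_eq k (f g : seq nat -> nat) : (forall a : k.-tuple nat, f a = g a) -> pr k f -> pr k g.
Proof. by move=> h [p hp]; exists p => a; rewrite -h. Qed.

Lemma pr_var k i : i < k -> pr k (fun e => nth 0 e i).
Proof.
move=> ik; exists (rf_proj (Ordinal ik)) => a /=.
by rewrite (tnth_nth 0).
Qed.

Lemma pr_comp k fs g : pr (size fs) g -> (forall i, i < size fs -> pr k (nth (fun=> 0) fs i)) ->
  pr k (fun e => g [seq f e | f <- fs]).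
Proof.
case=> p hp hfs.
have [h hh] : exists h : 'I_(size fs) -> recfun k, forall i (a : k.-tuple nat),
    rf_eval (h i) a (nth (fun=> 0) fs i a).
  exists (fun i : 'I_(size fs) => projT1 (cid (hfs i (ltn_ord i)))) => i a.
  by case: cid.
exists (rf_comp p h) => a /=.
exists (map_tuple (fun f : seq nat -> nat => f a) (in_tuple fs)).
  by move=> i; rewrite (tnth_nth 0) /= (nth_map (fun=> 0)).
exact: (hp (map_tuple (fun f : seq nat -> nat => f a) (in_tuple fs))).
Qed.

Lemma pr_const k n : pr k (fun=> n).
Proof.
elim: n => [|n IH]; first by exists (rf_zero k).
have hs : pr 1 (fun e => (head 0 e).+1).
  by exists rf_succ => a /=; rewrite /thead (tnth_nth 0) /= nth0.
apply: (pr_comp (fs := [:: fun=> n]) hs) => -[|[]] //.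
Qed.

Lemma pr_succ k f : pr k f -> pr k (fun e => (f e).+1).
Proof.
move=> hf; have hs : pr 1 (fun e => (head 0 e).+1).
  by exists rf_succ => a /=; rewrite /thead (tnth_nth 0) /= nth0.
by apply: (pr_comp (fs := [:: f]) hs) => -[|[]].
Qed.

Fixpoint prec (b : nat) (s : nat -> nat -> nat) (n : nat) : nat :=
  if n is n'.+1 then s n' (prec b s n') else b.

Lemma pr_prim k b s : pr k b -> pr k.+2 (fun e => s (behead (behead e)) (head 0 e) (head 0 (behead e))) ->
  pr k.+1 (fun e => prec (b (behead e)) (s (behead e)) (head 0 e)).
Proof.
move=> [p hp] [q hq]; exists (rf_prim p q) => a /=.
exists (prec (b (behead a)) (s (behead a))); split.
- exact: (hp [tuple of behead a]).
- by move=> i _; exact: (hq [tuple of i :: prec (b (behead a)) (s (behead a)) i :: behead a]).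
- by rewrite /thead (tnth_nth 0) nth0.
Qed.

Lemma map_nth_iota (e : seq nat) : [seq nth 0 e i | i <- iota 0 (size e)] = e.
Proof. by rewrite map_nth_iota0 // take_size. Qed.

Lemma pr_rec k n b s : pr k n -> pr k b ->
  pr k.+2 (fun e => s (behead (behead e)) (head 0 e) (head 0 (behead e))) ->
  pr k (fun e => prec (b e) (s e) (n e)).
Proof.
move=> hn hb hs; have h := pr_prim hb hs.
pose fs := n :: [seq (fun e => nth 0 e i) | i <- iota 0 k].
have sfs : size fs = k.+1 by rewrite /= size_map size_iota.
apply: pr_eq (pr_comp (fs := fs) (g := fun e => prec (b (behead e)) (s (behead e)) (head 0 e)) _ _).
- move=> a /=; rewrite -map_comp.
  have -> : [seq ((@^~ (tval a)) \o (fun (i : nat) (e : seq nat) => nth 0 e i)) i | i <- iota 0 k] = a.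
    by rewrite -[k in iota 0 k](size_tuple a) -[RHS]map_nth_iota.
  by [].
- by rewrite sfs.
- rewrite sfs => -[|i] //= ik.
  by rewrite (nth_map 0) ?size_iota // nth_iota // add0n; exact: pr_var.
Qed.

Lemma pr_behead k f : pr k f -> pr k.+1 (fun e => f (behead e)).
Proof.
move=> hf; pose fs := [seq (fun e : seq nat => nth 0 e i) | i <- iota 1 k].
have sfs : size fs = k by rewrite /= size_map size_iota.
apply: pr_eq (pr_comp (fs := fs) (g := f) _ _).
- move=> a /=; rewrite -map_comp; congr f.
  case/tupleP: a => x a /=.
  rewrite -[RHS]map_nth_iota size_tuple -[1]addn0 iotaDl -map_comp.
  by apply: eq_map => i.
- by rewrite sfs.
- rewrite sfs => i ik.
  by rewrite (nth_map 0) ?size_iota // nth_iota // add1n; exact: pr_var.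
Qed.

(** In a recursion the accumulator sits between the counter and the parameters; the body of a
    bounded count must not see it. *)
Lemma pr_skip1 k f : pr k.+1 f -> pr k.+2 (fun e => f (head 0 e :: behead (behead e))).
Proof.
move=> hf; pose fs := (fun e => nth 0 e 0) :: [seq (fun e : seq nat => nth 0 e i) | i <- iota 2 k].
have sfs : size fs = k.+1 by rewrite /= size_map size_iota.
apply: pr_eq (pr_comp (fs := fs) (g := f) _ _).
- move=> a; rewrite /fs [map _ (_ :: _)]/= -map_comp; congr f.
  case/tupleP: a => x a; case/tupleP: a => y a /=; congr (_ :: _).
  rewrite -[RHS]map_nth_iota size_tuple -[2]addn0 iotaDl -map_comp.
  by apply: eq_map => i.
- by rewrite sfs.
- rewrite sfs => -[|i] ik /=; first exact: pr_var.
  rewrite ltnS in ik.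
  by rewrite (nth_map 0) ?size_iota // nth_iota // add2n; exact: pr_var.
Qed.

Lemma pr_comp1 (F : nat -> nat) : pr 1 (fun e => F (nth 0 e 0)) ->
  forall k f1, pr k f1 -> pr k (fun e => F (f1 e)).
Proof. by move=> h k f1 h1; apply: (pr_comp (fs := [:: f1]) h) => -[|[]]. Qed.

Lemma pr_comp2 (F : nat -> nat -> nat) : pr 2 (fun e => F (nth 0 e 0) (nth 0 e 1)) ->
  forall k f1 f2, pr k f1 -> pr k f2 -> pr k (fun e => F (f1 e) (f2 e)).
Proof.
by move=> h k f1 f2 h1 h2; apply: (pr_comp (fs := [:: f1; f2]) h) => -[|[|[]]].
Qed.

Lemma pr_comp3 (F : nat -> nat -> nat -> nat) :
  pr 3 (fun e => F (nth 0 e 0) (nth 0 e 1) (nth 0 e 2)) ->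
  forall k f1 f2 f3, pr k f1 -> pr k f2 -> pr k f3 ->
  pr k (fun e => F (f1 e) (f2 e) (f3 e)).
Proof.
move=> h k f1 f2 f3 h1 h2 h3.
by apply: (pr_comp (fs := [:: f1; f2; f3]) h) => -[|[|[|[]]]].
Qed.

Lemma pr_comp4 (F : nat -> nat -> nat -> nat -> nat) :
  pr 4 (fun e => F (nth 0 e 0) (nth 0 e 1) (nth 0 e 2) (nth 0 e 3)) ->
  forall k f1 f2 f3 f4, pr k f1 -> pr k f2 -> pr k f3 -> pr k f4 ->
  pr k (fun e => F (f1 e) (f2 e) (f3 e) (f4 e)).
Proof.
move=> h k f1 f2 f3 f4 h1 h2 h3 h4.
by apply: (pr_comp (fs := [:: f1; f2; f3; f4]) h) => -[|[|[|[|[]]]]].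
Qed.

Lemma pr_comp5 (F : nat -> nat -> nat -> nat -> nat -> nat) :
  pr 5 (fun e => F (nth 0 e 0) (nth 0 e 1) (nth 0 e 2) (nth 0 e 3) (nth 0 e 4)) ->
  forall k f1 f2 f3 f4 f5, pr k f1 -> pr k f2 -> pr k f3 -> pr k f4 -> pr k f5 ->
  pr k (fun e => F (f1 e) (f2 e) (f3 e) (f4 e) (f5 e)).
Proof.
move=> h k f1 f2 f3 f4 f5 h1 h2 h3 h4 h5.
by apply: (pr_comp (fs := [:: f1; f2; f3; f4; f5]) h) => -[|[|[|[|[|[]]]]]].
Qed.

Ltac pr_path := solve [eapply pr_eq; [ | apply: pr_var];
  [by move=> a; rewrite /= -?nth0 ?nth_behead | by []]].

Lemma pr_head k : pr k.+1 (fun e => head 0 e).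
Proof. by apply: pr_eq (pr_var (ltn0Sn k)) => a; rewrite nth0. Qed.

Lemma pr_add k f g : pr k f -> pr k g -> pr k (fun e => f e + g e).
Proof.
move=> hf hg; have h : pr k (fun e => prec (f e) (fun _ r => r.+1) (g e)).
  apply: pr_rec => //; apply: pr_succ; exact: pr_behead (pr_head _).
apply: pr_eq h => a; elim: (g a) => [|n /= ->]; by rewrite ?addn0 ?addnS.
Qed.

Lemma pr_mul k f g : pr k f -> pr k g -> pr k (fun e => f e * g e).
Proof.
move=> hf hg; have h : pr k (fun e => prec 0 (fun _ r => r + f e) (g e)).
  apply: (pr_rec (b := fun=> 0) (s := fun e _ r => r + f e)) => //.
    exact: pr_const.
  by apply: pr_add; [exact: pr_behead (pr_head _)|exact: pr_behead (pr_behead hf)].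
by apply: pr_eq h => a; elim: (g a) => [|n /= ->]; rewrite ?muln0 ?mulnSr.
Qed.

Lemma pr_exp k f g : pr k f -> pr k g -> pr k (fun e => f e ^ g e).
Proof.
move=> hf hg; have h : pr k (fun e => prec 1 (fun _ r => r * f e) (g e)).
  apply: (pr_rec (b := fun=> 1) (s := fun e _ r => r * f e)) => //.
    exact: pr_const.
  by apply: pr_mul; [exact: pr_behead (pr_head _)|exact: pr_behead (pr_behead hf)].
by apply: pr_eq h => a; elim: (g a) => [|n /= ->]; rewrite ?expn0 ?expnSr.
Qed.

Lemma pr_fact k f : pr k f -> pr k (fun e => (f e)`!).
Proof.
move=> hf; have h : pr k (fun e => prec 1 (fun i r => i.+1 * r) (f e)).
  apply: (pr_rec (b := fun=> 1) (s := fun e i r => i.+1 * r)) => //.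
    exact: pr_const.
  by apply: pr_mul; [apply: pr_succ; exact: pr_head|exact: pr_behead (pr_head _)].
by apply: pr_eq h => a; elim: (f a) => [|n /= ->]; rewrite ?factS.
Qed.

Lemma pr_pred k f : pr k f -> pr k (fun e => (f e).-1).
Proof.
move=> hf; have h : pr k (fun e => prec 0 (fun i _ => i) (f e)).
  apply: (pr_rec (b := fun=> 0) (s := fun e i r => i)) => //.
    exact: pr_const.
  exact: pr_head.
by apply: pr_eq h => a; case: (f a).
Qed.

Lemma pr_sub k f g : pr k f -> pr k g -> pr k (fun e => f e - g e).
Proof.
move=> hf hg; have h : pr k (fun e => prec (f e) (fun _ r => r.-1) (g e)).
  apply: pr_rec => //; apply: pr_pred; exact: pr_behead (pr_head _).
by apply: pr_eq h => a; elim: (g a) => [|n /= ->]; rewrite ?subn0 ?subnS.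
Qed.

Lemma prb_leq k f g : pr k f -> pr k g -> prb k (fun e => f e <= g e).
Proof.
move=> hf hg; apply: pr_eq (pr_sub (pr_const k 1) (pr_sub hf hg)) => a.
by rewrite /leq; case: (f a - g a).
Qed.

Lemma prb_not k f : prb k f -> prb k (fun e => ~~ f e).
Proof.
by move=> hf; apply: pr_eq (pr_sub (pr_const k 1) hf) => a; case: (f a).
Qed.

Lemma prb_and k f g : prb k f -> prb k g -> prb k (fun e => f e && g e).
Proof.
by move=> hf hg; apply: pr_eq (pr_mul hf hg) => a; case: (f a); case: (g a).
Qed.

Lemma prb_or k f g : prb k f -> prb k g -> prb k (fun e => f e || g e).
Proof.
move=> hf hg; apply: pr_eq (prb_not (prb_and (prb_not hf) (prb_not hg))) => a.
by rewrite negb_and !negbK.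
Qed.

Lemma prb_imply k f g : prb k f -> prb k g -> prb k (fun e => f e ==> g e).
Proof.
by move=> hf hg; apply: pr_eq (prb_or (prb_not hf) hg) => a; rewrite implybE.
Qed.

Lemma prb_eq k f g : pr k f -> pr k g -> prb k (fun e => f e == g e).
Proof.
move=> hf hg; apply: pr_eq (prb_and (prb_leq hf hg) (prb_leq hg hf)) => a.
by rewrite eqn_leq.
Qed.

Lemma pr_if k b f g : prb k b -> pr k f -> pr k g -> pr k (fun e => if b e then f e else g e).
Proof.
move=> hb hf hg; apply: pr_eq (pr_add (pr_mul hb hf) (pr_mul (prb_not hb) hg)) => a.
by case: (b a); rewrite ?mul1n ?mul0n ?addn0.
Qed.

Lemma prb_if k b f g : prb k b -> prb k f -> prb k g -> prb k (fun e => if b e then f e else g e).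
Proof. by move=> hb hf hg; apply: pr_eq (pr_if hb hf hg) => a; case: (b a). Qed.

Lemma prb_odd k f : pr k f -> prb k (fun e => odd (f e)).
Proof.
move=> hf; have h : pr k (fun e => prec 0 (fun _ r => 1 - r) (f e)).
  apply: (pr_rec (b := fun=> 0) (s := fun e _ r => 1 - r)) => //.
    exact: pr_const.
  by apply: pr_sub; [exact: pr_const|exact: pr_behead (pr_head _)].
by apply: pr_eq h => a; elim: (f a) => //= n ->; case: (odd n).
Qed.

Lemma pr_count k n (p : nat -> seq nat -> bool) : pr k n ->
  prb k.+1 (fun e => p (head 0 e) (behead e)) ->
  pr k (fun e => count (fun i => p i e) (iota 0 (n e))).
Proof.
move=> hn hp; have h : pr k (fun e => prec 0 (fun i r => r + p i e) (n e)).
  apply: (pr_rec (b := fun=> 0) (s := fun e i r => r + p i e)) => //.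
    exact: pr_const.
  apply: pr_add; first exact: pr_behead (pr_head _).
  exact: (pr_skip1 hp).
apply: pr_eq h => a; elim: (n a) => // j IH; rewrite [LHS]/= IH.
by rewrite -[j.+1]addn1 iotaD count_cat /= addn0.
Qed.

Lemma prb_has k n (p : nat -> seq nat -> bool) : pr k n ->
  prb k.+1 (fun e => p (head 0 e) (behead e)) ->
  prb k (fun e => has (fun i => p i e) (iota 0 (n e))).
Proof.
move=> hn hp; apply: pr_eq (prb_leq (pr_const k 1) (pr_count hn hp)) => a.
by rewrite has_count.
Qed.

Lemma prb_all k n (p : nat -> seq nat -> bool) : pr k n ->
  prb k.+1 (fun e => p (head 0 e) (behead e)) ->
  prb k (fun e => all (fun i => p i e) (iota 0 (n e))).
Proof.
move=> hn hp; apply: pr_eq (prb_eq (pr_count hn hp) hn) => a.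
by rewrite all_count size_iota.
Qed.

Lemma pr_iter k n f (g : nat -> nat) : pr k n -> pr k f -> pr 1 (fun e => g (nth 0 e 0)) ->
  pr k (fun e => iter (n e) g (f e)).
Proof.
move=> hn hf hg; have h : pr k (fun e => prec (f e) (fun _ r => g r) (n e)).
  apply: pr_rec => //; apply: (pr_comp1 hg); exact: pr_behead (pr_head _).
by apply: pr_eq h => a; elim: (n a) => //= j ->.
Qed.

Ltac prt1 := first
  [ pr_path | exact: pr_const
  | apply: prb_has | apply: prb_all | apply: prb_and | apply: prb_or
  | apply: prb_imply | apply: prb_not | apply: prb_leq | apply: prb_eq
  | apply: prb_odd | apply: prb_if | apply: pr_count | apply: pr_succ
  | apply: pr_add | apply: pr_sub | apply: pr_mul | apply: pr_exp
  | apply: pr_fact | apply: pr_pred | apply: pr_if ].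

Lemma prb_comp2 (F : nat -> nat -> bool) : prb 2 (fun e => F (nth 0 e 0) (nth 0 e 1)) ->
  forall k f1 f2, pr k f1 -> pr k f2 -> prb k (fun e => F (f1 e) (f2 e)).
Proof. by move=> h; exact: (@pr_comp2 (fun x y => F x y)). Qed.

Lemma prb_comp3 (F : nat -> nat -> nat -> bool) :
  prb 3 (fun e => F (nth 0 e 0) (nth 0 e 1) (nth 0 e 2)) ->
  forall k f1 f2 f3, pr k f1 -> pr k f2 -> pr k f3 ->
  prb k (fun e => F (f1 e) (f2 e) (f3 e)).
Proof. by move=> h; exact: (@pr_comp3 (fun x y z => F x y z)). Qed.

Lemma prb_comp4 (F : nat -> nat -> nat -> nat -> bool) :
  prb 4 (fun e => F (nth 0 e 0) (nth 0 e 1) (nth 0 e 2) (nth 0 e 3)) ->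
  forall k f1 f2 f3 f4, pr k f1 -> pr k f2 -> pr k f3 -> pr k f4 ->
  prb k (fun e => F (f1 e) (f2 e) (f3 e) (f4 e)).
Proof. by move=> h; exact: (@pr_comp4 (fun x y z t => F x y z t)). Qed.

Lemma prb_comp5 (F : nat -> nat -> nat -> nat -> nat -> bool) :
  prb 5 (fun e => F (nth 0 e 0) (nth 0 e 1) (nth 0 e 2) (nth 0 e 3) (nth 0 e 4)) ->
  forall k f1 f2 f3 f4 f5, pr k f1 -> pr k f2 -> pr k f3 -> pr k f4 -> pr k f5 ->
  prb k (fun e => F (f1 e) (f2 e) (f3 e) (f4 e) (f5 e)).
Proof. by move=> h; exact: (@pr_comp5 (fun x y z t u => F x y z t u)). Qed.

Ltac prt := repeat prt1.

(* The head, tail, items and size of a sequence, as functions of its code. *)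
Definition cdvd d c := has (fun q => q * d == c) (iota 0 c.+1).
(** The 2-adic valuation, as [code (n :: s)] is [2 ^ n] times an odd number; it is obtained by
    counting the powers of 2 that divide [c]. *)
Definition chd c := count (fun k => cdvd (2 ^ k.+1) c) (iota 0 c).
(** The quotient by [2 ^ (chd c).+1]: dropping the last binary digit of the odd part leaves the code
    of the tail. *)
Definition ctl c := count (fun q => 2 ^ (chd c).+1 * q.+1 <= c) (iota 0 c).
Definition cnth c i := chd (iter i ctl c).
Definition csize c := count (fun i => 0 < iter i ctl c) (iota 0 c).

Lemma pr_cdvd : prb 2 (fun e => cdvd (nth 0 e 0) (nth 0 e 1)).
Proof. rewrite /cdvd; prt. Qed.

Lemma pr_chd : pr 1 (fun e => chd (nth 0 e 0)).
Proof. rewrite /chd; prt; apply: (prb_comp2 pr_cdvd); prt. Qed.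

Lemma pr_ctl : pr 1 (fun e => ctl (nth 0 e 0)).
Proof. rewrite /ctl; prt; apply: (pr_comp1 pr_chd); prt. Qed.

Lemma pr_cnth : pr 2 (fun e => cnth (nth 0 e 0) (nth 0 e 1)).
Proof.
rewrite /cnth; apply: (pr_comp1 pr_chd); apply: pr_iter; [prt|prt|exact: pr_ctl].
Qed.

Lemma pr_csize : pr 1 (fun e => csize (nth 0 e 0)).
Proof. rewrite /csize; prt; apply: pr_iter; [prt|prt|exact: pr_ctl]. Qed.

Lemma count_ltn n c : count (fun k => k < n) (iota 0 c) = minn n c.
Proof.
elim: c => [|c IH]; first by rewrite minn0.
rewrite -[c.+1 in LHS]addn1 iotaD count_cat IH /= add0n addn0.
by case: (ltnP c n) => cn /=; lia.
Qed.

Local Notation code := CodeSeq.code.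

Lemma code_cons n s : code (n :: s) = 2 ^ n * (code s).*2.+1.
Proof. by []. Qed.

Lemma code_gt0 s : (0 < code s) = (s != [::]).
Proof. by case: s => // n s; rewrite code_cons muln_gt0 expn_gt0. Qed.

Lemma chd_cons n s : chd (code (n :: s)) = n.
Proof.
set c := code _; have c0 : 0 < c by rewrite code_gt0.
have ln : logn 2 c = n.
  rewrite /c code_cons lognM ?expn_gt0 // lognX logn_prime // muln1.
  rewrite (_ : logn 2 _.*2.+1 = 0) ?addn0 //.
  by apply/eqP; rewrite -leqn0 leqNgt logn_gt0 mem_primes /= dvdn2 /= odd_double.
have nc : n <= c.
  by apply/ltnW/(leq_trans (ltn_expl n (ltnSn 1))); rewrite /c code_cons leq_pmulr.
rewrite /chd -[RHS](minn_idPl nc) -count_ltn; apply: eq_count => k.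
rewrite -ln -pfactor_dvdn //; apply/hasP/dvdnP => [[q _ /eqP <-]|[q e]].
  by exists q.
exists q; last by rewrite e.
by rewrite mem_iota /= add0n ltnS e leq_pmulr ?expn_gt0.
Qed.

Lemma ctl_cons n s : ctl (code (n :: s)) = code s.
Proof.
rewrite /ctl chd_cons; set c := code _; set M := 2 ^ n.+1.
have M0 : 0 < M by rewrite expn_gt0.
have -> : code s = c %/ M.
  by rewrite /c /M code_cons expnSr divnMl ?expn_gt0 // -muln2 -addn1 divnMDl // addn0.
rewrite -[RHS](minn_idPl (leq_div c M)) -count_ltn; apply: eq_count => k.
by rewrite leq_divRL // mulnC.
Qed.

Lemma ctl_code s : ctl (code s) = code (behead s).
Proof. by case: s => // n s; exact: ctl_cons. Qed.

Lemma iter_ctl i s : iter i ctl (code s) = code (drop i s).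
Proof.
elim: i s => [|i IH] s; first by rewrite drop0.
by rewrite iterSr ctl_code IH -drop1 drop_drop addn1.
Qed.

Lemma cnth_code s i : cnth (code s) i = nth 0 s i.
Proof.
rewrite /cnth iter_ctl -[i in RHS]addn0 -nth_drop.
by case: (drop i s) => // n s'; rewrite chd_cons.
Qed.

Lemma size_code s : size s <= code s.
Proof.
elim: s => // n s IH; rewrite code_cons /= -[(size s).+1]mul1n.
by rewrite leq_mul ?expn_gt0 // ltnS (leq_trans IH) // -addnn leq_addr.
Qed.

Lemma csize_code s : csize (code s) = size s.
Proof.
rewrite /csize -[RHS](minn_idPl (size_code s)) -count_ltn; apply: eq_count => i.
by rewrite iter_ctl code_gt0 -size_eq0 size_drop subn_eq0 ltnNge.
Qed.

Lemma code_mem x s : x \in s -> x < code s.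
Proof.
elim: s => // n s IH; rewrite inE code_cons => /orP[/eqP->|/IH xs].
  by rewrite (leq_trans (ltn_expl n (ltnSn 1))) // leq_pmulr.
apply: leq_trans xs _; apply: leq_trans (leq_pmull _ (expn_gt0 2 n)).
by rewrite ltnW // ltnS -addnn leq_addr.
Qed.

Lemma code_lt s : code s < 2 ^ (sumn s + size s).
Proof.
elim: s => // n s IH; rewrite code_cons /= -addnA expnD ltn_mul2l expn_gt0 /=.
by rewrite addnS expnS mul2n -doubleS leq_double.
Qed.

(** Bounded entries and bounded size give a bounded code, which turns searches over sequences into
    bounded searches over numbers. *)
Lemma code_ltb b s : all (fun x => x < b) s -> code s < 2 ^ (b * size s).
Proof.
move=> h; apply: leq_trans (code_lt s) _; rewrite leq_exp2l //.
elim: s h => [|x s IH] /=; first by rewrite muln0.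
by case/andP => xb /IH; rewrite mulnS; lia.
Qed.

Lemma has_codeP (P : nat -> bool) B :
  reflect (exists2 s, code s < B & P (code s)) (has P (iota 0 B)).
Proof.
apply: (iffP hasP) => [[c]|[s sB Ps]].
  rewrite mem_iota /= add0n => cB Pc; exists (CodeSeq.decode c);
  by rewrite CodeSeq.decodeK.
by exists (code s); rewrite ?mem_iota.
Qed.

Lemma all_iotaP (P : nat -> bool) B :
  reflect (forall i, i < B -> P i) (all P (iota 0 B)).
Proof.
apply: (iffP allP) => h i; last by rewrite mem_iota /= add0n; exact: h.
by move=> iB; apply: h; rewrite mem_iota.
Qed.

Lemma has_iotaP (P : nat -> bool) B :
  reflect (exists2 i, i < B & P i) (has P (iota 0 B)).
Proof.
apply: (iffP hasP) => -[i]; rewrite ?mem_iota /= => iB Pi; exists i => //.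
by rewrite mem_iota.
Qed.

(** * The algorithm *)

(* [c] is the code of the input; words and chains of words are also given by
   their codes. *)
Definition nvert c := cnth c 0.
Definition vlab c i := cnth c i.+1.
Definition elab c i j := cnth c ((nvert c).+1 + (i * nvert c + j)).
Definition mem1 c i := cnth c ((nvert c).+1 + (nvert c * nvert c + i)) == 1.
Definition mem2 c i :=
  cnth c ((nvert c).+1 + (nvert c * nvert c + (nvert c + i))) == 1.
Definition is2 c i := (i < nvert c) && (vlab c i == 2).

Definition wordb c d w := (csize w <= (csize d).+1) &&
  all (fun i => is2 c (cnth w i)) (iota 0 (csize w)).

Definition delb u w := (csize u == (csize w).+2) &&
  has (fun p => (cnth u p == cnth u p.+1) &&
    all (fun i => cnth w i == cnth u (if i < p then i else i.+2)) (iota 0 (csize w)))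
  (iota 0 (csize w).+1).

(** The condition [0 < elab c s t] excludes the label infinity, which is coded by 0. *)
Definition braidb c u w := (csize u == csize w) &&
  has (fun p => has (fun s => has (fun t =>
      [&& s != t, 0 < elab c s t, p + elab c s t <= csize u &
       all (fun i => if (p <= i) && (i < p + elab c s t) then
            (cnth u i == if odd (i - p) then t else s) &&
            (cnth w i == if odd (i - p) then s else t)
          else cnth u i == cnth w i) (iota 0 (csize u))])
    (iota 0 (nvert c))) (iota 0 (nvert c))) (iota 0 (csize u).+1).

(** Braid moves are reversed by exchanging the two letters, so one direction is tested; deletions
    are tested both ways. *)
Definition stepb c u w := [|| delb u w, delb w u | braidb c u w].

Definition firstb d y u := [&& csize u == (csize d).+1, cnth u (csize d) == y &
  all (fun i => cnth u i == cnth d i) (iota 0 (csize d))].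

Definition lastb d y u := [&& csize u == (csize d).+1, cnth u 0 == y &
  all (fun i => cnth u i.+1 == cnth d i) (iota 0 (csize d))].

Definition chainb c d y y' q := [&& 0 < csize q,
  all (fun j => wordb c d (cnth q j)) (iota 0 (csize q)),
  all (fun j => stepb c (cnth q j) (cnth q j.+1)) (iota 0 (csize q).-1),
  firstb d y (cnth q 0) & lastb d y' (cnth q (csize q).-1)].

(* [c] bounds the number of vertices and [c`!] is a multiple of every finite
   label. *)
Definition conj_bound c := c ^ c * 3 ^ (c * c`!).
(** Bounds the codes of words with letters below [c] and length at most one more than
    [conj_bound c], as [code_ltb] shows. *)
Definition word_bound c := 2 ^ (c * (conj_bound c).+1).
(** A chain without repetition has at most [word_bound c] words, each with a code below
    [word_bound c]. *)
Definition chain_bound c := 2 ^ (word_bound c * word_bound c).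

Definition linkb c d y y' := has (chainb c d y y') (iota 0 (chain_bound c)).

Definition commb c u := is2 c u && all (fun p => mem1 c p && (vlab c p != 2) ==>
  (elab c u p == 2)) (iota 0 (nvert c)).

Definition conjb c d := [&& all (fun i => commb c (cnth d i)) (iota 0 (csize d)),
  all (fun y => mem1 c y && is2 c y ==> has (fun y' =>
    [&& mem2 c y', is2 c y' & linkb c d y y']) (iota 0 (nvert c))) (iota 0 (nvert c)) &
  all (fun y' => mem2 c y' && is2 c y' ==> has (fun y =>
    [&& mem1 c y, is2 c y & linkb c d y y']) (iota 0 (nvert c))) (iota 0 (nvert c))].

Definition checkb c :=
  all (fun p => (vlab c p != 2) ==>
    (mem1 c p ==> mem2 c p) && (mem2 c p ==> mem1 c p)) (iota 0 (nvert c)) &&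
  has (conjb c) (iota 0 (word_bound c)).

(* The dispatch is syntactic: unification would unfold the definitions. *)
Ltac prs := repeat lazymatch goal with
  | |- pr _ (fun e => cnth (@?f e) (@?g e)) => apply: (pr_comp2 pr_cnth)
  | |- pr _ (fun e => csize (@?f e)) => apply: (pr_comp1 pr_csize)
  | |- pr _ (fun e => nvert (@?f e)) => unfold nvert
  | |- pr _ (fun e => vlab (@?f e) (@?g e)) => unfold vlab
  | |- pr _ (fun e => elab (@?f e) (@?g e) (@?h e)) => unfold elab
  | |- prb _ (fun e => mem1 (@?f e) (@?g e)) => unfold mem1
  | |- prb _ (fun e => mem2 (@?f e) (@?g e)) => unfold mem2
  | |- prb _ (fun e => is2 (@?f e) (@?g e)) => unfold is2
  | |- _ => prt1
  end.

Lemma prb_wordb : prb 3 (fun e => wordb (nth 0 e 0) (nth 0 e 1) (nth 0 e 2)).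
Proof. rewrite /wordb; prs. Qed.

Lemma prb_delb : prb 2 (fun e => delb (nth 0 e 0) (nth 0 e 1)).
Proof. rewrite /delb; prs. Qed.

Lemma prb_braidb : prb 3 (fun e => braidb (nth 0 e 0) (nth 0 e 1) (nth 0 e 2)).
Proof. rewrite /braidb; prs. Qed.

Lemma prb_stepb : prb 3 (fun e => stepb (nth 0 e 0) (nth 0 e 1) (nth 0 e 2)).
Proof.
rewrite /stepb; apply: prb_or; first by apply: (prb_comp2 prb_delb); prs.
apply: prb_or; first by apply: (prb_comp2 prb_delb); prs.
by apply: (prb_comp3 prb_braidb); prs.
Qed.

Lemma prb_firstb : prb 3 (fun e => firstb (nth 0 e 0) (nth 0 e 1) (nth 0 e 2)).
Proof. rewrite /firstb; prs. Qed.

Lemma prb_lastb : prb 3 (fun e => lastb (nth 0 e 0) (nth 0 e 1) (nth 0 e 2)).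
Proof. rewrite /lastb; prs. Qed.

Lemma prb_chainb : prb 5 (fun e =>
  chainb (nth 0 e 0) (nth 0 e 1) (nth 0 e 2) (nth 0 e 3) (nth 0 e 4)).
Proof.
rewrite /chainb; apply: prb_and; first by prs.
apply: prb_and; first by apply: prb_all; [prs|apply: (prb_comp3 prb_wordb); prs].
apply: prb_and; first by apply: prb_all; [prs|apply: (prb_comp3 prb_stepb); prs].
apply: prb_and; first by apply: (prb_comp3 prb_firstb); prs.
by apply: (prb_comp3 prb_lastb); prs.
Qed.

Lemma pr_word_bound : pr 1 (fun e => word_bound (nth 0 e 0)).
Proof. rewrite /word_bound /conj_bound; prs. Qed.

Lemma pr_chain_bound : pr 1 (fun e => chain_bound (nth 0 e 0)).
Proof.
rewrite /chain_bound; apply: pr_exp; first by prs.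
by apply: pr_mul; apply: (pr_comp1 pr_word_bound); prs.
Qed.

Lemma prb_linkb : prb 4 (fun e => linkb (nth 0 e 0) (nth 0 e 1) (nth 0 e 2) (nth 0 e 3)).
Proof.
rewrite /linkb.
apply: (prb_has (p := fun q e => chainb (nth 0 e 0) (nth 0 e 1) (nth 0 e 2) (nth 0 e 3) q)).
  by apply: (pr_comp1 pr_chain_bound); prs.
by apply: (prb_comp5 prb_chainb); prs.
Qed.

Lemma prb_commb : prb 2 (fun e => commb (nth 0 e 0) (nth 0 e 1)).
Proof. rewrite /commb; prs. Qed.

Lemma prb_conjb : prb 2 (fun e => conjb (nth 0 e 0) (nth 0 e 1)).
Proof.
rewrite /conjb; apply: prb_and.
  by apply: prb_all; [prs|apply: (prb_comp2 prb_commb); prs].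
apply: prb_and; (apply: prb_all; first by prs); (apply: prb_imply; first by prs);
  (apply: prb_has; first by prs); (apply: prb_and; first by prs);
  (apply: prb_and; first by prs); by apply: (prb_comp4 prb_linkb); prs.
Qed.

Lemma prb_checkb : prb 1 (fun e => checkb (nth 0 e 0)).
Proof.
rewrite /checkb; apply: prb_and; first by prs.
apply: (prb_has (p := fun d e => conjb (nth 0 e 0) d)).
  by apply: (pr_comp1 pr_word_bound); prs.
by apply: (prb_comp2 prb_conjb); prs.
Qed.

(** * Correctness of the elementary tests on codes *)

Lemma delbP (u w : seq nat) :
  reflect (exists a s z, u = a ++ [:: s, s & z] /\ w = a ++ z) (delb (code u) (code w)).
Proof.
rewrite /delb !csize_code; apply: (iffP andP).
- case=> /eqP su /has_iotaP[p pw]; rewrite !cnth_code => /andP[/eqP e /all_iotaP h].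
  have pu : p < size u by lia.
  exists (take p u), (nth 0 u p), (drop p.+2 u); split.
    rewrite -{1}(cat_take_drop p u) (drop_nth 0) // (drop_nth 0) ?e //.
    by rewrite su ltnS.
  apply: (@eq_from_nth _ 0); first by rewrite size_cat size_takel ?size_drop; lia.
  move=> i iw; have := h i iw; rewrite !cnth_code => /eqP->.
  rewrite nth_cat size_takel ?(ltnW pu) //; case: ltnP => ip; first by rewrite nth_take.
  by rewrite nth_drop; congr nth; lia.
- case=> a [s [z [-> ->]]]; split; first by rewrite !size_cat /= !addnS.
  apply/has_iotaP; exists (size a); first by rewrite size_cat ltnS leq_addr.
  rewrite !cnth_code !nth_cat ltnn subnn ltnNge leqnSn /= subSn // subnn eqxx /=.
  apply/all_iotaP => i _; rewrite !cnth_code !nth_cat.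
  case: ltnP => ia; first by rewrite ia.
  have -> : (i.+2 < size a) = false by lia.
  by have -> : i.+2 - size a = (i - size a).+2 by lia.
Qed.

Lemma nth_splice p k (u x : seq nat) i : size x = k -> p + k <= size u -> i < size u ->
  nth 0 (take p u ++ x ++ drop (p + k) u) i =
    if (p <= i) && (i < p + k) then nth 0 x (i - p) else nth 0 u i.
Proof.
move=> sx pk iu; have pu : p <= size u by rewrite (leq_trans (leq_addr k p)).
rewrite !nth_cat size_takel //; case: ltnP => ip /=; first by rewrite nth_take.
rewrite sx; have -> : (i - p < k) = (i < p + k) by lia.
case: ltnP => // ipk; rewrite nth_drop; congr nth; lia.
Qed.

Lemma size_splice p k (u x : seq nat) : size x = k -> p + k <= size u ->
  size (take p u ++ x ++ drop (p + k) u) = size u.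
Proof.
move=> sx pk; have pu : p <= size u by rewrite (leq_trans (leq_addr k p)).
rewrite !size_cat size_takel //.
by rewrite size_drop sx; lia.
Qed.

Lemma size_altw (T : Type) k (s t : T) : size (altw k s t) = k.
Proof. exact: size_mkseq. Qed.

Lemma braidbP c (u w : seq nat) :
  reflect (exists a s t z, [/\ u = a ++ altw (elab c s t) s t ++ z,
      w = a ++ altw (elab c s t) t s ++ z, s != t &
      [&& s < nvert c, t < nvert c & 0 < elab c s t]]) (braidb c (code u) (code w)).
Proof.
rewrite /braidb !csize_code; apply: (iffP andP).
- case=> /eqP su /has_iotaP[p _ /has_iotaP[s sn /has_iotaP[t tn /and4P[st k0 pk /all_iotaP h]]]].
  set k := elab c s t in k0 pk h *.
  exists (take p u), s, t, (drop (p + k) u); split=> //; last by rewrite sn tn.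
    apply: (@eq_from_nth _ 0); first by rewrite size_splice ?size_altw.
    move=> i iu; rewrite nth_splice ?size_altw //; have := h i iu.
    case: ifP => // ip; rewrite !cnth_code => /andP[/eqP-> _].
    by rewrite nth_mkseq //; lia.
  apply: (@eq_from_nth _ 0); first by rewrite size_splice ?size_altw.
  move=> i; rewrite -su => iu; rewrite nth_splice ?size_altw //; have := h i iu.
  case: ifP => ip; rewrite !cnth_code; last by move/eqP.
  by move=> /andP[_ /eqP->]; rewrite nth_mkseq //; lia.
- case=> a [s [t [z [eu ew st /and3P[sn tn k0]]]]]; set k := elab c s t in eu ew k0.
  have ea : a = take (size a) u by rewrite eu take_size_cat.
  have ez : z = drop (size a + k) u.
    by rewrite eu catA drop_size_cat // size_cat size_altw.
  have pk : size a + k <= size u by rewrite eu !size_cat size_altw addnA leq_addr.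
  have su : size u = size w by rewrite eu ew !size_cat !size_altw.
  split; first by rewrite su.
  apply/has_iotaP; exists (size a); first by rewrite ltnS (leq_trans _ pk) // leq_addr.
  apply/has_iotaP; exists s => //; apply/has_iotaP; exists t => //.
  rewrite st k0 pk /=; apply/all_iotaP => i iu; rewrite !cnth_code -/k.
  have eu' : u = take (size a) u ++ altw k s t ++ drop (size a + k) u by rewrite -ea -ez.
  have ew' : w = take (size a) u ++ altw k t s ++ drop (size a + k) u by rewrite -ea -ez.
  have := nth_splice (size_altw k s t) pk iu; rewrite -eu' => ->.
  have := nth_splice (size_altw k t s) pk iu; rewrite -ew' => ->.
  have [ip|_] := boolP ((size a <= i) && (i < size a + k)); last exact: eqxx.
  have ik : i - size a < k by case/andP: ip => i1 i2; rewrite ltn_subLR.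
  by rewrite !nth_mkseq // !eqxx.
Qed.

Lemma firstb_code (d u : seq nat) y : firstb (code d) y (code u) = (u == rcons d y).
Proof.
rewrite /firstb !csize_code; apply/idP/eqP.
- case/and3P => /eqP su /eqP ey /all_iotaP h.
  apply: (@eq_from_nth _ 0); first by rewrite size_rcons.
  move=> i; rewrite su ltnS leq_eqVlt => /orP[/eqP->|id].
    by rewrite -cnth_code ey nth_rcons ltnn eqxx.
  by rewrite nth_rcons id; have := h i id; rewrite !cnth_code => /eqP.
- move=> ->; rewrite size_rcons eqxx cnth_code nth_rcons ltnn eqxx eqxx !andTb.
  by apply/all_iotaP => i id; rewrite !cnth_code nth_rcons id.
Qed.

Lemma lastb_code (d u : seq nat) y : lastb (code d) y (code u) = (u == y :: d).
Proof.
rewrite /lastb !csize_code; apply/idP/eqP.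
- case/and3P => /eqP su /eqP ey /all_iotaP h.
  apply: (@eq_from_nth _ 0); first by rewrite su.
  move=> [|i]; rewrite su => id; first by rewrite -cnth_code ey.
  by have := h i id; rewrite !cnth_code => /eqP.
- move=> ->; apply/and3P; split; [exact: eqxx|by rewrite cnth_code|].
  by apply/all_iotaP => i id; rewrite !cnth_code.
Qed.

Lemma nth_allpairs (T : Type) (x0 : T) (f : T -> T -> nat) (s t : seq T) i j :
  i < size s -> j < size t ->
  nth 0 [seq f x y | x <- s, y <- t] (i * size t + j) = f (nth x0 s i) (nth x0 t j).
Proof.
elim: s i => // x s IH [|i] /= is_ jt; rewrite nth_cat size_map.
  by rewrite mul0n add0n jt (nth_map x0).
rewrite mulSn -addnA ltnNge leq_addr /= addKn.
exact: IH.
Qed.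

(** * Correctness of the algorithm on the code of a Dyer graph *)

Section Input.
Variables (V : finType) (G : dyerGraph V) (vs : seq V) (A A' : {set V}).
Hypothesis vsP : perm_eq vs (enum V).
Implicit Types (u v p y : V).
Local Notation n := (size vs).
Local Notation idx v := (index v vs).
Local Notation c := (dyer_code G vs A A').
Local Notation ci w := (code [seq idx v | v <- w]).

Lemma mem_vs v : v \in vs. Proof. by rewrite (perm_mem vsP) mem_enum. Qed.

Lemma uniq_vs : uniq vs. Proof. by rewrite (perm_uniq vsP) enum_uniq. Qed.

Lemma size_vs : n = #|V|. Proof. by rewrite (perm_size vsP) cardE. Qed.

Lemma idx_lt v : idx v < n. Proof. by rewrite index_mem mem_vs. Qed.

Lemma idx_inj : injective (fun v => idx v).
Proof. by move=> u v e; rewrite -(nth_index u (mem_vs u)) e nth_index // mem_vs. Qed.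

Lemma idx_surj i : i < n -> exists v, idx v = i.
Proof.
move=> iv; have [v0 _] : exists v0 : V, v0 \in vs.
  by case: (vs) iv => // v s _; exists v; rewrite mem_head.
by exists (nth v0 vs i); rewrite index_uniq // uniq_vs.
Qed.

Lemma all_idx (P : nat -> bool) : reflect (forall v, P (idx v)) (all P (iota 0 n)).
Proof.
apply: (iffP (all_iotaP _ _)) => h; first by move=> v; apply: h; exact: idx_lt.
by move=> i /idx_surj[v <-].
Qed.

Lemma has_idx (P : nat -> bool) : reflect (exists v, P (idx v)) (has P (iota 0 n)).
Proof.
apply: (iffP (has_iotaP _ _)) => [[i /idx_surj[v <-] Pv]|[v Pv]]; first by exists v.
by exists (idx v) => //; exact: idx_lt.
Qed.

Lemma nvertE : nvert c = n. Proof. by rewrite /nvert cnth_code. Qed.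

Lemma vlabE v : vlab c (idx v) = label_code (vlabel G v).
Proof.
rewrite /vlab cnth_code /dyer_input /= nth_cat size_map idx_lt.
by rewrite (nth_map v) ?idx_lt // nth_index // mem_vs.
Qed.

Lemma elabE u v : elab c (idx u) (idx v) = label_code (mlabel G u v).
Proof.
rewrite /elab nvertE cnth_code /dyer_input addSn /= nth_cat size_map.
rewrite ltnNge leq_addr /= addKn nth_cat size_allpairs.
have -> : idx u * n + idx v < n * n.
  have := idx_lt u; have := idx_lt v; move: (idx u) (idx v) n => a b k ka kb.
  by apply: (@leq_trans (a.+1 * k)); rewrite ?leq_mul // mulSn addnC ltn_add2r.
by rewrite (nth_allpairs u) ?idx_lt // !nth_index // mem_vs.
Qed.

Lemma mem1E v : mem1 c (idx v) = (v \in A).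
Proof.
rewrite /mem1 nvertE cnth_code /dyer_input addSn /= nth_cat size_map.
rewrite ltnNge leq_addr /= addKn nth_cat size_allpairs ltnNge leq_addr /= addKn.
rewrite nth_cat size_map idx_lt (nth_map v) ?idx_lt // nth_index ?mem_vs //.
by case: (v \in A).
Qed.

Lemma mem2E v : mem2 c (idx v) = (v \in A').
Proof.
rewrite /mem2 nvertE cnth_code /dyer_input addSn /= nth_cat size_map.
rewrite ltnNge leq_addr /= addKn nth_cat size_allpairs ltnNge leq_addr /= addKn.
rewrite nth_cat size_map ltnNge leq_addr /= addKn.
rewrite (nth_map v) ?idx_lt // nth_index ?mem_vs //.
by case: (v \in A').
Qed.

Lemma label_code2 l : (label_code l == 2) = (l == Some 2).
Proof. by case: l => // k; apply/eqP/eqP => [->|[]]. Qed.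

Lemma is2E v : is2 c (idx v) = order2 G v.
Proof. by rewrite /is2 nvertE idx_lt vlabE label_code2. Qed.

Lemma idx_ltc v : idx v < c.
Proof. by apply: leq_trans (idx_lt v) _; apply/ltnW/code_mem; rewrite mem_head. Qed.

Lemma word_of (s : seq nat) : all (fun i => i < n) s -> exists w, s = [seq idx v | v <- w].
Proof.
elim: s => [|i s IH] /=; first by exists [::].
by case/andP => /idx_surj[v <-] /IH[w ->]; exists (v :: w).
Qed.

Lemma map_idx_inj (u w : seq V) : [seq idx v | v <- u] = [seq idx v | v <- w] -> u = w.
Proof. exact: (inj_map idx_inj). Qed.

Lemma map_idx_cat (u : seq V) a b : [seq idx v | v <- u] = a ++ b -> exists a' b',
  [/\ u = a' ++ b', a = [seq idx v | v <- a'] & b = [seq idx v | v <- b']].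
Proof.
move=> e; exists (take (size a) u), (drop (size a) u); split.
- by rewrite cat_take_drop.
- by rewrite map_take e take_size_cat.
- by rewrite map_drop e drop_size_cat.
Qed.

Lemma map_altw (f : V -> nat) k u v : [seq f x | x <- altw k u v] = altw k (f u) (f v).
Proof. by rewrite /altw /mkseq -map_comp; apply: eq_map => i /=; case: ifP. Qed.

Lemma altw_trel a z k u v : u != v -> mlabel G u v = Some k ->
  trel (cmV G) (a ++ altw k u v ++ z) (a ++ altw k v u ++ z).
Proof.
move=> uv muv; have := @tstep_braid _ (cmV G) a u v k z uv muv; rewrite !raltE.
by case: odd => h; apply/asboolP; [left|right].
Qed.

Lemma stepb_trel (u w : seq V) : stepb c (ci u) (ci w) = trel (cmV G) u w.
Proof.
have del (x z : seq V) : delb (ci x) (ci z) -> tstep (cmV G) x z.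
  case/delbP => a [s [b [ex ez]]].
  have [a' [b' [-> ea eb]]] := map_idx_cat ex.
  case: b' eb => [|v [|v' b']] // [e1 e2 eb].
  have vv : v = v' by apply: idx_inj; rewrite -e1 -e2.
  have -> : z = a' ++ b' by apply: map_idx_inj; rewrite ez ea eb map_cat.
  by rewrite -vv; exact: tstep_del.
have br k s t a z x : s != t -> mlabel G s t = Some k ->
    x = a ++ altw k s t ++ z -> braidb c (ci x) (ci (a ++ altw k t s ++ z)).
  move=> st mst ->; apply/braidbP.
  exists [seq idx v | v <- a], (idx s), (idx t), [seq idx v | v <- z].
  rewrite elabE mst /= !map_cat !map_altw; split=> //.
    by rewrite (inj_eq idx_inj).
  rewrite nvertE !idx_lt /=.
  by have := mlabel_gt1 G s t; rewrite mst; exact: ltnW.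
apply/idP/asboolP.
- case/or3P => [/del h|/del h|/braidbP[a [s [t [z [eu ew st]]]]]]; [by left|by right|].
  rewrite nvertE => /and3P[/idx_surj[x ex] /idx_surj[y ey]]; move: eu ew st.
  rewrite -ex -ey elabE (inj_eq idx_inj) => eu ew xy.
  case e: (mlabel G x y) eu ew => [k|] //= eu ew _.
  have [a' [b' [eu1 ea eb]]] := map_idx_cat eu.
  have [x' [z' [eu2 ex' ez]]] := map_idx_cat (esym eb).
  have xE : x' = altw k x y by apply: map_idx_inj; rewrite -ex' map_altw.
  have -> : w = a' ++ altw k y x ++ z'.
    by apply: map_idx_inj; rewrite ew ea ez !map_cat map_altw.
  by rewrite eu1 eu2 xE; exact/asboolP/altw_trel.
- have step x z : tstep (cmV G) x z -> delb (ci x) (ci z) \/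
     (braidb c (ci x) (ci z) /\ braidb c (ci z) (ci x)).
    case=> [a s b|a s t k b st mst].
      left; apply/delbP; exists [seq idx v | v <- a], (idx s), [seq idx v | v <- b].
      by rewrite !map_cat.
    have ts : t != s by rewrite eq_sym.
    have mts : mlabel G t s = Some k by rewrite mlabelC.
    by right; rewrite !raltE; case: odd; split; exact: br.
  by rewrite /stepb; case=> /step[->|[e1 e2]]; rewrite ?e1 ?e2 ?orbT.
Qed.

Lemma wordb_word d (s : seq nat) : wordb c (ci d) (code s) -> exists x : seq V,
  s = [seq idx v | v <- x] /\ (size x <= (size d).+1) && all (order2 G) x.
Proof.
rewrite /wordb !csize_code size_map => /andP[sd /all_iotaP h].
have [x ex] : exists x : seq V, s = [seq idx v | v <- x].
  apply: word_of; apply/(all_nthP 0) => i is_; have := h i is_.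
  by rewrite cnth_code /is2 nvertE => /andP[].
exists x; split=> //; apply/andP; split; first by move: sd; rewrite ex size_map.
apply/allP => v vx; have := h (index v x).
rewrite ex size_map index_mem cnth_code => /(_ vx).
by rewrite (nth_map v) ?index_mem // nth_index // is2E.
Qed.

Lemma word_wordb (d x : seq V) : (size x <= (size d).+1) && all (order2 G) x ->
  wordb c (ci d) (ci x).
Proof.
move=> /andP[sx ox]; rewrite /wordb !csize_code !size_map sx.
apply/all_iotaP => i ix; rewrite cnth_code.
case: x ix ox {sx} => // v0 x ix /(all_nthP v0) ox.
by rewrite (nth_map v0) // is2E ox.
Qed.

Lemma linkb_chain d y y' : linkb c (ci d) (idx y) (idx y') ->
  tchain (cmV G) (size d).+1 (order2 G) (rcons d y) (y' :: d).
Proof.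
case/has_codeP => q _ /and5P[]; rewrite !csize_code !cnth_code.
move=> q0 /all_iotaP hw /all_iotaP hs hf hl.
have {hw} [xs exs axs] : exists2 xs : seq (seq V), q = [seq ci x | x <- xs] &
    all (fun x => (size x <= (size d).+1) && all (order2 G) x) xs.
  have {}hw : all (fun w => wordb c (ci d) w) q.
    by apply/(all_nthP 0) => i iq; have := hw i iq; rewrite cnth_code.
  elim: q hw {q0 hs hf hl} => [|w q IH]; first by exists [::].
  move=> /= /andP[ww /IH[xs -> axs]].
  (* Every number is the code of some sequence, so the test may be read on words. *)
  have := ww; rewrite -(CodeSeq.decodeK w) => /wordb_word[x [-> hx]].
  by exists (x :: xs) => //=; rewrite hx.
move: q0 hs hf hl axs; rewrite exs size_map.
case: xs {exs} => // x0 p _ hs hf hl axs.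
rewrite /= firstb_code -(map_rcons (fun v => idx v)) in hf.
have ex0 := map_idx_inj (eqP hf); rewrite ex0 in hs hl axs.
exists p; split=> //.
  apply/(pathP (rcons d y)) => i ip; have := hs i ip.
  rewrite !cnth_code (nth_map (rcons d y)) ?ltnS ?(ltnW ip) //.
  by rewrite (nth_map (rcons d y)) // stepb_trel.
rewrite (nth_map (rcons d y)) // lastb_code -(map_cons (fun v => idx v)) in hl.
by have := map_idx_inj (eqP hl); rewrite (last_nth (rcons d y)).
Qed.

Lemma nltc : n < c. Proof. by apply: code_mem; rewrite mem_head. Qed.

Lemma code_word_bound (x d : seq V) : size d <= conj_bound c -> size x <= (size d).+1 ->
  ci x < word_bound c.
Proof.
move=> sd sx; apply: leq_trans (@code_ltb c _ _) _.
  by apply/allP => _ /mapP[v _ ->]; exact: idx_ltc.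
by rewrite size_map leq_exp2l // leq_mul2l (leq_trans sx) ?orbT // ltnS.
Qed.

Lemma chain_linkb d y y' : size d <= conj_bound c ->
  tchain (cmV G) (size d).+1 (order2 G) (rcons d y) (y' :: d) ->
  linkb c (ci d) (idx y) (idx y').
Proof.
(* A chain without repeated words is extracted, since the bound on its code relies on
   distinctness. *)
move=> sd [p [hp lp ap]]; case/shortenP: hp lp => p' hp' up' sub lp'.
have {}ap : all (fun x => (size x <= (size d).+1) && all (order2 G) x) (rcons d y :: p').
  move: ap => /= /andP[-> /allP ap] /=; apply/allP => x /sub; exact: ap.
set xs := rcons d y :: p' in up' ap.
apply/has_codeP; exists [seq ci x | x <- xs].
  apply: leq_trans (@code_ltb (word_bound c) _ _) _.
    apply/allP => _ /mapP[x xp ->]; apply: code_word_bound sd _.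
    by have /allP /(_ x xp) /andP[] := ap.
  rewrite size_map /chain_bound leq_exp2l // leq_mul2l; apply/orP; right.
  have -> : size xs = size [seq ci x | x <- xs] by rewrite size_map.
  rewrite -[X in _ <= X](size_iota 0); apply: uniq_leq_size.
    rewrite map_inj_uniq // => x x' /(can_inj CodeSeq.codeK); exact: map_idx_inj.
  move=> _ /mapP[x xp ->]; rewrite mem_iota /= add0n; apply: code_word_bound sd _.
  by have /allP /(_ x xp) /andP[] := ap.
rewrite /chainb !csize_code !cnth_code size_map; apply/and5P; split.
- by [].
- apply/all_iotaP => i ixs; rewrite cnth_code (nth_map (rcons d y)) //.
  by apply: word_wordb; move/all_nthP: ap; apply.
- apply/all_iotaP => i ip; rewrite !cnth_code.
  rewrite !(nth_map (rcons d y)) ?ltnS // ?(ltnW ip) // stepb_trel.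
  by move/(pathP (rcons d y)): hp'; apply.
- by rewrite /= firstb_code map_rcons.
- rewrite (nth_map (rcons d y)) //= lastb_code -[_ :: _]/(map _ (y' :: d)).
  by rewrite -lp' (last_nth (rcons d y)).
Qed.

Lemma commbE u : commb c (idx u) = commuting G A u.
Proof.
rewrite /commb is2E /commuting /=; congr (_ && _); rewrite nvertE.
apply/all_idx/forallP => h p; have := h p;
  by rewrite mem1E vlabE elabE !label_code2.
Qed.

(** Soundness uses no geometry: the chains found are sequences of relations of the Dyer group. *)
Lemma checkb_conj : checkb c -> conj_subset (@gens V G A) (@gens V G A').
Proof.
rewrite /checkb nvertE => /andP[/all_idx hP /has_codeP[s _]].
rewrite /conjb nvertE csize_code => /and3P[/all_iotaP hc /all_idx h1 /all_idx h2].
have [b eb] : exists b, s = [seq idx v | v <- b].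
  apply: word_of; apply/(all_nthP 0) => i is_; have := hc i is_.
  by rewrite cnth_code /commb /is2 nvertE => /andP[/andP[]].
move: hc h1 h2; rewrite {s}eb size_map => hc h1 h2.
apply: (@crit_conj V G A A' b); split.
- move=> p p2; have := hP p; rewrite vlabE label_code2 p2 mem1E mem2E /=.
  by case: (p \in A); case: (p \in A').
- apply/allP => u ub; have := hc (index u b); rewrite index_mem => /(_ ub).
  by rewrite cnth_code (nth_map u) ?index_mem // nth_index // commbE.
- move=> y yA y2; have := h1 y; rewrite mem1E is2E yA y2 => /has_idx[y'].
  by rewrite mem2E is2E => /and3P[yA' y2' /linkb_chain h]; exists y'.
- move=> y' yA' y2'; have := h2 y'; rewrite mem2E is2E yA' y2' => /has_idx[y].
  by rewrite mem1E is2E => /and3P[yA y2 /linkb_chain h]; exists y.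
Qed.

(** Completeness is where the real representation is used; it supplies a conjugating word short
    enough for the search. *)
Lemma conj_checkb (R : realType) : conj_parabolic (@gens V G A) (@gens V G A') -> checkb c.
Proof.
have c0 : 0 < c by exact: leq_ltn_trans nltc.
(* A finite label is an entry of the input, hence smaller than its code, and so divides the
   factorial of the code. *)
have mN u v k : mlabel G u v = Some k -> k %| c`!.
  move=> muv; apply: dvdn_fact; have := mlabel_gt1 G u v; rewrite muv => k1.
  rewrite (ltnW k1) /=; apply/ltnW/code_mem.
  have <- : label_code (mlabel G u v) = k by rewrite muv.
  rewrite /dyer_input inE !mem_cat; apply/orP; right; apply/orP; right.
  by apply/orP; left; apply: allpairs_f; exact: mem_vs.
move=> /(conj_crit R (fact_gt0 c) mN)[b sb [hP Qb h1 h2]].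
have {}sb : size b <= conj_bound c.
  apply: leq_trans sb _; rewrite /move_bound /conj_bound -size_vs leq_mul //.
    apply: (@leq_trans (c ^ n)); last by rewrite leq_pexp2l // ltnW // nltc.
    by case: (n) nltc => // k kc; rewrite leq_exp2r // ltnW.
  by rewrite leq_exp2l // leq_mul2r ltnW ?orbT // nltc.
rewrite /checkb nvertE; apply/andP; split.
  apply/all_idx => p; rewrite vlabE label_code2 mem1E mem2E.
  by apply/implyP => /hP ->; case: (p \in A').
apply/has_codeP; exists [seq idx v | v <- b]; first exact: code_word_bound sb _.
rewrite /conjb nvertE csize_code size_map; apply/and3P; split.
- apply/all_iotaP => i ib; rewrite cnth_code.
  case: b ib Qb {sb h1 h2} => // v0 b ib /(all_nthP v0) Qb.
  by rewrite (nth_map v0) // commbE Qb.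
- apply/all_idx => y; rewrite mem1E is2E; apply/implyP => /andP[yA y2].
  have [y' [yA' y2' h]] := h1 y yA y2; apply/has_idx; exists y'.
  by rewrite mem2E is2E yA' y2' chain_linkb.
- apply/all_idx => y'; rewrite mem2E is2E; apply/implyP => /andP[yA' y2'].
  have [y [yA y2 h]] := h2 y' yA' y2'; apply/has_idx; exists y.
  by rewrite mem1E is2E yA y2 chain_linkb.
Qed.

End Input.

(** * Transport to a Dyer system *)

Local Open Scope classical_set_scope.

Section Transport.
Variables (D E : groupType) (phi : D -> E).
Hypotheses (phiM : {morph phi : x y / (x * y)%g}) (phi_bij : bijective phi).
Implicit Types (Y : set D).
Local Open Scope group_scope.

Lemma iso1 : phi 1 = 1.
Proof. by apply: (mulgI (phi 1)); rewrite -phiM !mulg1. Qed.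

Lemma isoV x : phi x^-1 = (phi x)^-1.
Proof. by apply: (mulgI (phi x)); rewrite -phiM !mulgV iso1. Qed.

Lemma iso_conj_set a Y : conj_set (phi a) (phi @` Y) = phi @` conj_set a Y.
Proof.
rewrite eqEsubset; split=> x.
  by case=> _ [y Yy <-] <-; exists (a * y * a^-1); rewrite ?phiM ?isoV //; exists y.
by case=> _ [y Yy <-] <-; exists (phi y); rewrite ?phiM ?isoV //; exists y.
Qed.

Lemma iso_image_inj Y Z : phi @` Y = phi @` Z -> Y = Z.
Proof.
have sub (A B : set D) : phi @` A `<=` phi @` B -> A `<=` B.
  by move=> h x Ax; have [y By /(bij_inj phi_bij) <-] := h (phi x) (ex_intro2 _ _ x Ax erefl).
by move=> e; rewrite eqEsubset; split; apply: sub; rewrite e.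
Qed.

Lemma iso_generated Y : generated (phi @` Y) = phi @` generated Y.
Proof.
have [psi psiK phiK] := phi_bij.
rewrite eqEsubset; split.
  apply: smallest_sub.
    split; first by exists 1; [move=> H [[]]|exact: iso1].
    move=> _ _ [x hx <-] [y hy <-]; exists (x * y^-1); last by rewrite phiM isoV.
    by move=> H hH; case: (hH) => -[_ h] _; apply: h; [exact: hx|exact: hy].
  by move=> _ [x Yx <-]; exists x => //; exact: generated_sub.
move=> _ [x hx <-].
suff : generated Y `<=` phi @^-1` generated (phi @` Y) by apply.
apply: smallest_sub; last by move=> y Yy; apply: generated_sub; exists y.
split; first by move=> H [[h1 _] _]; rewrite iso1.
move=> y z hy hz H hH; rewrite phiM isoV; case: (hH) => -[_ h] _.
by apply: h; [exact: hy|exact: hz].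
Qed.

Lemma iso_conj_subset Y Z : conj_subset (phi @` Y) (phi @` Z) <-> conj_subset Y Z.
Proof.
have [psi psiK phiK] := phi_bij; split=> -[a]; last first.
  by move=> <-; exists (phi a); rewrite iso_conj_set.
rewrite -(phiK a) iso_conj_set => /iso_image_inj e; by exists (psi a).
Qed.

Lemma iso_conj_parabolic Y Z :
  conj_parabolic (phi @` Y) (phi @` Z) <-> conj_parabolic Y Z.
Proof.
have [psi psiK phiK] := phi_bij; split=> -[a]; last first.
  by move=> e; exists (phi a); rewrite !iso_generated iso_conj_set e.
rewrite -(phiK a) !iso_generated iso_conj_set => /iso_image_inj e.
by exists (psi a).
Qed.

End Transport.

Lemma checkb_correct (V : finType) (G : dyerGraph V) (D : groupType)
    (phi : dyer_group G -> D) (vs : seq V) (A A' : {set V}) :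
  {morph phi : x y / (x * y)%g} -> bijective phi -> perm_eq vs (enum V) ->
  let Y := [set phi (dyer_gen G v) | v in [set` A]] in
  let Y' := [set phi (dyer_gen G v) | v in [set` A']] in
  (checkb (dyer_code G vs A A') <-> conj_parabolic Y Y') /\
  (checkb (dyer_code G vs A A') <-> conj_subset Y Y').
Proof.
move=> phiM phib vsP Y Y'.
have YE : Y = phi @` @gens V G A by rewrite /gens image_comp.
have YE' : Y' = phi @` @gens V G A' by rewrite /gens image_comp.
rewrite YE YE'; have /= [s sp] := (iso_conj_subset phiM phib (@gens V G A) (@gens V G A'),
  iso_conj_parabolic phiM phib (@gens V G A) (@gens V G A')).
have c1 := @checkb_conj V G vs A A' vsP.
have c2 := @conj_checkb V G vs A A' vsP Rdefinitions.R.
have c3 := @conj_subset_parabolic _ (@gens V G A) (@gens V G A').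
(* The implications close up in a cycle: a positive check, conjugate subsets, conjugate parabolic
   subgroups, a positive check. *)
tauto.
Qed.

Theorem theoremA :
  (forall (D : groupType) (X : set D), dyer_system X ->
     forall Y Y' : set D, Y `<=` X -> Y' `<=` X ->
       (conj_parabolic Y Y' <-> conj_subset Y Y'))
  /\
  (exists p : recfun 1,
     forall (V : finType) (G : dyerGraph V) (D : groupType) (X : set D)
       (phi : dyer_group G -> D), dyer_defines X phi ->
     forall vs : seq V, perm_eq vs (enum V) ->
     forall A A' : {set V},
       let Y := [set phi (dyer_gen G v) | v in [set` A]] in
       let Y' := [set phi (dyer_gen G v) | v in [set` A']] in
       exists2 b : bool,
         rf_eval p [tuple dyer_code G vs A A'] (nat_of_bool b) &
         (b <-> conj_parabolic Y Y') /\ (b <-> conj_subset Y Y')).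
Proof.
split.
  move=> D X [_ [V [G [phi [phiM phib [_ _ Xsurj]]]]]] Y Y' YX YX'.
  have sub (Z : set D) : Z `<=` X -> exists A : {set V},
      Z = [set phi (dyer_gen G v) | v in [set` A]].
    (* As [X] is the image of the finite vertex set, each of its subsets comes from a finite set of
       vertices; membership is decided classically. *)
    move=> ZX; exists [set v | `[< Z (phi (dyer_gen G v)) >]]%SET.
    rewrite eqEsubset; split=> x.
      move=> Zx; have [v _ e] := Xsurj x (ZX x Zx).
      have {}e : phi (dyer_gen G v) = x by [].
      by exists v => //=; rewrite inE; apply/asboolP; rewrite e.
    by case=> v /=; rewrite inE => /asboolP Zv <-.
  have [A ->] := sub Y YX; have [A' ->] := sub Y' YX'.
  have [h1 h2] := @checkb_correct V G D phi (enum V) A A' phiM phib (perm_refl _).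
  by rewrite -h1 -h2.
have [p hp] := prb_checkb; exists p => V G D X phi [phiM phib _] vs vsP A A' Y Y'.
exists (checkb (dyer_code G vs A A')); first exact: hp.
exact: checkb_correct.
Qed.
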